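(* Let $d\ge2$ and $\Delta\in\mathbb{R}$. For every $\beta<\beta_c(\Delta)$ there exists $c=c(\beta,\Delta,d)>0$ such that $\langle\sigma_0\sigma_x\rangle^+_{\beta,\Delta}\le e^{-c\|x\|_\infty}$ for every $x\in\mathbb{Z}^d$.
   Context: Blume–Capel model: for a finite subgraph $G=(V,E)$ of $\mathbb{L}^d=(\mathbb{Z}^d,\mathbb{E}^d)$, $\beta>0$, $\Delta\in\mathbb{R}$, boundary condition $\eta\in\{-1,0,1\}^{\mathbb{Z}^d}$, $\mu^\eta_{G,\beta,\Delta}(\sigma)\propto\exp\big(\beta\sum_{xy\in E}\sigma_x\sigma_y+\Delta\sum_{x\in V}\sigma_x^2+\beta\sum_{xy\in\mathbb{E}^d,x\in V,y\notin V}\sigma_x\eta_y\big)$ on $\sigma\in\{-1,0,1\}^V$. $\langle\cdot\rangle^+_{\beta,\Delta}$ is the infinite-volume weak limit of the measures with boundary condition $\eta\equiv1$ on boxes $\Lambda_n=[-n,n]^d$. $\beta_c(\Delta)=\inf\{\beta>0:\langle\sigma_0\rangle^+_{\beta,\Delta}>0\}$. *)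

(* Defs.v *)
From HB Require Import structures.
From mathcomp Require Import all_boot all_order all_algebra.
From mathcomp Require Import all_classical all_reals all_analysis.
Set Implicit Arguments. Unset Strict Implicit. Unset Printing Implicit Defensive.
Import Order.TTheory GRing.Theory Num.Theory numFieldNormedType.Exports.
Local Open Scope ring_scope.
Local Open Scope classical_set_scope.

Section BlumeCapel.
Context {R : realType} (d : nat).

Definition site := 'I_d -> int.
Definition origin : site := fun _ => 0%R.

Definition box (n : nat) := {ffun 'I_d -> 'I_(n.*2.+1)}.
Definition pt n (v : box n) : site := fun i => (v i)%:Z - n%:Z.
Definition inbox (n : nat) (y : site) : bool :=
  [forall i, (- (n%:Z) <= y i) && (y i <= n%:Z)].

Definition config n := {ffun box n -> 'I_3}.
Definition sv (k : 'I_3) : R := k%:R - 1.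

Definition nb (y : site) (j : 'I_d * bool) : site :=
  fun i => if i == j.1 then (if j.2 then y i + 1 else y i - 1) else y i.

Definition plus_ext n (s : config n) (y : site) : R :=
  match [pick v : box n | [forall i, pt v i == y i]] with
  | Some v => sv (s v)
  | None => 1
  end.

(* exponent of the Boltzmann weight:
   beta sum_{xy in E(Lambda_n)} s_x s_y  (each edge counted once, hence /2)
   + Delta sum_x s_x^2
   + beta sum_{x in Lambda_n, y notin Lambda_n, xy edge} s_x eta_y, eta = 1 *)
Definition BC_exponent n (beta Delta : R) (s : config n) : R :=
  beta * ((\sum_(v : box n) \sum_(j : 'I_d * bool)
            (if inbox n (nb (pt v) j)
             then sv (s v) * plus_ext s (nb (pt v) j) else 0)) / 2)
  + Delta * (\sum_(v : box n) sv (s v) ^+ 2)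
  + beta * (\sum_(v : box n) \sum_(j : 'I_d * bool)
            (if inbox n (nb (pt v) j) then 0
             else sv (s v) * plus_ext s (nb (pt v) j))).

Definition BC_expect n (beta Delta : R) (f : config n -> R) : R :=
  (\sum_(s : config n) f s * expR (BC_exponent beta Delta s))
  / (\sum_(s : config n) expR (BC_exponent beta Delta s)).

Definition plus_mag (beta Delta : R) : R :=
  limn (fun n => BC_expect beta Delta (fun s : config n => plus_ext s origin)).

Definition plus_corr (beta Delta : R) (x : site) : R :=
  limn (fun n => BC_expect beta Delta
                   (fun s : config n => plus_ext s origin * plus_ext s x)).

Definition beta_c (Delta : R) : R :=
  inf [set beta : R | 0 < beta /\ 0 < plus_mag beta Delta].

Definition norm_inf (x : site) : nat := \max_(i : 'I_d) `|x i|%N.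

End BlumeCapel.

(* Main.v *)
Require Import Defs.
From HB Require Import structures.
From mathcomp Require Import all_boot all_order all_algebra.
From mathcomp Require Import all_classical all_reals all_analysis.
From mathcomp Require Import ring lra zify.
Import Order.TTheory GRing.Theory Num.Theory.
Local Open Scope ring_scope.

(** The magnetization [m_n] of the box of radius [n] with plus boundary condition satisfies, on
    compact ranges of [beta], [n m_n <= C (1 + m_0 + ... + m_(n-1)) m_n'], and this inequality
    forces exponential decay of [m_n] below any [beta] at which [m_n -> 0]. The theorem follows
    because Griffiths' inequality (freeze the box around the origin just short of [x] in plus)
    gives [<s_0 s_x> <= m_(|x|-1)].

    The inequality is of OSSS type, but no random-cluster measure is needed. Two runs reveal the
    same items, one at a time: whether a site is occupied, and whether a bond is open, a bond
    being open with conditional probability [1 - exp (-2K)] when its end spins are equal and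
    nonzero. Run [I] explores from the plus sites in the model frozen in plus outside a smaller
    box [Lambda_k]; run [J] follows the unfrozen model in [Lambda_n]. If both use the same
    uniform variables, Griffiths' inequality keeps [J] below [I], so the magnetization of [J]
    vanishes whenever [I] fails to reach the origin. Decoupling the two runs one item at a time
    costs, per item, the probability that [I] reaches it times the covariance in [J] of the item
    with [s_0]. The former is at most [m_(k-|x|)] near a site [x]; the latter is bounded by the
    covariance of [s_0] with the bond energy, i.e. by a term of [m_n']. Finally sum over [k < n].

    All the correlation inequalities come from Ginibre's duplication argument, applied to two
    possibly different states of revealed information. *)

Set Implicit Arguments. Unset Strict Implicit. Unset Printing Implicit Defensive.

(** * Ginibre's inequality *)

(** Conditioning on revealed items leaves the class of ferromagnetic measures, so the correlation
    inequalities need an order on states that is preserved by both runs and for which Ginibre's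
    algebra survives. This is why the runs record an open bond differently. In [I] an open bond
    issues from a plus site, so it only spreads plus and then disappears from the weight; once the
    exploration stops, what it has not reached is symmetric under spin flip, and [f J <= f I = 0]
    there. In [J] nothing is plus, so an open bond stays as a factor [1 + s], which the order
    accepts between ends known to be occupied. The spin value zero is what makes sites items of
    their own: given only that a bond is closed, the remaining weight still distinguishes empty ends
    from occupied ones.

    After decoupling, the cost of an item is a product of means because the magnetization of [I] at
    a site is a martingale, equal to one when the site is reached, while covariances in [J] are
    supermartingales.

    In the last part the useful quantity is the logarithmic average of the [m_k]: its derivative
    controls [ln (1 + m_0 + ... + m_(n-1))]. *)

Lemma sv_cases (R : realType) (k : 'I_3) :
  [\/ sv k = -1 :> R, sv k = 0 :> R | sv k = 1 :> R].
Proof.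
case: k => [[|[|[|//]]] ik]; rewrite /sv /=.
- by constructor 1; rewrite sub0r.
- by constructor 2; rewrite subrr.
- by constructor 3; rewrite mulr2n addrK.
Qed.

Lemma eq_ge0 (R : realType) (x y : R) : x = y -> 0 <= x -> 0 <= y.
Proof. by move=> ->. Qed.

Section Model.
Context {R : realType} {V B : finType}.

(* What has been revealed so far. An [Open] bond forces its two ends to agree; a [Closed] one
   only loses its interaction, because both ends are then known to be present or absent. *)
Inductive site_status := Unknown | Absent | Present | Plus.
Inductive bond_status := Free | Closed | Open.
Record state := State { vs : V -> site_status; bs : B -> bond_status }.

Definition cfg := {ffun V -> 'I_3}.
Definition spin (s : cfg) (x : V) : R := sv (s x).

Lemma spin_cases s x : [\/ spin s x = -1, spin s x = 0 | spin s x = 1].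
Proof. exact: sv_cases. Qed.

(* Functions of two configurations [s], [t] that are polynomials with nonnegative coefficients
   in Ginibre's variables [t x + s x] and [t x - s x]. *)
Inductive cone : (cfg -> cfg -> R) -> Prop :=
| cone_c c of 0 <= c : cone (fun _ _ => c)
| cone_u x : cone (fun s t => spin t x + spin s x)
| cone_v x : cone (fun s t => spin t x - spin s x)
| cone_add f g of cone f & cone g : cone (fun s t => f s t + g s t)
| cone_mul f g of cone f & cone g : cone (fun s t => f s t * g s t)
| cone_ext f g of (forall s t, f s t = g s t) & cone f : cone g.

Lemma cone_exp f n : cone f -> cone (fun s t => f s t ^+ n).
Proof.
move=> cf; elim: n => [|n IH].
  by apply: (cone_ext (f := fun _ _ => 1)); [move=> s t; rewrite expr0|constructor].
apply: (cone_ext (f := fun s t => f s t * f s t ^+ n)).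
  by move=> s t; rewrite exprS.
exact: cone_mul.
Qed.

Lemma cone_prod (I : Type) (r : seq I) (P : pred I) (f : I -> cfg -> cfg -> R) :
  (forall i, P i -> cone (f i)) -> cone (fun s t => \prod_(i <- r | P i) f i s t).
Proof.
move=> cf; elim: r => [|i r IH].
  by apply: (cone_ext (f := fun _ _ => 1)); [move=> s t; rewrite big_nil|constructor].
case Pi : (P i); last first.
  by apply: cone_ext IH => s t; rewrite big_cons Pi.
apply: (cone_ext (f := fun s t => f i s t * \prod_(j <- r | P j) f j s t)).
  by move=> s t; rewrite big_cons Pi.
by apply: cone_mul => //; apply: cf.
Qed.

(** [r x] is the joint weight of the two spins at [x]. For a monomial in the variables [t x + s x]
    and [t x - s x] the double sum factorizes over the sites into the moments assumed nonnegative; a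
    general element of the cone is reduced to monomials. *)
Lemma pair_sum_ge0 (r : V -> 'I_3 -> 'I_3 -> R) f :
  (forall x (m n : nat), 0 <= \sum_(k : 'I_3) \sum_(l : 'I_3) r x k l *
     ((sv l + sv k) ^+ m * (sv l - sv k) ^+ n)) ->
  cone f ->
  0 <= \sum_(s : cfg) \sum_(t : cfg) (\prod_x r x (s x) (t x)) * f s t.
Proof.
move=> r0.
pose M (al be : V -> nat) (s t : cfg) : R :=
  \prod_x ((spin t x + spin s x) ^+ al x * (spin t x - spin s x) ^+ be x).
(* All monomial multipliers at once, so that a factor from [cone_u] or [cone_v] merely raises an
   exponent. *)
pose P (f : cfg -> cfg -> R) := forall al be,
  0 <= \sum_(s : cfg) \sum_(t : cfg) (\prod_x r x (s x) (t x)) * (f s t * M al be s t).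
have P1 : P (fun _ _ => 1).
  move=> al be.
  have -> : \sum_(s : cfg) \sum_(t : cfg) (\prod_x r x (s x) (t x)) * (1 * M al be s t) =
     \prod_x \sum_(k : 'I_3) \sum_(l : 'I_3) r x k l *
       ((sv l + sv k) ^+ al x * (sv l - sv k) ^+ be x).
    rewrite bigA_distr_bigA /=; apply: eq_bigr => s _.
    rewrite bigA_distr_bigA /=; apply: eq_bigr => t _.
    by rewrite mul1r -big_split.
  by apply: prodr_ge0 => x _; exact: r0.
(* The extra factor [k] is what makes the case of a product go through: the two factors are absorbed
   one after the other. *)
have Pmul g : cone g -> forall k, P k -> P (fun s t => k s t * g s t).
  elim=> [c c0|x|x|g1 g2 _ IH1 _ IH2|g1 g2 _ IH1 _ IH2|g1 g2 e _ IH] k Pk al be.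
  - have -> : \sum_(s : cfg) \sum_(t : cfg) \prod_x r x (s x) (t x) * (k s t * c * M al be s t)
       = c * \sum_(s : cfg) \sum_(t : cfg) \prod_x r x (s x) (t x) * (k s t * M al be s t).
      rewrite mulr_sumr; apply: eq_bigr => s _.
      by rewrite mulr_sumr; apply: eq_bigr => t _; ring.
    exact: mulr_ge0.
  - have := Pk (fun y => (y == x) + al y)%N be.
    apply: eq_ge0; apply: eq_bigr => s _; apply: eq_bigr => t _; congr (_ * _).
    rewrite -mulrA; congr (_ * _); rewrite /M.
    rewrite (bigD1 x) //= [in RHS](bigD1 x) //= eqxx exprD expr1 -!mulrA.
    congr (_ * (_ * (_ * _))).
    by apply: eq_bigr => y /negbTE ->.
  - have := Pk al (fun y => (y == x) + be y)%N.
    apply: eq_ge0; apply: eq_bigr => s _; apply: eq_bigr => t _; congr (_ * _).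
    rewrite -mulrA; congr (_ * _); rewrite /M.
    rewrite (bigD1 x) //= [in RHS](bigD1 x) //= eqxx exprD expr1.
    set X := \prod_(i | _) _; set Y := \prod_(i | _) _.
    have -> : X = Y by apply: eq_bigr => y /negbTE ->.
    ring.
  - have := addr_ge0 (IH1 _ Pk al be) (IH2 _ Pk al be).
    rewrite -big_split; apply: eq_ge0; apply: eq_bigr => s _; rewrite -big_split; apply: eq_bigr => t _.
    by rewrite /=; ring.
  - have := IH2 _ (IH1 _ Pk) al be.
    apply: eq_ge0.
    by apply: eq_bigr => s _; apply: eq_bigr => t _; ring.
  - have := IH _ Pk al be.
    apply: eq_ge0.
    by apply: eq_bigr => s _; apply: eq_bigr => t _; rewrite e.
move=> cf; have := Pmul f cf _ P1 (fun=> 0%N) (fun=> 0%N).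
apply: eq_ge0; apply: eq_bigr => s _; apply: eq_bigr => t _.
have -> : M (fun=> 0%N) (fun=> 0%N) s t = 1.
  by rewrite /M big1 // => x _; rewrite !expr0 mulr1.
by rewrite mul1r mulr1.
Qed.

(** Sum and difference are kept together to obtain stability under products: [f t * g t - f s * g s]
    is half of [(f t + f s) * (g t - g s) + (f t - f s) * (g t + g s)]. *)
Definition dcone (f : cfg -> R) : Prop :=
  cone (fun s t => f t + f s) /\ cone (fun s t => f t - f s).

Lemma dcone_spin x : dcone (fun s => spin s x).
Proof. by split; constructor. Qed.

Lemma dcone_c c : 0 <= c -> dcone (fun=> c).
Proof.
move=> c0; split; first by apply: cone_c; rewrite addr_ge0.
by apply: (cone_ext (f := fun _ _ => 0)) => [s t|]; [rewrite subrr|constructor].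
Qed.

Lemma dcone_add f g : dcone f -> dcone g -> dcone (fun s => f s + g s).
Proof.
move=> [f1 f2] [g1 g2]; split.
- by apply: cone_ext (cone_add f1 g1) => s t; ring.
- by apply: cone_ext (cone_add f2 g2) => s t; ring.
Qed.

Lemma dcone_mul f g : dcone f -> dcone g -> dcone (fun s => f s * g s).
Proof.
move=> [f1 f2] [g1 g2].
have ch : cone (fun _ _ => 2^-1) by apply: cone_c; rewrite invr_ge0.
split.
- apply: cone_ext (cone_mul ch (cone_add (cone_mul f1 g1) (cone_mul f2 g2))).
  by move=> s t; field.
- apply: cone_ext (cone_mul ch (cone_add (cone_mul f1 g2) (cone_mul f2 g1))).
  by move=> s t; field.
Qed.

Lemma dcone_ext f g : (forall s, f s = g s) -> dcone f -> dcone g.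
Proof.
by move=> e [f1 f2]; split; [apply: cone_ext f1|apply: cone_ext f2] => s t; rewrite !e.
Qed.

Lemma cone_snd f : dcone f -> cone (fun s t => f t).
Proof.
move=> [f1 f2].
have ch : cone (fun _ _ => 2^-1) by apply: cone_c; rewrite invr_ge0.
by apply: cone_ext (cone_mul ch (cone_add f1 f2)) => s t; field.
Qed.

Definition trivalued (f : cfg -> R) := forall s, [\/ f s = -1, f s = 0 | f s = 1].

Let nat_pow_bound (X : R) : exists k : nat, X <= 4 ^+ k.+1.
Proof.
exists (Num.bound `|X|); apply: (le_trans (ler_norm X)).
apply: (le_trans (ltW (archi_boundP (normr_ge0 X)))).
apply: (@le_trans _ _ (4 ^ (Num.bound `|X|).+1)%N%:R); last by rewrite natrX.
by rewrite ler_nat ltnW // (leq_trans (ltn_expl _ (isT : (1 < 4)%N))) // leq_exp2l.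
Qed.

(* On the nine values of [(f s, f t)] the weight [expR (c * (f t + f s))] agrees with a
   polynomial in the sum [T] and the difference [D] of the form
   [1 + al T^2 D^2 + ga T^(2k) + ga' T^(2k+1) + al' T^3 D^2]; taking [k] large makes
   all coefficients nonnegative. *)
Lemma cone_expR2 c f : 0 <= c -> trivalued f -> dcone f ->
  cone (fun s t => expR (c * (f t + f s))).
Proof.
move=> c0 f3 [fT fD].
set X := expR c; set Y := expR (- c).
have XY : X * Y = 1 by rewrite /X /Y -expRD subrr expR0.
have Y0 : 0 < Y by exact: expR_gt0.
have X1 : 1 <= X by rewrite -expR0 ler_expR.
have Y1 : Y <= 1 by rewrite -expR0 ler_expR oppr_le0.
have [k hk] := nat_pow_bound (X + Y + 2).
set Q := 4 ^+ k.+1 in hk; have Q0 : 0 < Q by rewrite exprn_gt0.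
pose ga := ((X - Y) ^+ 2 / 2) / Q.
pose al := (X + Y - 2) / 2 - ga.
pose ga' := ((X ^+ 2 - Y ^+ 2) / 2) / (2 * Q).
pose al' := (X - Y) / 2 - ga'.
have ga0 : 0 <= ga by apply: divr_ge0 (ltW Q0); apply: divr_ge0 => //; exact: sqr_ge0.
have ga'0 : 0 <= ga'.
  apply: divr_ge0; last by rewrite mulr_ge0 // ltW.
  apply: divr_ge0 => //.
  by rewrite subr_ge0 ler_sqr ?nnegrE ?(le_trans Y1) // ?(ltW Y0) // (le_trans _ X1).
have al0 : 0 <= al.
  rewrite /al subr_ge0 /ga ler_pdivrMr //.
  have -> : (X - Y) ^+ 2 / 2 = (X + Y - 2) / 2 * (X + Y + 2).
    have -> : (X - Y) ^+ 2 = (X + Y) ^+ 2 - 4 * (X * Y) by ring.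
    by rewrite XY; field.
  apply: ler_wpM2l => //; rewrite divr_ge0 // subr_ge0.
  have : 0 <= (X - 1) * (1 - Y) by rewrite mulr_ge0 ?subr_ge0.
  by rewrite mulrBr mulr1 mulrBl XY; lra.
have al'0 : 0 <= al'.
  rewrite /al' subr_ge0 /ga' ler_pdivrMr ?mulr_gt0 //.
  have -> : (X ^+ 2 - Y ^+ 2) / 2 = (X - Y) / 2 * (X + Y) by field.
  apply: ler_wpM2l; [lra|lra].
have H := cone_add (cone_c ler01) (cone_add (cone_add
   (cone_mul (cone_c al0) (cone_mul (cone_exp 2 fT) (cone_exp 2 fD)))
   (cone_mul (cone_c ga0) (cone_exp (2 * k.+1) fT)))
  (cone_add (cone_mul (cone_c ga'0) (cone_exp (2 * k.+1).+1 fT))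
   (cone_mul (cone_c al'0) (cone_mul (cone_exp 3 fT) (cone_exp 2 fD))))).
apply: cone_ext H => s t /=.
have e1 : expR (c * (1 + 1)) = X ^+ 2 by rewrite mulrDr mulr1 expRD.
have e2 : expR (c * (-1 + -1)) = Y ^+ 2 by rewrite mulrDr mulrN1 expRD.
have o2 : (1 + 1 : R) ^+ (2 * k.+1) = Q by rewrite exprM /Q; congr (_ ^+ _); ring.
have m2 : (-1 + -1 : R) ^+ (2 * k.+1) = Q by rewrite exprM /Q; congr (_ ^+ _); ring.
have m1 : (-1 : R) ^+ (2 * k.+1) = 1 by rewrite exprM sqrrN !expr1n.
have z : (0 : R) ^+ (2 * k.+1) = 0 by rewrite exprM expr0n /= expr0n.
have gQ : ga * Q = (X - Y) ^+ 2 / 2 by rewrite /ga divfK // gt_eqF.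
have gQ' : ga' * (2 * Q) = (X ^+ 2 - Y ^+ 2) / 2.
  by rewrite /ga' divfK // gt_eqF // mulr_gt0.
have XY2 : (X - Y) ^+ 2 = X ^+ 2 + Y ^+ 2 - 2.
  have -> : (X - Y) ^+ 2 = X ^+ 2 + Y ^+ 2 - 2 * (X * Y) by ring.
  by rewrite XY mulr1.
rewrite XY2 in gQ.
case: (f3 s) => ->; case: (f3 t) => ->;
  rewrite ?e1 ?e2 ?(addr0, add0r, subrr, addNr, addrN, mulr0, mulr1, mulrN1, expR0) -/X -/Y
    ?(exprS _ (2 * k.+1)) ?o2 ?m2 ?m1 ?z ?expr1n.
all: rewrite /al /al'; try lra.
all: nra.
Qed.

(** On the values -1, 0, 1 the exponential is [1 + sinh c * f + (cosh c - 1) * f ^+ 2], with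
    nonnegative coefficients. *)
Lemma cone_expR1 c f : 0 <= c -> trivalued f -> dcone f ->
  cone (fun s t => expR (c * f t)).
Proof.
move=> c0 f3 fC; have cf := cone_snd fC.
set X := expR c; set Y := expR (- c).
have XY : X * Y = 1 by rewrite /X /Y -expRD subrr expR0.
have X1 : 1 <= X by rewrite -expR0 ler_expR.
have Y1 : Y <= 1 by rewrite -expR0 ler_expR oppr_le0.
have h1 : 0 <= (X - Y) / 2 by lra.
have h2 : 0 <= (X + Y - 2) / 2.
  have : 0 <= (X - 1) * (1 - Y) by rewrite mulr_ge0 ?subr_ge0.
  by rewrite mulrBr mulr1 mulrBl XY; lra.
apply: cone_ext (cone_add (cone_c ler01) (cone_add (cone_mul (cone_c h1) cf)
   (cone_mul (cone_c h2) (cone_exp 2 cf)))) => s t /=.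
by case: (f3 t) => ->; rewrite ?mulrN1 ?mulr0 ?mulr1 ?expR0 -/X -/Y; field.
Qed.

Context (e1 e2 : B -> V) (K : B -> R) (h : V -> R) (a : R).
Context (K0 : forall b, 0 <= K b) (h0 : forall x, 0 <= h x) (a0 : 0 < a).

Definition bondspin b (s : cfg) : R := spin s (e1 b) * spin s (e2 b).

(** [(s ^+ 2 + s) / 2] is the indicator of spin 1. *)
Definition site_ind (v : site_status) (s : R) : R :=
  match v with Unknown => 1 | Absent => 1 - s ^+ 2 | Present => s ^+ 2 | Plus => (s ^+ 2 + s) / 2 end.
(** Weight [1] for spin 0 and [a] for spins -1 and 1; in the Blume-Capel model [a] is
    [expR Delta]. *)
Definition apriori (s : R) : R := 1 + (a - 1) * s ^+ 2.
Definition isabs v := if v is Absent then true else false.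
Definition isplus v := if v is Plus then true else false.
Definition ispre v := if v is Present then true else false.

(** For occupied ends [1 + bondspin b s] is twice the indicator that they agree, that is, up to a
    constant, the weight of the event that the bond is open. *)
Definition bond_weight st b s : R :=
  match bs st b with
  | Free => expR (K b * bondspin b s)
  | Closed => 1
  | Open => 1 + bondspin b s
  end.

Definition weight st s : R :=
  (\prod_x (apriori (spin s x) * site_ind (vs st x) (spin s x))) *
  ((\prod_x expR (h x * spin s x)) * \prod_b bond_weight st b s).

Definition le_v v v' :=
  match v, v' with
  | Absent, _ | _, Plus | Unknown, Unknown | Present, Present => true | _, _ => false end.

Definition hasabs st b := isabs (vs st (e1 b)) || isabs (vs st (e2 b)).
Definition hasplus st b := isplus (vs st (e1 b)) || isplus (vs st (e2 b)).
Definition bothplus st b := isplus (vs st (e1 b)) && isplus (vs st (e2 b)).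

Definition bothpre st b := ispre (vs st (e1 b)) && ispre (vs st (e2 b)).

(* A bond with an absent end in the smaller state, or with both ends plus in the larger one,
   has a constant weight there, whence no condition on its status. *)
Definition le_b st st' b := hasabs st b || (bothplus st' b ||
  match bs st b, bs st' b with
  | Free, Free | Closed, Closed | Closed, Open => true
  | Open, Open => bothpre st b && bothpre st' b
  | _, _ => false end).

Definition le_state st st' := (forall x, le_v (vs st x) (vs st' x)) /\ (forall b, le_b st st' b).

Lemma trivalued_spin x : trivalued (fun s => spin s x).
Proof. by move=> s; exact: spin_cases. Qed.

Lemma trivalued_bondspin b : trivalued (bondspin b).
Proof.
move=> s; rewrite /bondspin; case: (spin_cases s (e1 b)) => ->;
case: (spin_cases s (e2 b)) => ->; rewrite ?mulr0 ?mul0r ?mulr1 ?mul1r ?mulN1r ?opprK;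
by [constructor 1|constructor 2|constructor 3].
Qed.

Lemma dcone_bondspin b : dcone (bondspin b).
Proof. exact: dcone_mul (dcone_spin _) (dcone_spin _). Qed.

Let neg1X n : (-1 : R) ^+ n = 1 \/ (-1 : R) ^+ n = -1.
Proof. by rewrite -signr_odd; case: (odd n); [right|left]; rewrite ?expr1 ?expr0. Qed.

Lemma apriori_ge0 k : 0 <= apriori (sv k).
Proof.
by case: (sv_cases R k) => e; rewrite /apriori e ?sqrrN ?expr1n ?expr0n ?mulr1 ?mulr0 ?addr0 //;
  move: (ltW a0); lra.
Qed.

Lemma site_ind_ge0 v k : 0 <= site_ind v (sv k).
Proof.
by case: v; case: (sv_cases R k) => e; rewrite /site_ind ?e ?sqrrN ?expr1n ?expr0n /=; lra.
Qed.


Let sum3 (F : 'I_3 -> R) (G : R -> R) : (forall k, F k = G (sv k)) ->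
  \sum_(k : 'I_3) F k = G (-1) + G 0 + G 1.
Proof.
move=> e; rewrite !big_ord_recl big_ord0 !e /sv /= addr0 sub0r addrA.
have -> : (bump 0 0)%:R - 1 = 0 :> R by rewrite /bump /= subrr.
by have -> : (bump 0 (bump 0 0))%:R - 1 = 1 :> R by rewrite /bump /= mulr2n addrK.
Qed.

(** If the lower site is absent, its spin is 0 and a moment of a single spin remains, nonnegative
    because plus is at least as likely as minus. If the upper site is plus, [1 + s] and [1 - s] are
    both nonnegative. If both carry the same symmetric law, this is Ginibre's parity argument. *)
Lemma site_pos v v' m n : le_v v v' ->
  0 <= \sum_(k : 'I_3) \sum_(l : 'I_3)
     (apriori (sv k) * site_ind v (sv k)) * (apriori (sv l) * site_ind v' (sv l)) *
     ((sv l + sv k) ^+ m * (sv l - sv k) ^+ n).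
Proof.
move=> vv'.
have r0 := apriori_ge0; have i0 := site_ind_ge0.
have [e|[->|[-> hv]]] : v = Absent \/ v' = Plus \/ v = v' /\ (v' = Unknown \/ v' = Present).
  by move: vv'; case: v; case: v' => //= _; auto 10.
- rewrite exchange_big /=.
  rewrite (sum3 (G := fun r => apriori r * site_ind v' r * (r ^+ m * r ^+ n))); last first.
    move=> l; rewrite (sum3 (G := fun r => apriori r * site_ind v r * (apriori (sv l) * site_ind v' (sv l)) *
       ((sv l + r) ^+ m * (sv l - r) ^+ n))) // e /site_ind /apriori sqrrN expr1n expr0n /=.
    by rewrite !(subrr, mulr0, mul0r, add0r, addr0, subr0, mulr1, mul1r).
  have q0 : 0 <= apriori 0 * site_ind v' 0 * (0 ^+ m * 0 ^+ n).
    rewrite /apriori /site_ind; case: v' {vv'}; rewrite !expr0n /=; case: (m == 0)%N; case: (n == 0)%N => /=; lra.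
  have q1 : 0 <= apriori (-1) * site_ind v' (-1) * ((-1) ^+ m * (-1) ^+ n) + apriori 1 * site_ind v' 1 * (1 ^+ m * 1 ^+ n).
    have A0 := ltW a0.
    rewrite /apriori !expr1n !sqrrN; case: v' {vv' q0}; rewrite /site_ind ?sqrrN !expr1n;
    case: (neg1X m) => ->; case: (neg1X n) => ->; lra.
  by rewrite addrAC addr_ge0.
- apply: sumr_ge0 => k _; apply: sumr_ge0 => l _.
  case: (sv_cases R l) => el; rewrite [in site_ind Plus _]el /site_ind ?sqrrN ?expr1n ?expr0n.
  + by rewrite subrr mul0r mulr0 mulr0 mul0r.
  + by rewrite addr0 mul0r mulr0 mulr0 mul0r.
  + rewrite mulr_ge0 // ?mulr_ge0 ?i0 // ?exprn_ge0 // el; case: (sv_cases R k) => ->; lra.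
- set w := fun r => apriori r * site_ind v' r.
  rewrite (sum3 (G := fun r => \sum_l w r * w (sv l) *
       ((sv l + r) ^+ m * (sv l - r) ^+ n))) //.
  have I r : \sum_(l : 'I_3) w r * w (sv l) * ((sv l + r) ^+ m * (sv l - r) ^+ n) =
      w r * w (-1) * ((-1 + r) ^+ m * (-1 - r) ^+ n) + w r * w 0 * ((0 + r) ^+ m * (0 - r) ^+ n) +
      w r * w 1 * ((1 + r) ^+ m * (1 - r) ^+ n).
    exact: (sum3 (G := fun l => w r * w l * ((l + r) ^+ m * (l - r) ^+ n))).
  rewrite !I {I}.
  have w1 : w (-1) = w 1.
    by rewrite /w /apriori /site_ind; case: hv => ->; rewrite !sqrrN expr1n.
  have w0 : 0 <= w 0.
    have -> : w 0 = w (sv (inord 1)) by rewrite /w /sv inordK // subrr.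
    by rewrite mulr_ge0.
  have w1' : 0 <= w 1.
    have -> : w 1 = w (sv (inord 2)) by rewrite /w /sv inordK // mulr2n addrK.
    by rewrite mulr_ge0.
  rewrite w1 !(opprK, subr0, sub0r, add0r, addr0, subrr, addNr, expr1n).
  have em2 p : (-1 - 1 : R) ^+ p = (-1) ^+ p * 2 ^+ p by rewrite -exprMn; congr (_ ^+ _); ring.
  have ep2 : (1 + 1 : R) = 2 by [].
  rewrite !em2 ep2.
  have T p : 0 <= (2 : R) ^+ p by rewrite exprn_ge0.
  have Z p : 0 <= (0 : R) ^+ p by rewrite exprn_ge0.
  move: (T m) (T n) (Z m) (Z n).
  set t1 := 2 ^+ m; set t2 := 2 ^+ n; set z1 := 0 ^+ m; set z2 := 0 ^+ n.
  move=> t10 t20 z10 z20.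
  have p1 := mulr_ge0 w1' w1'; have p2 := mulr_ge0 w0 w1'; have p3 := mulr_ge0 w0 w0.
  have q1 := mulr_ge0 p1 (mulr_ge0 t10 z20).
  have q2 := mulr_ge0 p1 (mulr_ge0 z10 t20).
  have q3 := mulr_ge0 p3 (mulr_ge0 z10 z20).
  case: (neg1X m) => ->; case: (neg1X n) => ->; nra.
Qed.

End Model.

Section PairInequality.
Context {R : realType} {V B : finType} (e1 e2 : B -> V) (K : B -> R) (h : V -> R) (a : R).
Context (K0 : forall b, 0 <= K b) (h0 : forall x, 0 <= h x) (a0 : 0 < a).

Notation cfg := (@cfg V).
Notation spin := (@spin R V).
Notation state := (@state V B).
Notation bondspin := (@bondspin R V B e1 e2).
Notation bond_weight := (bond_weight e1 e2 K).
Notation weight := (weight e1 e2 K h a).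
Notation le_state := (@le_state V B e1 e2).
Notation bothpre := (@bothpre V B e1 e2).

Definition supp (st : state) (s : cfg) := [forall x, site_ind (vs st x) (spin s x) != 0].

Lemma weight_supp0 st s : ~~ supp st s -> weight st s = 0.
Proof.
rewrite /supp negb_forall => /existsP[x]; rewrite negbK => /eqP e.
by rewrite /weight (bigD1 x) //= e mulr0 !mul0r.
Qed.

Lemma supp_ind st s x : supp st s ->
  match vs st x with
  | Unknown => True | Absent => spin s x = 0 | Present => spin s x ^+ 2 = 1 | Plus => spin s x = 1 end.
Proof.
move/forallP/(_ x); case: (vs st x) => //=; case: (spin_cases (R := R) s x) => ->;
  by rewrite ?sqrrN ?expr1n ?expr0n //= ?subrr ?addrN ?addNr ?addr0 ?mul0r ?eqxx.
Qed.

Let cT b : cone (fun s t => bondspin b t + bondspin b s).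
Proof. by case: (dcone_bondspin (R := R) e1 e2 b). Qed.
Let cS b : cone (fun s t => bondspin b t).
Proof. exact: cone_snd (dcone_bondspin _ _ b). Qed.
Let cE b : cone (fun s t => expR (K b * bondspin b t)).
Proof. exact: cone_expR1 (K0 b) (trivalued_bondspin _ _ b) (dcone_bondspin _ _ b). Qed.

(** The two bond factors only have to agree with an element of the cone on the supports of the two
    states, where absent and plus ends have a fixed spin. *)
Lemma bond_cone st st' b : (forall x, le_v (vs st x) (vs st' x)) -> le_b e1 e2 st st' b ->
  exists G, cone G /\ forall s t, supp st s -> supp st' t -> bond_weight st b s * bond_weight st' b t = G s t.
Proof.
move=> lv.
have c1 : cone (fun _ _ : cfg => 1 : R) by exact: cone_c.
have cS1 : cone (fun _ t => 1 + bondspin b t) by exact: cone_add.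
case/orP => [ha|].
  have b0 s : supp st s -> bondspin b s = 0.
    move=> ss; move: ha; rewrite /bondspin /hasabs => /orP[];
      [have := supp_ind (e1 b) ss|have := supp_ind (e2 b) ss];
      by case: (vs st _) => // ->; rewrite ?mul0r ?mulr0.
  have g1 s : supp st s -> bond_weight st b s = 1.
    by move=> ss; rewrite /bond_weight (b0 _ ss) mulr0 expR0 addr0; case: (bs st b).
  have [G [cG eG]] : exists G, cone G /\ forall s t, bond_weight st' b t = G s t.
    rewrite /bond_weight; case: (bs st' b).
    - by exists (fun s t => expR (K b * bondspin b t)).
    - by exists (fun s t => 1).
    - by exists (fun s t => 1 + bondspin b t).
  by exists G; split => // s t ss _; rewrite g1 // mul1r (eG s).
case/orP => [hp|].
  have t1 t : supp st' t -> bondspin b t = 1.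
    move=> tt; move: hp; rewrite /bothplus /bondspin => /andP[].
    have := supp_ind (e1 b) tt; have := supp_ind (e2 b) tt.
    by case: (vs st' _) => // ->; case: (vs st' _) => // ->; rewrite mulr1.
  have [c [c0 ec]] : exists c, 0 <= c /\ forall t, supp st' t -> bond_weight st' b t = c.
    rewrite /bond_weight; case: (bs st' b).
    - by exists (expR (K b)); split; [exact: expR_ge0|move=> t /t1 ->; rewrite mulr1].
    - by exists 1.
    - by exists 2; split => // t /t1 ->.
  have cc : cone (fun _ _ : cfg => c) by exact: cone_c.
  case eb : (bs st b).
  - have ck : cone (fun _ _ : cfg => expR (- K b)) by apply: cone_c; exact: expR_ge0.
    (* The upper copy has [bondspin b t = 1], so [K * bondspin b s] is
       [K * (bondspin b t + bondspin b s) - K], which is symmetric in the two copies. *)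
    exists (fun s t => c * (expR (- K b) * expR (K b * (bondspin b t + bondspin b s)))); split.
      apply: cone_mul => //; apply: cone_mul => //.
      exact: cone_expR2 (K0 b) (trivalued_bondspin _ _ b) (dcone_bondspin _ _ b).
    move=> s t ss tt; rewrite (ec _ tt) /bond_weight eb mulrC; congr (_ * _).
    by rewrite -expRD (t1 _ tt); congr expR; ring.
  - by exists (fun _ _ => c); split => // s t ss tt; rewrite (ec _ tt) /bond_weight eb mul1r.
  - exists (fun s t => c * (bondspin b t + bondspin b s)); split; first exact: cone_mul.
    by move=> s t ss tt; rewrite (ec _ tt) /bond_weight eb (t1 _ tt) mulrC.
rewrite /bond_weight; case: (bs st b); case: (bs st' b) => //.
- exists (fun s t => expR (K b * (bondspin b t + bondspin b s))); split.
    exact: cone_expR2 (K0 b) (trivalued_bondspin _ _ b) (dcone_bondspin _ _ b).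
  by move=> s t _ _; rewrite -expRD -mulrDr addrC.
- by exists (fun _ _ => 1); split => // s t _ _; rewrite mulr1.
- by exists (fun _ t => 1 + bondspin b t); split => // s t _ _; rewrite mul1r.
have ch : cone (fun _ _ : cfg => 2^-1 : R) by apply: cone_c; rewrite invr_ge0.
have sq (unrevealed : state) s : bothpre unrevealed b -> supp unrevealed s -> bondspin b s ^+ 2 = 1.
  move=> + ss; rewrite /bondspin exprMn /bothpre.
  have := supp_ind (e1 b) ss; have := supp_ind (e2 b) ss.
  by case: (vs unrevealed (e1 b)) => //; case: (vs unrevealed (e2 b)) => // -> -> _; rewrite mulr1.
case/andP => p1 p2.
(* Since both squares are 1 on known occupied ends, [(1 + u) * (1 + v) = (u + v) + (u + v) ^+ 2 /
   2]. *)
exists (fun s t => (bondspin b t + bondspin b s) + 2^-1 * (bondspin b t + bondspin b s) ^+ 2); split.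
  apply: cone_add => //; apply: cone_mul => //; exact: cone_exp.
move=> s t ss tt.
by rewrite sqrrD (sq _ _ p1 ss) (sq _ _ p2 tt); field.
Qed.

(** The field and bond factors of the two copies, paired with each other, belong to the cone and
    join [f]; what remains is a product of site weights, as [pair_sum_ge0] requires. Off the
    supports both sides vanish. *)
Theorem pair_ineq st st' f : le_state st st' -> cone f ->
  0 <= \sum_(s : cfg) \sum_(t : cfg) weight st s * weight st' t * f s t.
Proof.
move=> [lv lb] cf.
have /boolp.choice[G HG] : forall b, exists G, cone G /\
    forall s t, supp st s -> supp st' t -> bond_weight st b s * bond_weight st' b t = G s t.
  by move=> b; exact: bond_cone.
pose r x k l := (apriori a (sv k) * site_ind (vs st x) (sv k)) * (apriori a (sv l) * site_ind (vs st' x) (sv l)).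
pose F s t := ((\prod_x expR (h x * (spin t x + spin s x))) * \prod_b G b s t) * f s t.
have cF : cone F.
  apply: cone_mul => //; apply: cone_mul.
    apply: cone_prod => x _; apply: cone_expR2 (h0 x) (trivalued_spin x) (dcone_spin x).
  by apply: cone_prod => b _; case: (HG b).
have := pair_sum_ge0 (r := r) (f := F) _ cF.
have site x m n := site_pos a0 m n (lv x).
move=> /(_ (fun x m n => site x m n)); apply: eq_ge0.
apply: eq_bigr => s _; apply: eq_bigr => t _.
have [ss|ns] := boolP (supp st s); last first.
  rewrite weight_supp0 // !mul0r; move: ns; rewrite /supp negb_forall => /existsP[x].
  rewrite negbK => /eqP e; rewrite (bigD1 x) //= /r.
  by rewrite -[site_ind _ (sv (s x))]/(site_ind (vs st x) (spin s x)) e mulr0 !mul0r.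
have [tt|nt] := boolP (supp st' t); last first.
  rewrite [weight st' t]weight_supp0 // mulr0 mul0r; move: nt; rewrite /supp negb_forall => /existsP[x].
  rewrite negbK => /eqP e; rewrite (bigD1 x) //= /r.
  by rewrite -[site_ind _ (sv (t x))]/(site_ind (vs st' x) (spin t x)) e !mulr0 !mul0r.
rewrite /F mulrA; congr (_ * _).
have -> : \prod_b G b s t = (\prod_b bond_weight st b s) * \prod_b bond_weight st' b t.
  by rewrite -big_split; apply: eq_bigr => b _; case: (HG b) => _ <-.
have -> : \prod_x expR (h x * (spin t x + spin s x)) =
    (\prod_x expR (h x * spin s x)) * \prod_x expR (h x * spin t x).
  by rewrite -big_split /=; apply: eq_bigr => x _; rewrite -expRD; congr expR; ring.
rewrite /r big_split /= /weight; ring.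
Qed.

End PairInequality.

(** * Expectations in a state: monotonicity, Griffiths' inequalities, conditioning *)

Section Expectation.
Context {R : realType} {V B : finType} (e1 e2 : B -> V) (K : B -> R) (h : V -> R) (a : R).
Context (K0 : forall b, 0 <= K b) (h0 : forall x, 0 <= h x) (a0 : 0 < a).

Notation cfg := (@cfg V).
Notation spin := (@spin R V).
Notation state := (@state V B).
Notation bondspin := (@bondspin R V B e1 e2).
Notation bond_weight := (bond_weight e1 e2 K).
Notation weight := (weight e1 e2 K h a).
Notation le_state := (@le_state V B e1 e2).
Notation hasabs := (@hasabs V B e1 e2).
Notation supp := (@supp R V B).

Definition partition (st : state) : R := \sum_(s : cfg) weight st s.
Definition expect (st : state) (F : cfg -> R) : R := (\sum_(s : cfg) weight st s * F s) / partition st.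

Lemma weight_ge0 st s : 0 <= weight st s.
Proof.
rewrite /weight mulr_ge0 //.
  by apply: prodr_ge0 => x _; rewrite mulr_ge0 ?apriori_ge0 ?site_ind_ge0.
rewrite mulr_ge0 //; first by apply: prodr_ge0 => x _; exact: expR_ge0.
apply: prodr_ge0 => b _; rewrite /bond_weight; case: (bs st b) => //; rewrite ?expR_ge0 //.
by case: (trivalued_bondspin (R := R) e1 e2 b s) => ->; rewrite ?subrr ?addr0 // addrN.
Qed.

Lemma partition_gt0 st : 0 < partition st.
Proof.
pose s0 : cfg := [ffun x => if vs st x is Absent then inord 1 else inord 2].
have s0E x : spin s0 x = if vs st x is Absent then 0 else 1.
  rewrite /spin ffunE /sv; case: (vs st x); rewrite inordK // ?mulr2n ?addrK //.
  exact: subrr.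
have bd0 b : 0 <= bondspin b s0.
  by rewrite /bondspin !s0E mulr_ge0 //; case: (vs st _).
have w0 : 0 < weight st s0.
  rewrite /weight mulr_gt0 //.
    apply: prodr_gt0 => x _; rewrite s0E /apriori /site_ind.
    case: (vs st x); rewrite ?expr0n ?expr1n /=.
    - by rewrite !mulr1 addrC subrK.
    - by rewrite mulr0 addr0 subr0 mulr1.
    - by rewrite !mulr1 addrC subrK.
    - by have -> : (1 + (a - 1) * 1) * ((1 + 1) / 2) = a by field.
  rewrite mulr_gt0 //; first by apply: prodr_gt0 => x _; exact: expR_gt0.
  apply: prodr_gt0 => b _; rewrite /bond_weight; case: (bs st b) => //; rewrite ?expR_gt0 //.
  by rewrite ltr_wpDr.
rewrite /partition (bigD1 s0) //= ltr_wpDr //; apply: sumr_ge0 => s _; exact: weight_ge0.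
Qed.

Lemma partition_neq0 st : partition st != 0.
Proof. by rewrite gt_eqF // partition_gt0. Qed.

Lemma sum_weightE st F : \sum_(s : cfg) weight st s * F s = partition st * expect st F.
Proof. by rewrite /expect mulrC divfK // partition_neq0. Qed.

Lemma expect_supp st F G : (forall s, supp st s -> F s = G s) -> expect st F = expect st G.
Proof.
move=> e; congr (_ / _); apply: eq_bigr => s _.
have [ss|ns] := boolP (supp st s); first by rewrite e.
by rewrite weight_supp0 // !mul0r.
Qed.

Lemma eq_expect st F G : (forall s, F s = G s) -> expect st F = expect st G.
Proof. by move=> e; apply: expect_supp => s _; exact: e. Qed.

Lemma expectD st F G : expect st (fun s => F s + G s) = expect st F + expect st G.
Proof.
rewrite /expect -mulrDl -big_split; congr (_ / _); apply: eq_bigr => s _.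
by rewrite mulrDr.
Qed.

Lemma expectZ st c F : expect st (fun s => c * F s) = c * expect st F.
Proof.
rewrite /expect mulrA mulr_sumr; congr (_ / _); apply: eq_bigr => s _; ring.
Qed.

Lemma expectB st F G : expect st (fun s => F s - G s) = expect st F - expect st G.
Proof.
rewrite -[X in _ - X]mul1r -mulNr -expectZ -expectD; apply: eq_expect => s; ring.
Qed.

Lemma expect_cst st c : expect st (fun=> c) = c.
Proof. by rewrite /expect -mulr_suml mulrC mulrA mulVf ?mul1r // partition_neq0. Qed.

Lemma expect_ge0 st F : (forall s, supp st s -> 0 <= F s) -> 0 <= expect st F.
Proof.
move=> F0; rewrite /expect divr_ge0 ?(ltW (partition_gt0 _)) //.
apply: sumr_ge0 => s _; have [ss|ns] := boolP (supp st s).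
  by rewrite mulr_ge0 ?weight_ge0 // F0.
by rewrite weight_supp0 // mul0r.
Qed.

Lemma expect_le st F G : (forall s, supp st s -> F s <= G s) -> expect st F <= expect st G.
Proof.
by move=> FG; rewrite -subr_ge0 -expectB; apply: expect_ge0 => s ss; rewrite subr_ge0 FG.
Qed.

Lemma expect_mono st st' F : le_state st st' -> dcone F -> expect st F <= expect st' F.
Proof.
move=> l [_ cF]; have := pair_ineq K0 h0 a0 l cF.
have -> : \sum_(s : cfg) \sum_(t : cfg) weight st s * weight st' t * (F t - F s) =
   partition st * partition st' * (expect st' F - expect st F).
  have dbl H H' : \sum_(s : cfg) \sum_(t : cfg) (weight st s * H s) * (weight st' t * H' t) =
      (partition st * expect st H) * (partition st' * expect st' H').
    by rewrite -!sum_weightE mulr_suml; apply: eq_bigr => s _; rewrite mulr_sumr.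
  transitivity (partition st * expect st (fun=> 1) * (partition st' * expect st' F)
     - partition st * expect st F * (partition st' * expect st' (fun=> 1))).
    rewrite -!dbl -sumrB; apply: eq_bigr => s _.
    rewrite -sumrB; apply: eq_bigr => t _ /=; ring.
  by rewrite !expect_cst; ring.
by rewrite pmulr_rge0 ?subr_ge0 // mulr_gt0 ?partition_gt0.
Qed.

Lemma gks2 st F G : le_state st st -> dcone F -> dcone G ->
  expect st F * expect st G <= expect st (fun s => F s * G s).
Proof.
move=> l [_ cF] [_ cG]; have := pair_ineq K0 h0 a0 l (cone_mul cF cG).
have -> : \sum_(s : cfg) \sum_(t : cfg) weight st s * weight st t * ((F t - F s) * (G t - G s)) =
   partition st * partition st * 2 * (expect st (fun s => F s * G s) - expect st F * expect st G).
  pose S H := \sum_(s : cfg) weight st s * H s.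
  have dbl H H' : \sum_(s : cfg) \sum_(t : cfg) (weight st s * H s) * (weight st t * H' t) = S H * S H'.
    by rewrite mulr_suml; apply: eq_bigr => s _; rewrite mulr_sumr.
  transitivity (S (fun=> 1) * S (fun s => F s * G s) + S (fun s => F s * G s) * S (fun=> 1)
     - S F * S G - S G * S F).
    rewrite -!dbl -big_split -!sumrB; apply: eq_bigr => s _.
    rewrite -big_split -!sumrB; apply: eq_bigr => t _ /=; ring.
  by rewrite /S !sum_weightE expect_cst; ring.
by rewrite pmulr_rge0 ?subr_ge0 // !mulr_gt0 ?partition_gt0.
Qed.

(** The state with all sites absent lies below every other one and is concentrated on the zero
    configuration. *)
Lemma gks1 st F : (forall s, (forall x, spin s x = 0) -> 0 <= F s) -> dcone F -> 0 <= expect st F.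
Proof.
move=> F0 cF.
pose unrevealed : state := State (fun=> Absent) (fun=> Closed).
have l : le_state unrevealed st by split=> [x|b]; rewrite ?/le_b //.
apply: le_trans (expect_mono l cF); apply: expect_ge0 => s ss; apply: F0 => x.
exact: (supp_ind x ss).
Qed.

(** Conditioning on an event of conditional probability [hh] given the spins, in product form: if
    [hh] has mean zero, both sides vanish whatever [st1] is, so branches of probability zero need no
    separate treatment. *)
Lemma expect_cond st st1 hh F : (forall s, supp st s -> 0 <= hh s) ->
  (expect st hh != 0 -> exists2 al, al != 0 & forall s, weight st1 s = al * (weight st s * hh s)) ->
  expect st hh * expect st1 F = expect st (fun s => hh s * F s).
Proof.
move=> hh0; have [e _|ne /(_ isT)[al al0 e]] := eqVneq (expect st hh) 0.
  rewrite e mul0r; have {e} : \sum_(s : cfg) weight st s * hh s = 0.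
    by move/eqP: e; rewrite mulf_eq0 invr_eq0 (negbTE (partition_neq0 st)) orbF => /eqP.
  have nn s : true -> 0 <= weight st s * hh s.
    have [ss _|ns _] := boolP (supp st s); first by rewrite mulr_ge0 ?weight_ge0 ?hh0.
    by rewrite weight_supp0 // mul0r.
  move/eqP; rewrite psumr_eq0 //.
  move=> /allP z; rewrite /expect big1 ?mul0r // => s _.
  by have /eqP := z s (mem_index_enum s); rewrite mulrA => ->; rewrite mul0r.
have zE : partition st1 = al * (partition st * expect st hh).
  by rewrite /expect [partition st * _]mulrC divfK ?partition_neq0 // mulr_sumr; apply: eq_bigr => s _; rewrite e.
rewrite /expect -/(expect st hh) zE.
have -> : \sum_(s : cfg) weight st1 s * F s = al * \sum_(s : cfg) weight st s * (hh s * F s).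
  by rewrite mulr_sumr; apply: eq_bigr => s _; rewrite e; ring.
rewrite -/(partition st); move: (partition_neq0 st) ne; rewrite /expect.
move: (\sum_(s : cfg) weight st s * hh s) (\sum_(s : cfg) _) (partition st) => p q z z0 p0.
field; rewrite al0 z0 /=; move: p0; rewrite mulf_eq0 negb_or => /andP[-> _] //.
Qed.

Lemma expect_split st st1 unrevealed hh F : (forall s, supp st s -> 0 <= hh s <= 1) ->
  (expect st hh != 0 -> exists2 al, al != 0 & forall s, weight st1 s = al * (weight st s * hh s)) ->
  (expect st hh != 1 -> exists2 al, al != 0 & forall s, weight unrevealed s = al * (weight st s * (1 - hh s))) ->
  expect st F = expect st hh * expect st1 F + (1 - expect st hh) * expect unrevealed F.
Proof.
move=> hh01 c1 c0; rewrite (expect_cond F _ c1); last by move=> s /hh01/andP[].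
have e : expect st (fun s => 1 - hh s) = 1 - expect st hh by rewrite expectB expect_cst.
rewrite -e expect_cond.
- by rewrite -expectD; apply: eq_expect => s; ring.
- by move=> s /hh01/andP[_]; rewrite subr_ge0.
- by rewrite e subr_eq0 eq_sym.
Qed.

End Expectation.

(** * Revealing sites and bonds *)

Section Reveal.
Context {R : realType} {V B : finType} (e1 e2 : B -> V) (K : B -> R) (h : V -> R) (a : R).
Context (K0 : forall b, 0 <= K b) (h0 : forall x, 0 <= h x) (a0 : 0 < a).

Notation cfg := (@cfg V).
Notation spin := (@spin R V).
Notation state := (@state V B).
Notation bondspin := (@bondspin R V B e1 e2).
Notation bond_weight := (bond_weight e1 e2 K).
Notation weight := (weight e1 e2 K h a).
Notation expect := (expect e1 e2 K h a).
Notation le_state := (@le_state V B e1 e2).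
Notation hasabs := (@hasabs V B e1 e2).
Notation hasplus := (@hasplus V B e1 e2).
Notation bothplus := (@bothplus V B e1 e2).
Notation bothpre := (@bothpre V B e1 e2).
Notation supp := (@supp R V B).

Definition known (v : site_status) := if v is Unknown then false else true.
Definition knownb (st : state) b := known (vs st (e1 b)) && known (vs st (e2 b)).

Definition reveal_status (v : site_status) (w : bool) := if v is Unknown then (if w then Present else Absent) else v.
Definition reveal_site (st : state) x w : state :=
  State (fun y => if y == x then reveal_status (vs st y) w else vs st y) (bs st).
Definition reveal_bond (st : state) b (w : bool) : state :=
  State (vs st) (fun b' => if b' == b then (if w then Open else Closed) else bs st b').
(** Applied to bonds with a plus end: if such a bond is open, both ends are plus, its factor is
    constant, and [Closed] records it just as well. Hence the run [I] never contains an [Open]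
    bond. *)
Definition explore_bond (st : state) b (w : bool) : state :=
  State (fun x => if (w && ~~ hasabs st b) && ((x == e1 b) || (x == e2 b)) then Plus else vs st x)
        (fun b' => if b' == b then Closed else bs st b').

Definition isopen (t : bond_status) := if t is Open then true else false.
(** Invariant of the run [J]. It makes a state comparable with itself, which is what Griffiths'
    second inequality asks for, since [le_b] restricts open bonds. *)
Definition opens_known (st : state) := (forall x, ~~ isplus (vs st x)) /\
  (forall b, isopen (bs st b) -> knownb st b).
Definition no_open (st : state) := forall b, ~~ isopen (bs st b).

Lemma le_vv v : le_v v v. Proof. by case: v. Qed.

Lemma le_state_refl st : opens_known st -> le_state st st.
Proof.
move=> [np ko]; split=> [x|b]; first exact: le_vv.
rewrite /le_b; case eb : (bs st b); rewrite ?orbT //.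
have : knownb st b by apply: ko; rewrite eb.
rewrite /knownb /hasabs /bothpre; move: (np (e1 b)) (np (e2 b)).
by case: (vs st (e1 b)) => //; case: (vs st (e2 b)) => //; rewrite ?orbT.
Qed.

Lemma le_reveal_status v v' w w' : le_v v v' -> w ==> w' -> le_v (reveal_status v w) (reveal_status v' w').
Proof. by case: v => //; case: v' => //; case: w => //; case: w'. Qed.

Lemma isabs_reveal v w : isabs v -> isabs (reveal_status v w). Proof. by case: v. Qed.
Lemma isplus_reveal v w : isplus v -> isplus (reveal_status v w). Proof. by case: v. Qed.
Lemma ispre_reveal v w : ispre v -> ispre (reveal_status v w). Proof. by case: v. Qed.
Lemma known_reveal v w : known (reveal_status v w). Proof. by case: v; case: w. Qed.

Lemma reveal_site_le st st' x w w' : le_state st st' -> w ==> w' -> le_state (reveal_site st x w) (reveal_site st' x w').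
Proof.
move=> [lv lb] ww; split=> [y|b] /=.
  by case: eqP => // _; exact: le_reveal_status.
have P (p : site_status -> bool) (s0 : state) w0 y : (forall v w1, p v -> p (reveal_status v w1)) ->
    p (vs s0 y) -> p (vs (reveal_site s0 x w0) y).
  by move=> pr py /=; case: eqP => // _; exact: pr.
move: (lb b); rewrite /le_b => /or3P[ha|hp|e]; apply/or3P.
- constructor 1; move: ha; rewrite /hasabs => /orP[] H; apply/orP;
   [left|right]; exact: P isabs_reveal H.
- constructor 2; move: hp; rewrite /bothplus => /andP[H1 H2].
  by rewrite !(P isplus) //; exact: isplus_reveal.
- constructor 3; move: e => /=; case: (bs st b) => //; case: (bs st' b) => //.
  rewrite /bothpre => /andP[/andP[H1 H2] /andP[H3 H4]].
  by rewrite !(P ispre) //; exact: ispre_reveal.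
Qed.

Lemma reveal_bond_le st st' b w w' : le_state st st' -> opens_known st' -> knownb st b ->
  (forall x, ~~ isplus (vs st x)) ->
  w ==> w' -> le_state (reveal_bond st b w) (reveal_bond st' b w').
Proof.
move=> [lv lb] [np' _] kn np ww; split=> [y|b'] //=.
have [->|nb] := eqVneq b' b; last first.
  by move: (lb b'); rewrite /le_b /= (negbTE nb).
rewrite /le_b /= eqxx; case: w ww => /= [->|_]; last by case: w'; rewrite !orbT.
move: kn (np (e1 b)) (np (e2 b)) (lv (e1 b)) (lv (e2 b)) (np' (e1 b)) (np' (e2 b)).
rewrite /knownb /hasabs /bothplus /bothpre /=.
case: (vs st (e1 b)) => //; case: (vs st (e2 b)) => //; case: (vs st' (e1 b)) => //;
  by case: (vs st' (e2 b)).
Qed.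

(** If the lower run opens the bond, so does the upper one. Its ends then become plus, unless one of
    them is absent, in which case it is absent below as well; in either case [le_b] holds whatever
    the bond statuses. *)
Lemma reveal_explore_le st st' b w w' : le_state st st' -> no_open st' ->
  w ==> w' -> le_state (reveal_bond st b w) (explore_bond st' b w').
Proof.
move=> [lv lb] it ww; split=> [y|b'] //=.
  by case: ifP => // _; case: (vs st y).
have [->|nb] := eqVneq b' b; last first.
  move: (lb b'); rewrite /le_b /= (negbTE nb) => /or3P[ha|hp|e]; first by apply/or3P; constructor 1.
    apply/or3P; constructor 2; move: hp; rewrite /bothplus /= => /andP[H1 H2].
    by case: ifP => _; case: ifP => _; rewrite ?H1 ?H2.
  move: e (it b'); case: (bs st b') => //; case: (bs st' b') => //; by rewrite !orbT.
rewrite /le_b /= eqxx; case: w ww => /= [->|_]; last by rewrite !orbT.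
case ha : (hasabs st' b).
  suff -> : hasabs (reveal_bond st b true) b by [].
  move: ha (lv (e1 b)) (lv (e2 b)); rewrite /hasabs /=.
  by case: (vs st' (e1 b)) => //; case: (vs st' (e2 b)) => //;
    case: (vs st (e1 b)) => //; case: (vs st (e2 b)).
by rewrite /bothplus /= !ha !eqxx ?orbT.
Qed.

Lemma reveal_site_known st x w : opens_known st -> opens_known (reveal_site st x w).
Proof.
move=> [np ko]; split=> [y|b] /=.
  by move: (np y); case: eqP => // _; case: (vs st y) => //; case: w.
move/ko; rewrite /knownb /= => /andP[k1 k2].
by case: eqP => _; case: eqP => _; rewrite ?known_reveal ?k1 ?k2.
Qed.

Lemma reveal_bond_known st b w : opens_known st -> knownb st b -> opens_known (reveal_bond st b w).
Proof.
move=> [np ko] kn; split=> [y|b'] //=.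
by case: eqP => [->|_] // /ko.
Qed.

Lemma explore_bond_no_open st b w : no_open st -> no_open (explore_bond st b w).
Proof. by move=> it b' /=; case: eqP. Qed.

Definition occupied x (s : cfg) : R := spin s x ^+ 2.
Definition open_prob b (s : cfg) : R := (1 - expR (- (2 * K b))) * ((bondspin b s ^+ 2 + bondspin b s) / 2).

Lemma open_factor01 b : 0 <= 1 - expR (- (2 * K b)) <= 1.
Proof.
have e0 := expR_ge0 (- (2 * K b)).
have e1' : expR (- (2 * K b)) <= 1 by rewrite -expR0 ler_expR oppr_le0 mulr_ge0.
by apply/andP; split; lra.
Qed.

Lemma dcone_sq F : dcone (R := R) F -> dcone (fun s : cfg => F s ^+ 2).
Proof.
by move=> cF; apply: dcone_ext (dcone_mul cF cF) => s; rewrite expr2.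
Qed.

Lemma dcone_occupied x : dcone (occupied x).
Proof. exact: dcone_sq (dcone_spin x). Qed.

Lemma dcone_agree b : dcone (fun s => (bondspin b s ^+ 2 + bondspin b s) / 2).
Proof.
have c2 : dcone (fun _ : cfg => 2^-1 : R) by apply: dcone_c; rewrite invr_ge0.
apply: dcone_mul => //; apply: dcone_add; last exact: dcone_bondspin.
exact: dcone_sq (dcone_bondspin _ _ b).
Qed.

Lemma dcone_open_prob b : dcone (open_prob b).
Proof.
apply: dcone_mul; last exact: dcone_agree.
by apply: dcone_c; case/andP: (open_factor01 b).
Qed.

Lemma occupied01 x s : 0 <= occupied x s <= 1.
Proof.
by rewrite /occupied; case: (spin_cases (R := R) s x) => ->; rewrite ?sqrrN ?expr1n ?expr0n /= ?ler01 ?lexx.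
Qed.

Lemma agree01 b s : 0 <= (bondspin b s ^+ 2 + bondspin b s) / 2 <= 1.
Proof. by case: (trivalued_bondspin (R := R) e1 e2 b s) => ->; apply/andP; split; lra. Qed.

Lemma open_prob01 b s : 0 <= open_prob b s <= 1.
Proof.
rewrite /open_prob; case/andP: (open_factor01 b) => c0 c1; case/andP: (agree01 b s) => o0 o1.
by rewrite mulr_ge0 //= mulr_ile1.
Qed.

Lemma weight_ext st st' s : (forall x, vs st x = vs st' x) -> (forall b, bs st b = bs st' b) ->
  weight st s = weight st' s.
Proof.
move=> ev eb; rewrite /weight; congr (_ * (_ * _)).
  by apply: eq_bigr => x _; rewrite ev.
by apply: eq_bigr => b _; rewrite /bond_weight eb.
Qed.

Definition splits (st : state) (p : R) st1 unrevealed := 0 <= p <= 1 /\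
  forall F, expect st F = p * expect st1 F + (1 - p) * expect unrevealed F.

Lemma expect01 st F : (forall s, 0 <= F s <= 1) -> 0 <= expect st F <= 1.
Proof.
move=> F01; apply/andP; split; first by apply: expect_ge0 => // s _; case/andP: (F01 s).
rewrite -[X in _ <= X](expect_cst e1 e2 K h a0 st); apply: expect_le => // s _.
by case/andP: (F01 s).
Qed.

Let weight_revealed st x w s : weight (reveal_site st x w) s * site_ind (vs st x) (spin s x) =
  weight st s * site_ind (reveal_status (vs st x) w) (spin s x).
Proof.
rewrite /weight; set A := \prod_y expR _; rewrite (bigD1 x) //= [in RHS](bigD1 x) //= eqxx.
set P := \prod_(y | y != x) _; set P' := \prod_(y | y != x) _.
have -> : P = P' by apply: eq_bigr => y /negbTE ->.
rewrite /bond_weight /=; ring.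
Qed.

Let weight_revealed_same st x w s : known (vs st x) -> weight (reveal_site st x w) s = weight st s.
Proof.
move=> kn; apply: weight_ext => // y /=; case: eqP => // ->.
by case: (vs st x) kn.
Qed.

Lemma reveal_site_cond1 st x : expect st (occupied x) != 0 ->
  exists2 al, al != 0 & forall s, weight (reveal_site st x true) s = al * (weight st s * occupied x s).
Proof.
move=> n0; exists 1; rewrite ?oner_neq0 // => s; rewrite mul1r.
case ev : (vs st x).
- by have := weight_revealed st x true s; rewrite ev /= mulr1.
- case/eqP: n0; rewrite -(expect_cst e1 e2 K h a0 st 0); apply: expect_supp => // t /(supp_ind x).
  by rewrite ev /occupied => ->; rewrite expr0n.
all: rewrite weight_revealed_same ?ev //.
all: have [/(supp_ind x)|ns] := boolP (supp st s); last by rewrite weight_supp0 // mul0r.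
all: by rewrite ev /occupied => ->; rewrite ?expr1n mulr1.
Qed.

Lemma reveal_site_cond0 st x : expect st (occupied x) != 1 ->
  exists2 al, al != 0 & forall s, weight (reveal_site st x false) s = al * (weight st s * (1 - occupied x s)).
Proof.
move=> n1; exists 1; rewrite ?oner_neq0 // => s; rewrite mul1r.
case ev : (vs st x).
- by have := weight_revealed st x false s; rewrite ev /= mulr1.
- rewrite weight_revealed_same ?ev //.
  have [/(supp_ind x)|ns] := boolP (supp st s); last by rewrite weight_supp0 // mul0r.
  by rewrite ev /occupied => ->; rewrite expr0n subr0 mulr1.
all: case/eqP: n1; rewrite -(expect_cst e1 e2 K h a0 st 1); apply: expect_supp => // t /(supp_ind x).
all: by rewrite ev /occupied => ->; rewrite ?expr1n.
Qed.

Lemma reveal_site_splits st x : splits st (expect st (occupied x)) (reveal_site st x true) (reveal_site st x false).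
Proof.
split; first by apply: expect01 => s; exact: occupied01.
move=> F; apply: expect_split; rewrite ?a0 //.
- by move=> s _; exact: occupied01.
- exact: reveal_site_cond1.
- exact: reveal_site_cond0.
Qed.

Let bondspin_known st b s : knownb st b -> supp st s ->
  if hasabs st b then bondspin b s = 0 else bondspin b s = -1 \/ bondspin b s = 1.
Proof.
rewrite /knownb /hasabs /bondspin => kn ss; move: kn (supp_ind (e1 b) ss) (supp_ind (e2 b) ss).
case: (vs st (e1 b)) => //=; case: (vs st (e2 b)) => //= _; try by move=> -> _; rewrite mul0r.
all: try by move=> _ ->; rewrite mulr0.
all: case: (spin_cases (R := R) s (e1 b)) => ->; case: (spin_cases (R := R) s (e2 b)) => ->;
  rewrite ?expr0n ?sqrrN ?expr1n ?mulrN1 ?mulr1 ?mul1r ?opprK /=; try lra.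
all: by move=> *; (left + right).
Qed.

Let weight_bond st st' b s : (forall x, vs st x = vs st' x) ->
  (forall b', b' != b -> bs st b' = bs st' b') ->
  weight st s * bond_weight st' b s = weight st' s * bond_weight st b s.
Proof.
move=> ev eb; rewrite /weight.
have -> : \prod_x (apriori a (spin s x) * site_ind (vs st x) (spin s x)) =
          \prod_x (apriori a (spin s x) * site_ind (vs st' x) (spin s x)).
  by apply: eq_bigr => x _; rewrite ev.
rewrite [X in _ * (_ * X) * _](bigD1 b) //= [X in _ = _ * (_ * X) * _](bigD1 b) //=.
set P := \prod_(y | y != b) _; set P' := \prod_(y | y != b) _.
have -> : P = P' by apply: eq_bigr => y /eb; rewrite /bond_weight => ->.
ring.
Qed.

(** On known ends, [expR (K b * bondspin b s)] times the probability of being closed is constant: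
    [1] if an end is absent, [expR (- K b)] if both are occupied, whether they agree or not. *)
Lemma bond_cond0 st st' b : knownb st b -> bs st b = Free ->
  (forall x, vs st' x = vs st x) -> (forall b', bs st' b' = if b' == b then Closed else bs st b') ->
  exists2 al, al != 0 & forall s, weight st' s = al * (weight st s * (1 - open_prob b s)).
Proof.
move=> kn bf ev eb.
exists (if hasabs st b then 1 else expR (K b)).
  by case: ifP => _; rewrite ?oner_neq0 // gt_eqF // expR_gt0.
move=> s; have E : weight st s = weight st' s * expR (K b * bondspin b s).
  have := @weight_bond st' st b s ev; rewrite /bond_weight eb eqxx bf mulr1 => -> //.
  by move=> b' nb; rewrite eb (negbTE nb).
have [ss|ns] := boolP (supp st s); last first.
  have : weight st s = 0 by rewrite weight_supp0.
  rewrite E => /eqP; rewrite mulf_eq0 [X in _ || X]gt_eqF ?expR_gt0 // orbF => /eqP ->.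
  by rewrite !mul0r mulr0.
rewrite E /open_prob; have := bondspin_known kn ss; case: ifP => _.
  by move=> ->; rewrite expr0n /= mulr0 expR0; ring.
case=> ->.
  rewrite sqrrN expr1n mulrN1 addrN mul0r mulr0 subr0 mulr1 mulrCA -expRD addrN expR0; ring.
rewrite expr1n mulr1 divff // mulr1 subKr.
have -> : expR (K b) * (weight st' s * expR (K b) * expR (- (2 * K b))) =
   weight st' s * (expR (K b) * (expR (K b) * expR (- (2 * K b)))) by ring.
rewrite -!expRD; have -> : K b + (K b + - (2 * K b)) = 0 by ring.
by rewrite expR0 mulr1.
Qed.

Lemma open_prob_absent st b : knownb st b -> hasabs st b -> expect st (open_prob b) = 0.
Proof.
move=> kn ha; rewrite -(expect_cst e1 e2 K h a0 st 0); apply: expect_supp => // t ss.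
by have := bondspin_known kn ss; rewrite ha /open_prob => ->; rewrite expr0n /= addr0 mul0r mulr0.
Qed.

Lemma open_factor_neq0 st b : expect st (open_prob b) != 0 -> 1 - expR (- (2 * K b)) != 0.
Proof.
apply: contraNneq => e; apply/eqP; rewrite -(expect_cst e1 e2 K h a0 st 0); apply: eq_expect => // s.
by rewrite /open_prob e mul0r.
Qed.

Lemma reveal_bond_cond1 st b : knownb st b -> bs st b = Free -> expect st (open_prob b) != 0 ->
  exists2 al, al != 0 & forall s, weight (reveal_bond st b true) s = al * (weight st s * open_prob b s).
Proof.
move=> kn bf n0; have c0 := open_factor_neq0 n0.
have ha : hasabs st b = false by apply/negP => ha; move: n0; rewrite open_prob_absent ?eqxx.
(* Where the ends agree, the free factor times the opening probability is
   [expR (K b) * (1 - expR (- (2 * K b)))], while the factor of an open bond is [2]. *)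
exists (2 / (expR (K b) * (1 - expR (- (2 * K b))))).
  by rewrite mulf_neq0 // invr_neq0 // mulf_neq0 // gt_eqF ?expR_gt0.
move=> s; have E : weight (reveal_bond st b true) s * expR (K b * bondspin b s) = weight st s * (1 + bondspin b s).
  have := @weight_bond (reveal_bond st b true) st b s (fun _ => erefl).
  by rewrite /bond_weight /= eqxx bf; apply=> b' /negbTE ->.
have [ss|ns] := boolP (supp st s); last first.
  move: E; rewrite [weight st s]weight_supp0 // !mul0r mulr0 => /eqP.
  by rewrite mulf_eq0 [X in _ || X]gt_eqF ?expR_gt0 // orbF => /eqP.
have := bondspin_known kn ss; rewrite ha /open_prob => -[] e; move: E; rewrite e.
  rewrite addrN mulr0 sqrrN expr1n addrN mul0r !mulr0 => /eqP.
  by rewrite mulf_eq0 [X in _ || X]gt_eqF ?expR_gt0 // orbF => /eqP.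
rewrite mulr1 expr1n => E.
have ek : expR (K b) != 0 by rewrite gt_eqF ?expR_gt0.
apply: (mulIf ek); rewrite E; move: c0 ek; set c := 1 - _; set k := expR _ => c0 ek.
by field; rewrite c0 ek.
Qed.

(** An open bond makes its ends agree, so one plus end makes both plus: conditioning on openness
    amounts to the status [Plus] at both ends. *)
Lemma explore_bond_cond1 st b : knownb st b -> hasplus st b -> bs st b = Free -> expect st (open_prob b) != 0 ->
  exists2 al, al != 0 & forall s, weight (explore_bond st b true) s = al * (weight st s * open_prob b s).
Proof.
move=> kn pl bf n0; have c0 := open_factor_neq0 n0.
have ha : hasabs st b = false by apply/negP => ha; move: n0; rewrite open_prob_absent ?eqxx.
exists ((expR (K b) * (1 - expR (- (2 * K b))))^-1).
  by rewrite invr_neq0 // mulf_neq0 // gt_eqF ?expR_gt0.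
move=> s.
have [/andP[/eqP s1 /eqP s2]|ns] := boolP ((spin s (e1 b) == 1) && (spin s (e2 b) == 1)); last first.
  rewrite [weight (explore_bond _ _ _) _]weight_supp0.
    have [ss|nss] := boolP (supp st s); last by rewrite weight_supp0 // mul0r mulr0.
    suff -> : open_prob b s = 0 by rewrite !mulr0.
    have -> // : bondspin b s = -1 -> open_prob b s = 0.
      by rewrite /open_prob => ->; rewrite sqrrN expr1n addrN mul0r mulr0.
    have := bondspin_known kn ss; rewrite ha => -[] //; rewrite /bondspin.
    move: pl ns (supp_ind (e1 b) ss) (supp_ind (e2 b) ss); rewrite /hasplus.
    case: (vs st (e1 b)) => //; case: (vs st (e2 b)) => //= _ ns.
    - by move=> _ s2; move: ns; rewrite s2 eqxx andbT mulr1 => /eqP.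
    - by move=> _ s2; move: ns; rewrite s2 eqxx andbT mulr1 => /eqP.
    - by move=> _ s2; move: ns; rewrite s2 eqxx andbT mulr1 => /eqP.
    - by move=> s1; move: ns; rewrite s1 eqxx /= mul1r => /eqP.
    - by move=> s1; move: ns; rewrite s1 eqxx /= mul1r => /eqP.
    - by move=> s1; move: ns; rewrite s1 eqxx /= mul1r => /eqP.
    - by move=> s1 s2; move: ns; rewrite s1 s2 eqxx.
  apply: contra ns => ss; have := supp_ind (e1 b) ss; have := supp_ind (e2 b) ss.
  by rewrite /= ha !eqxx ?orbT /= => -> ->; rewrite !eqxx.
have bd1 : bondspin b s = 1 by rewrite /bondspin s1 s2 mulr1.
have -> : open_prob b s = 1 - expR (- (2 * K b)) by rewrite /open_prob bd1 expr1n divff // mulr1.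
have ek : expR (K b) != 0 by rewrite gt_eqF ?expR_gt0.
suff -> : weight st s = weight (explore_bond st b true) s * expR (K b).
  by move: c0 ek; set c := 1 - _; set k := expR _ => c0 ek; field; rewrite c0 ek.
have -> : weight (explore_bond st b true) s = weight (reveal_bond st b false) s.
  rewrite /weight; congr (_ * _); apply: eq_bigr => x _; rewrite /= ha /=.
  case: ifP => // /orP[] /eqP ->; rewrite ?s1 ?s2; congr (_ * _).
    move: ha kn; rewrite /hasabs /knownb; case: (vs st (e1 b)) => //= _ _; lra.
  move: ha kn; rewrite /hasabs /knownb orbC andbC; case: (vs st (e2 b)) => //= _ _; lra.
have := @weight_bond (reveal_bond st b false) st b s (fun _ => erefl).
rewrite /bond_weight /= eqxx bf bd1 !mulr1 => -> // b' /negbTE -> //.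
Qed.

Lemma reveal_bond_splits st b : knownb st b -> bs st b = Free ->
  splits st (expect st (open_prob b)) (reveal_bond st b true) (reveal_bond st b false).
Proof.
move=> kn bf; split; first by apply: expect01 => s; exact: open_prob01.
move=> F; apply: expect_split; rewrite ?a0 //.
- by move=> s _; exact: open_prob01.
- exact: reveal_bond_cond1.
- by move=> _; apply: bond_cond0.
Qed.

Lemma explore_bond_splits st b : knownb st b -> hasplus st b -> bs st b = Free ->
  splits st (expect st (open_prob b)) (explore_bond st b true) (explore_bond st b false).
Proof.
move=> kn pl bf; split; first by apply: expect01 => s; exact: open_prob01.
move=> F; apply: expect_split; rewrite ?a0 //.
- by move=> s _; exact: open_prob01.
- exact: explore_bond_cond1.
- by move=> _; apply: bond_cond0.
Qed.

Lemma reveal_site_mul st x F : expect st (occupied x) * expect (reveal_site st x true) F = expect st (fun s => occupied x s * F s).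
Proof. by apply: expect_cond => //; [move=> s _; case/andP: (occupied01 x s)|exact: reveal_site_cond1]. Qed.

Lemma reveal_bond_mul st b F : knownb st b -> bs st b = Free ->
  expect st (open_prob b) * expect (reveal_bond st b true) F = expect st (fun s => open_prob b s * F s).
Proof. by move=> *; apply: expect_cond => //; [move=> s _; case/andP: (open_prob01 b s)|exact: reveal_bond_cond1]. Qed.

End Reveal.

(** * The OSSS-type inequality *)

Section Sync.
Context {R : realType}.
Implicit Types (p q : R) (d : bool -> bool -> R).

(* The mean of [d] over two bits of laws [p] and [q] driven by the same uniform variable. *)
Definition sync p q d : R :=
  Num.min p q * d true true + (p - Num.min p q) * d true false +
  (q - Num.min p q) * d false true + (1 - Num.max p q) * d false false.

Lemma sync_dom p q d (f : bool -> R) : 0 <= p <= 1 -> 0 <= q <= 1 -> q <= p ->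
  (forall v w, w ==> v -> d v w = f w) -> sync p q d = q * f true + (1 - q) * f false.
Proof.
move=> _ _ qp e; rewrite /sync min_r // max_l // subrr mul0r addr0.
by rewrite !e //; ring.
Qed.

(** All three bits, of laws [p], [q] and [q'], are read off one uniform variable. The position of
    [p] relative to [q <= q'] gives three cases; in each the unit interval splits into four pieces
    on which the bits are constant. *)
Lemma sync_lip p q q' d d' (f f' : bool -> R) :
  0 <= p <= 1 -> 0 <= q <= 1 -> 0 <= q' <= 1 -> q <= q' ->
  (forall v w w', w ==> w' -> 0 <= d' v w' - d v w <= f' w' - f w) ->
  0 <= sync p q' d' - sync p q d <=
    (q' * f' true + (1 - q') * f' false) - (q * f true + (1 - q) * f false).
Proof.
move=> /andP[p0 p1] /andP[q0 q1] /andP[q'0 q'1] qq' H.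
have H' w0 v w w' : 0 <= w0 -> w ==> w' ->
    0 <= w0 * (d' v w' - d v w) /\ w0 * (d' v w' - d v w) <= w0 * (f' w' - f w).
  move=> w00 ww; case/andP: (H v w w' ww) => h1 h2.
  by rewrite mulr_ge0 // ler_wpM2l.
rewrite /sync.
have [pq|qp] := leP p q.
  have pq' := le_trans pq qq'; rewrite min_l // max_r //.
  have [a1 a2] := H' p true true true p0 isT.
  have [b1 b2] := H' (q - p) false true true ltac:(by rewrite subr_ge0) isT.
  have [c1 c2] := H' (q' - q) false false true ltac:(by rewrite subr_ge0) isT.
  have [e1 e2] := H' (1 - q') false false false ltac:(by rewrite subr_ge0) isT.
  apply/andP; split; lra.
have [pq'|q'p] := leP p q'.
  have [a1 a2] := H' q true true true q0 isT.
  have [b1 b2] := H' (p - q) true false true ltac:(by rewrite subr_ge0 ltW) isT.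
  have [c1 c2] := H' (q' - p) false false true ltac:(by rewrite subr_ge0) isT.
  have [e1 e2] := H' (1 - q') false false false ltac:(by rewrite subr_ge0) isT.
  apply/andP; split; lra.
have [a1 a2] := H' q true true true q0 isT.
have [b1 b2] := H' (q' - q) true false true ltac:(by rewrite subr_ge0) isT.
have [c1 c2] := H' (p - q') true false false ltac:(by rewrite subr_ge0 ltW) isT.
have [e1 e2] := H' (1 - p) false false false ltac:(by rewrite subr_ge0) isT.
by apply/andP; split; lra.
Qed.

(** Synchronized and independent bits have the same marginals, so the two means differ by
    [Num.min p q - p * q], which is at most [q * (1 - q)], times the mixed second difference of [d].
    The resulting cost [q * (1 - q) * (f true - f false)] involves the second bit only. *)
Lemma sync_indep p q d (f : bool -> R) :
  0 <= p <= 1 -> 0 <= q <= 1 ->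
  (forall v, 0 <= d v true - d v false <= f true - f false) ->
  sync p q d <= p * (q * d true true + (1 - q) * d true false) +
     (1 - p) * (q * d false true + (1 - q) * d false false) + q * (1 - q) * (f true - f false).
Proof.
move=> /andP[p0 p1] /andP[q0 q1] H.
case/andP: (H true) => t0 t1; case/andP: (H false) => s0 s1.
set m := Num.min p q.
have mx : Num.max p q = p + q - m by rewrite /m; case: (leP p q) => _; ring.
have m1 : 0 <= m - p * q <= q * (1 - q).
  rewrite /m; case: (leP p q) => [pq|qp].
    have := mulr_ge0 p0 (_ : 0 <= 1 - q); rewrite subr_ge0 => /(_ q1) u.
    have := ler_wpM2r (_ : 0 <= 1 - q) pq; rewrite subr_ge0 => /(_ q1) w.
    by apply/andP; split; lra.
  have := mulr_ge0 q0 (_ : 0 <= 1 - p); rewrite subr_ge0 => /(_ p1) u.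
  have := ler_wpM2l q0 (ltW qp) => w.
  by apply/andP; split; lra.
case/andP: m1 => m0 m1.
rewrite /sync -/m mx.
set D := d true true - d true false - (d false true - d false false).
have -> : m * d true true + (p - m) * d true false + (q - m) * d false true +
    (1 - (p + q - m)) * d false false =
   p * (q * d true true + (1 - q) * d true false) +
     (1 - p) * (q * d false true + (1 - q) * d false false) + (m - p * q) * D.
  by rewrite /D; ring.
rewrite lerD2l.
have DF : D <= f true - f false by rewrite /D; lra.
have FF : 0 <= f true - f false by lra.
by apply: le_trans (ler_wpM2l m0 DF) _; exact: ler_wpM2r.
Qed.

End Sync.

(** * The two coupled runs and the cost of decoupling them *)

Section Exploration.
Context {R : realType} {V B : finType} (e1 e2 : B -> V) (K : B -> R) (h : V -> R) (a : R).
Context (K0 : forall b, 0 <= K b) (h0 : forall x, 0 <= h x) (a0 : 0 < a).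

Notation cfg := (@cfg V).
Notation spin := (@spin R V).
Notation state := (@state V B).
Notation bondspin := (@bondspin R V B e1 e2).
Notation bond_weight := (bond_weight e1 e2 K).
Notation weight := (weight e1 e2 K h a).
Notation expect := (expect e1 e2 K h a).
Notation le_state := (@le_state V B e1 e2).
Notation hasabs := (@hasabs V B e1 e2).
Notation hasplus := (@hasplus V B e1 e2).
Notation supp := (@supp R V B).
Notation knownb := (@knownb V B e1 e2).
Notation explore_bond := (@explore_bond V B e1 e2).
Notation open_prob := (@open_prob R V B e1 e2 K).
Notation occupied := (@occupied R V).
Notation opens_known := (@opens_known V B e1 e2).
Notation splits := (@splits R V B e1 e2 K h a).

Context (o : V).
Let so (s : cfg) : R := spin s o.
Notation f := (fun st => expect st so).

Definition influence (Q : cfg -> R) (J : state) := expect J (fun s => Q s * so s) - expect J Q * f J.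

Definition syncV x (k : state -> state -> R) I J :=
  sync (expect I (occupied x)) (expect J (occupied x)) (fun v w => k (reveal_site I x v) (reveal_site J x w)).
Definition syncB b (k : state -> state -> R) I J :=
  sync (expect I (open_prob b)) (expect J (open_prob b)) (fun v w => k (explore_bond I b v) (reveal_bond J b w)).

(* Each explored bond reveals both ends before itself, so that closing it never changes the
   a priori weight of an end. *)
Fixpoint coupled n (N : {set B}) (I J : state) : R :=
  match n with
  | 0%N => (isplus (vs I o))%:R * f J
  | n'.+1 => match [pick b in N | hasplus I b] with
     | None => (isplus (vs I o))%:R * f J
     | Some b => syncV (e1 b) (syncV (e2 b) (syncB b (coupled n' (N :\ b)))) I J
     end
  end.

Lemma dcone_o : dcone so. Proof. exact: dcone_spin. Qed.

Lemma p_occupied01 st x : 0 <= expect st (occupied x) <= 1.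
Proof. by apply: expect01 => // s; exact: occupied01. Qed.
Lemma p_open01 st b : 0 <= expect st (open_prob b) <= 1.
Proof. by apply: expect01 => // s; exact: open_prob01. Qed.

Lemma f_ge0 st : 0 <= f st.
Proof. by apply: gks1 => //; [move=> s sz; rewrite /so sz|exact: dcone_o]. Qed.

Lemma f_plus st x : isplus (vs st x) -> expect st (fun s => spin s x) = 1.
Proof.
move=> px; rewrite -(expect_cst e1 e2 K h a0 st 1); apply: expect_supp => // s /(supp_ind x).
by case: (vs st x) px.
Qed.

Definition J_inv (N : {set B}) J := opens_known J /\ forall b, b \in N -> bs J b = Free.

(** Enlarging the second state raises [k] by no more than it raises the magnetization there. This is
    the bound on differences that [sync_indep] takes as hypothesis. *)
Definition Lip (P : state -> Prop) (k : state -> state -> R) := forall I J J', P J -> P J' ->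
  le_state J J' -> 0 <= k I J' - k I J <= f J' - f J.

Lemma Lip_V P P' x k : (forall J w, P J -> P' (reveal_site J x w)) -> Lip P' k -> Lip P (syncV x k).
Proof.
move=> PP' lk I J J' J_inv1 J_inv2 l.
have [q01 sJ] := reveal_site_splits e1 e2 K h a0 J x.
have [q01' sJ'] := reveal_site_splits e1 e2 K h a0 J' x.
rewrite (sJ so) (sJ' so).
apply: (@sync_lip R _ _ _ _ _ (fun w => f (reveal_site J x w)) (fun w => f (reveal_site J' x w))); rewrite ?p_occupied01 //.
  by apply: expect_mono => //; exact: dcone_occupied.
by move=> v w w' ww; apply: lk; [exact: PP'|exact: PP'|exact: reveal_site_le].
Qed.

Lemma Lip_B (P P' : state -> Prop) b k : (forall J, P J -> [/\ opens_known J, knownb J b & bs J b = Free]) ->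
  (forall J w, P J -> P' (reveal_bond J b w)) -> Lip P' k -> Lip P (syncB b k).
Proof.
move=> Pb PP' lk I J J' J_inv1 J_inv2 l.
have [jt kn bf] := Pb _ J_inv1; have [jt' kn' bf'] := Pb _ J_inv2.
have [q01 sJ] := reveal_bond_splits h K0 a0 kn bf.
have [q01' sJ'] := reveal_bond_splits h K0 a0 kn' bf'.
rewrite (sJ so) (sJ' so).
apply: (@sync_lip R _ _ _ _ _ (fun w => f (reveal_bond J b w)) (fun w => f (reveal_bond J' b w))); rewrite ?p_open01 //.
  by apply: expect_mono => //; exact: dcone_open_prob.
move=> v w w' ww; apply: lk; [exact: PP'|exact: PP'|].
by apply: reveal_bond_le => //; case: jt.
Qed.

Lemma known_reveal_site (st : state) x y w : known (vs st x) -> known (vs (reveal_site st y w) x).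
Proof. by move=> /=; case: eqP => // _; rewrite known_reveal. Qed.

Lemma known_revealed (st : state) x w : known (vs (reveal_site st x w) x).
Proof. by rewrite /= eqxx known_reveal. Qed.

Definition J_inv1 N x J := J_inv N J /\ known (vs J x).
Definition J_inv2 N b J := J_inv N J /\ knownb J b.

Lemma J_inv_reveal N J x w : J_inv N J -> J_inv N (reveal_site J x w).
Proof. by move=> [jt nf]; split; [exact: reveal_site_known|]. Qed.

Lemma J_inv1_reveal N J b w : J_inv N J -> J_inv1 N (e1 b) (reveal_site J (e1 b) w).
Proof. by move=> p; split; [exact: J_inv_reveal|exact: known_revealed]. Qed.

Lemma J_inv2_reveal N J b w : J_inv1 N (e1 b) J -> J_inv2 N b (reveal_site J (e2 b) w).
Proof. by move=> [p k]; split; [exact: J_inv_reveal|rewrite /knownb known_revealed known_reveal_site]. Qed.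

Lemma J_inv_reveal_bond N J b w : J_inv2 N b J -> J_inv (N :\ b) (reveal_bond J b w).
Proof.
move=> [[jt nf] kn]; split; first exact: reveal_bond_known.
by move=> b'; rewrite !inE /= => /andP[/negbTE -> b'N]; exact: nf.
Qed.

Lemma Lip_stageB (N : {set B}) b k : b \in N -> Lip (J_inv (N :\ b)) k -> Lip (J_inv2 N b) (syncB b k).
Proof.
move=> bN; apply: Lip_B => [J [[jt nf] kn]|J w]; last exact: J_inv_reveal_bond.
by split => //; exact: nf.
Qed.

Lemma Lip_stageV (N : {set B}) b k : b \in N -> Lip (J_inv (N :\ b)) k ->
  Lip (J_inv1 N (e1 b)) (syncV (e2 b) (syncB b k)).
Proof. by move=> bN lk; apply: Lip_V (Lip_stageB bN lk) => J w; exact: J_inv2_reveal. Qed.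

Lemma coupled_lip n N : Lip (J_inv N) (coupled n N).
Proof.
have base N' : Lip (J_inv N') (fun I J => (isplus (vs I o))%:R * f J).
  move=> I J J' _ _ l; have := expect_mono K0 h0 a0 l dcone_o; rewrite -subr_ge0 => m.
  by rewrite -mulrBr; case: (isplus _); rewrite ?mul1r ?mul0r ?lexx ?m.
elim: n N => [|n IH] N; first exact: base.
move=> I J J' p1 p2 l /=; case: pickP => [b /andP[bN _]|_]; last exact: (base N).
suff : Lip (J_inv N) (syncV (e1 b) (syncV (e2 b) (syncB b (coupled n (N :\ b))))) by apply.
by apply: Lip_V (Lip_stageV bN (IH _)) => J0 w; exact: J_inv1_reveal.
Qed.

(* The region [S] carries no field and every bond touching it outside [N0] is inactive,
   so once no unexplored bond touches a [Plus] vertex the unreached part is spin-flip symmetric. *)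
Context (S : {set V}) (N0 : {set B}).
Context (hS : forall x, x \in S -> h x = 0).
Context (KN0 : forall b, b \notin N0 -> (e1 b \in S) || (e2 b \in S) -> K b = 0).

Definition I_inv (N : {set B}) I := [/\ no_open I, forall b, b \in N -> bs I b = Free,
   forall b, b \in N0 -> b \notin N -> bs I b = Closed & forall x, x \notin S -> isplus (vs I x)].

Definition flip (I : state) (s : cfg) : cfg :=
  [ffun x => if isplus (vs I x) then s x else rev_ord (s x)].

Lemma flipK I : involutive (flip I).
Proof. by move=> s; apply/ffunP => x; rewrite !ffunE; case: (isplus _); rewrite ?rev_ordK. Qed.

Lemma spin_flip I s x : spin (flip I s) x = if isplus (vs I x) then spin s x else - spin s x.
Proof.
rewrite /spin ffunE; case: (isplus _) => //; rewrite /sv /=; case: (s x) => -[|[|[|//]]] ? /=.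
- by rewrite sub0r opprK /subn /= mulr2n addrK.
- by rewrite /subn /= subrr oppr0.
- by rewrite /subn /= sub0r mulr2n addrK.
Qed.

(** Flip every spin that is not known to be plus. No field acts on these sites, and a bond joining
    one of them to a plus site has either been explored, hence is closed, or has [K b = 0]. The
    weight is thus invariant while the spin at [o] changes sign. *)
Lemma leaf_sym N I : I_inv N I -> (forall b, b \in N -> ~~ hasplus I b) -> ~~ isplus (vs I o) -> f I = 0.
Proof.
move=> [it fr cl ou] np no.
suff e : \sum_(s : cfg) weight I s * so s = - \sum_(s : cfg) weight I s * so s.
  have {e} : \sum_(s : cfg) weight I s * so s = 0 by lra.
  rewrite (sum_weightE e1 e2 K h a0) => /eqP; rewrite mulf_eq0.
  by rewrite (negbTE (partition_neq0 e1 e2 K h a0 I)) => /eqP.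
rewrite [LHS](reindex_inj (inv_inj (@flipK I))) /= -sumrN; apply: eq_bigr => s _.
rewrite -mulrN; congr (_ * _); last by rewrite /so spin_flip (negbTE no).
rewrite /weight; congr (_ * (_ * _)).
- apply: eq_bigr => x _; rewrite spin_flip; case ex : (vs I x) => //=;
   by rewrite /apriori ?sqrrN.
- apply: eq_bigr => x _; rewrite spin_flip; case ip : (isplus _) => //.
  suff -> : h x = 0 by rewrite !mul0r.
  by apply: hS; apply: contraFT ip => /ou.
apply: eq_bigr => b _; rewrite /bond_weight; move: (it b); case eb : (bs I b) => // _.
suff : bondspin b (flip I s) = bondspin b s \/ K b = 0.
  by case=> ->; rewrite // !mul0r.
rewrite /bondspin !spin_flip.
case i1 : (isplus (vs I (e1 b))); case i2 : (isplus (vs I (e2 b))).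
- by left.
- right; have hp : hasplus I b by rewrite /hasplus i1.
  apply: KN0; last by apply/orP; right; apply: contraFT i2 => /ou.
  apply/negP => bN0; have [bN|bN] := boolP (b \in N); first by have := np _ bN; rewrite hp.
  by have := cl _ bN0 bN; rewrite eb.
- right; have hp : hasplus I b by rewrite /hasplus i2 orbT.
  apply: KN0; last by apply/orP; left; apply: contraFT i1 => /ou.
  apply/negP => bN0; have [bN|bN] := boolP (b \in N); first by have := np _ bN; rewrite hp.
  by have := cl _ bN0 bN; rewrite eb.
- by left; rewrite mulrNN.
Qed.

Lemma syncV_dom (P P' : state -> state -> Prop) x k :
  (forall I J, P I J -> le_state J I) ->
  (forall I J v w, P I J -> w ==> v -> P' (reveal_site I x v) (reveal_site J x w)) ->
  (forall I J, P' I J -> k I J = f J) -> forall I J, P I J -> syncV x k I J = f J.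
Proof.
move=> Pl PP' kf I J p; have [q01 sJ] := reveal_site_splits e1 e2 K h a0 J x.
rewrite (sJ so); apply: (@sync_dom R _ _ _ (fun w => f (reveal_site J x w))); rewrite ?p_occupied01 //.
  by apply: expect_mono => //; [exact: Pl|exact: dcone_occupied].
by move=> v w ww; apply: kf; exact: PP'.
Qed.

Lemma syncB_dom (P P' : state -> state -> Prop) b k :
  (forall I J, P I J -> [/\ le_state J I, knownb J b & bs J b = Free]) ->
  (forall I J v w, P I J -> w ==> v -> P' (explore_bond I b v) (reveal_bond J b w)) ->
  (forall I J, P' I J -> k I J = f J) -> forall I J, P I J -> syncB b k I J = f J.
Proof.
move=> Pl PP' kf I J p; have [l kn bf] := Pl _ _ p; have [q01 sJ] := reveal_bond_splits h K0 a0 kn bf.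
rewrite (sJ so); apply: (@sync_dom R _ _ _ (fun w => f (reveal_bond J b w))); rewrite ?p_open01 //.
  by apply: expect_mono => //; exact: dcone_open_prob.
by move=> v w ww; apply: kf; exact: PP'.
Qed.

Lemma isplus_reveal_site (I : state) x y v : isplus (vs I y) -> isplus (vs (reveal_site I x v) y).
Proof. by move=> /=; case: eqP => // _; exact: isplus_reveal. Qed.

(** [J] stays below [I] along the synchronized run, and the fuel [n] lets it continue until no
    unexplored bond has a plus end. A final state in which [I] has missed [o] contributes nothing,
    as [f J <= f I = 0]; so the indicator in [coupled] may be dropped, and the martingale [f J]
    keeps its initial value. *)
Lemma coupled_dom n (N : {set B}) I J : (#|N| <= n)%N -> I_inv N I -> J_inv N J -> le_state J I -> coupled n N I J = f J.
Proof.
have leaf N' I' J' : I_inv N' I' -> le_state J' I' -> (forall b, b \in N' -> ~~ hasplus I' b) ->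
    (isplus (vs I' o))%:R * f J' = f J'.
  move=> q l np; case io : (isplus (vs I' o)); rewrite ?mul1r // mul0r.
  have := leaf_sym q np; rewrite io => /(_ isT) fI0.
  by apply/esym/eqP; rewrite eq_le f_ge0 -fI0 expect_mono //; exact: dcone_o.
elim: n N I J => [|n IH] N I J.
  rewrite leqn0 cards_eq0 => /eqP -> qi pj l /=.
  have np b : b \in (finset.set0 : {set B}) -> ~~ hasplus I b by rewrite inE.
  exact: leaf qi l np.
move=> cN qi pj l /=; case: pickP => [b /andP[bN _]|np]; last first.
  have np' b : b \in N -> ~~ hasplus I b by move=> bN; have := np b; rewrite /= bN /= => ->.
  exact: leaf qi l np'.
pose P I J := [/\ I_inv N I, J_inv N J & le_state J I].
have PV x I0 J0 v w : P I0 J0 -> w ==> v -> P (reveal_site I0 x v) (reveal_site J0 x w).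
  move=> [[it fr cl ou] [jt nf] l0] ww; split; last exact: reveal_site_le.
    by split => // y yS; apply: isplus_reveal_site; exact: ou.
  by split; [exact: reveal_site_known|].
apply: (syncV_dom (P := P) (P' := fun I J => P I J /\ known (vs J (e1 b)))) => //.
- by move=> I0 J0 [].
- by move=> I0 J0 v w p ww; split; [exact: PV|exact: known_revealed].
apply: (syncV_dom (P' := fun I J => P I J /\ knownb J b)) => //.
- by move=> I0 J0 [[]].
- by move=> I0 J0 v w [p kn] ww; split; [exact: PV|rewrite /knownb known_revealed known_reveal_site].
apply: (syncB_dom (P' := fun I J => [/\ I_inv (N :\ b) I, J_inv (N :\ b) J & le_state J I])) => //.
- by move=> I0 J0 [[_ [_ nf] l0] kn]; split => //; exact: nf.
- move=> I0 J0 v w [[[it fr cl ou] [jt nf] l0] kn] ww; split.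
  + split.
    * exact: explore_bond_no_open.
    * by move=> b'; rewrite !inE /= => /andP[/negbTE -> b'N]; exact: fr.
    * move=> b' b'N0; rewrite !inE /=; case: eqP => //= _ b'N; exact: cl.
    * by move=> y yS /=; case: ifP => // _; exact: ou.
  + split; first exact: reveal_bond_known.
    by move=> b'; rewrite !inE /= => /andP[/negbTE -> b'N]; exact: nf.
  + exact: reveal_explore_le.
move=> I0 J0 [qi0 pj0 l0]; apply: IH => //.
by move: cN; rewrite (cardsD1 b) bN.
Qed.

(** Stands for the probability that [I] ever explores [b]: a nonnegative martingale in [I], at least
    1 once an end is plus. *)
Definition reach b I := expect I (fun s => spin s (e1 b)) + expect I (fun s => spin s (e2 b)).
Definition bond_influence b J := influence (occupied (e1 b)) J + (influence (occupied (e2 b)) J + influence (open_prob b) J).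
(* Product of a martingale in [I] and a supermartingale in [J], summed over the bonds left. *)
Definition budget (N : {set B}) (L : seq (cfg -> R)) I J :=
  f I * f J + \sum_(b in N) reach b I * bond_influence b J + \sum_(Q <- L) influence Q J.

Definition supermart (J J1 J0 : state) q (w : state -> R) :=
  q * w J1 + (1 - q) * w J0 <= w J.

(** Law of total covariance: the dropped term is the covariance of the two conditional means,
    nonnegative because both increase with the revealed bit. *)
Lemma influence_super J J1 J0 q Q : splits J q J1 J0 -> le_state J0 J1 -> dcone Q ->
  supermart J J1 J0 q (influence Q).
Proof.
move=> [/andP[q0 q1] sJ] l cQ; rewrite /supermart /influence !sJ.
have f1 := expect_mono K0 h0 a0 l dcone_o; have Q1 := expect_mono K0 h0 a0 l cQ.
have := mulr_ge0 (mulr_ge0 q0 (_ : 0 <= 1 - q)) (mulr_ge0 (_ : 0 <= f J1 - f J0) (_ : 0 <= expect J1 Q - expect J0 Q)).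
rewrite !subr_ge0 => /(_ q1 f1 Q1).
set x1 := expect J1 _; set x2 := expect J0 _; set y1 := expect J1 Q; set y2 := expect J0 Q.
set z1 := expect J1 so; set z2 := expect J0 so; move=> H.
rewrite -subr_ge0; move: H; congr (0 <= _); ring.
Qed.

Lemma bond_influence_super J J1 J0 q b : splits J q J1 J0 -> le_state J0 J1 -> supermart J J1 J0 q (bond_influence b).
Proof.
move=> s l.
have := influence_super s l (dcone_occupied (R := R) (e1 b)); have := influence_super s l (dcone_occupied (R := R) (e2 b)).
have := influence_super s l (dcone_open_prob e1 e2 K0 b); rewrite /supermart /bond_influence => h1 h2 h3; lra.
Qed.

Lemma reach_ge0 b I : 0 <= reach b I.
Proof.
by rewrite addr_ge0 //; apply: gks1 => //; [move=> s -> | exact: dcone_spin |move=> s -> | exact: dcone_spin].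
Qed.

Lemma influence_ge0 Q J : opens_known J -> dcone Q -> 0 <= influence Q J.
Proof.
by move=> jt cQ; rewrite subr_ge0; apply: gks2 => //; [exact: le_state_refl|exact: dcone_o].
Qed.

Lemma bond_influence_ge0 b J : opens_known J -> 0 <= bond_influence b J.
Proof.
by move=> jt; apply: addr_ge0; [|apply: addr_ge0]; apply: influence_ge0 => //;
  [exact: dcone_occupied|exact: dcone_occupied|exact: dcone_open_prob].
Qed.

(** The cost of decoupling one item is exactly [influence Qe J]. For independent bits the products
    in [budget] average factor by factor: those in [I] are martingales, those in [J] do not
    increase. *)
Lemma step_ub (I I1 I0 J J1 J0 : state) p q N L Qe (d : bool -> bool -> R) :
  splits I p I1 I0 -> splits J q J1 J0 -> le_state J0 J1 ->
  (forall Q, List.In Q L -> dcone Q) ->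
  q = expect J Qe -> (forall F, q * expect J1 F = expect J (fun s => Qe s * F s)) ->
  (forall v, 0 <= d v true - d v false <= f J1 - f J0) ->
  (forall v w, d v w <= budget N L (if v then I1 else I0) (if w then J1 else J0)) ->
  sync p q d <= budget N (Qe :: L) I J.
Proof.
move=> sI sJ l cL qE hh lip ub.
have [/andP[p0 p1] sI'] := sI; have [/andP[q0 q1] sJ'] := sJ.
apply: le_trans (@sync_indep R p q d (fun w => if w then f J1 else f J0) _ _ lip) _;
  rewrite ?p0 ?q0 //=.
have p1' : 0 <= 1 - p by rewrite subr_ge0.
have q1' : 0 <= 1 - q by rewrite subr_ge0.
apply: (@le_trans _ _ (p * (q * budget N L I1 J1 + (1 - q) * budget N L I1 J0) +
    (1 - p) * (q * budget N L I0 J1 + (1 - q) * budget N L I0 J0) + q * (1 - q) * (f J1 - f J0))).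
  rewrite lerD2r; apply: lerD; apply: ler_wpM2l => //; apply: lerD; apply: ler_wpM2l => //;
   first [exact: (ub true true)|exact: (ub true false)|exact: (ub false true)|exact: (ub false false)].
have eQ : q * (1 - q) * (f J1 - f J0) = influence Qe J.
  rewrite /influence -qE -hh (sJ' so); ring.
rewrite eQ /budget big_cons.
have T1 : p * (q * (f I1 * f J1) + (1 - q) * (f I1 * f J0)) +
    (1 - p) * (q * (f I0 * f J1) + (1 - q) * (f I0 * f J0)) = f I * f J.
  rewrite (sI' so) (sJ' so); ring.
have T2 : p * (q * (\sum_(b in N) reach b I1 * bond_influence b J1) + (1 - q) * (\sum_(b in N) reach b I1 * bond_influence b J0)) +
    (1 - p) * (q * (\sum_(b in N) reach b I0 * bond_influence b J1) + (1 - q) * (\sum_(b in N) reach b I0 * bond_influence b J0))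
    <= \sum_(b in N) reach b I * bond_influence b J.
  rewrite !mulr_sumr -!big_split /= !mulr_sumr -big_split /=; apply: ler_sum => b _.
  have -> : p * (q * (reach b I1 * bond_influence b J1) + (1 - q) * (reach b I1 * bond_influence b J0)) +
     (1 - p) * (q * (reach b I0 * bond_influence b J1) + (1 - q) * (reach b I0 * bond_influence b J0)) =
     (p * reach b I1 + (1 - p) * reach b I0) * (q * bond_influence b J1 + (1 - q) * bond_influence b J0) by ring.
  have -> : p * reach b I1 + (1 - p) * reach b I0 = reach b I.
    by rewrite /reach (sI' (fun s => spin s (e1 b))) (sI' (fun s => spin s (e2 b))); ring.
  apply: ler_wpM2l; [exact: reach_ge0|exact: bond_influence_super].
have T3 : q * (\sum_(Q <- L) influence Q J1) + (1 - q) * (\sum_(Q <- L) influence Q J0)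
    <= \sum_(Q <- L) influence Q J.
  elim: L cL {ub} => [|Q L IH] cL; first by rewrite !big_nil !mulr0 addr0.
  rewrite !big_cons.
  have := influence_super sJ l (cL Q (or_introl erefl)); rewrite /supermart.
  have := IH (fun Q' h => cL Q' (or_intror h)); lra.
rewrite -T1 -subr_ge0; rewrite -subr_ge0 in T2; rewrite -subr_ge0 in T3.
by apply: eq_ge0 (addr_ge0 T2 T3); ring.
Qed.

Definition I_fresh (N : {set B}) b I := (forall b', b' \in N -> bs I b' = Free) /\ hasplus I b.

Lemma budget_cons N Q L I J : budget N (Q :: L) I J = budget N L I J + influence Q J.
Proof. by rewrite /budget big_cons; ring. Qed.

Lemma hasplus_reveal_site (I : state) b x v : hasplus I b -> hasplus (reveal_site I x v) b.
Proof. by rewrite /hasplus => /orP[] /isplus_reveal_site H; rewrite H ?orbT. Qed.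

Lemma le_reveal_site_ft J x : opens_known J -> le_state (reveal_site J x false) (reveal_site J x true).
Proof. by move=> jt; apply: reveal_site_le => //; exact: le_state_refl. Qed.

(** The three items of an explored bond cost [bond_influence b J]. Its own term of [budget] pays for
    them, since [reach b I] is at least 1 when the bond is chosen, and the bond then leaves [N]. *)
Lemma coupled_ub n (N : {set B}) I J : (forall b, b \in N -> bs I b = Free) -> J_inv N J ->
  coupled n N I J <= budget N [::] I J.
Proof.
have base N' I' J' : J_inv N' J' -> (isplus (vs I' o))%:R * f J' <= budget N' [::] I' J'.
  move=> [jt _]; rewrite /budget big_nil addr0 -[X in X <= _]addr0 lerD //.
    case io : (isplus (vs I' o)); last by rewrite mul0r mulr_ge0 ?f_ge0.
    by rewrite (f_plus io).
  by apply: sumr_ge0 => b _; rewrite mulr_ge0 ?reach_ge0 ?bond_influence_ge0.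
elim: n N I J => [|n IH] N I J fr pj; first exact: base.
rewrite /=; case: pickP => [b /andP[bN hp]|_]; last exact: base.
have stB I' J' : I_fresh N b I' -> knownb I' b -> J_inv2 N b J' ->
    syncB b (coupled n (N :\ b)) I' J' <= budget (N :\ b) [:: open_prob b] I' J'.
  move=> [fr' hp'] kI pj2; have [[jt nf] kJ] := pj2.
  have sJ := reveal_bond_splits h K0 a0 kJ (nf _ bN).
  have l : le_state (reveal_bond J' b false) (reveal_bond J' b true).
    by apply: reveal_bond_le => //; [exact: le_state_refl|case: jt].
  apply: (step_ub (L := [::]) (explore_bond_splits h K0 a0 kI hp' (fr' _ bN)) sJ l) => //.
  - by move=> F; apply: reveal_bond_mul => //; exact: nf.
  - by move=> v; apply: (@coupled_lip n (N :\ b)) => //; exact: J_inv_reveal_bond.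
  - move=> v w; have -> : (if v then explore_bond I' b true else explore_bond I' b false) = explore_bond I' b v by case: v.
    have -> : (if w then reveal_bond J' b true else reveal_bond J' b false) = reveal_bond J' b w by case: w.
    apply: IH; last exact: J_inv_reveal_bond.
    by move=> b'; rewrite !inE /= => /andP[/negbTE -> b'N]; exact: fr'.
have st2 I' J' : I_fresh N b I' -> known (vs I' (e1 b)) -> J_inv1 N (e1 b) J' ->
    syncV (e2 b) (syncB b (coupled n (N :\ b))) I' J' <= budget (N :\ b) [:: occupied (e2 b); open_prob b] I' J'.
  move=> [fr' hp'] kI pj1; have [[jt nf] kJ] := pj1.
  apply: (step_ub (reveal_site_splits e1 e2 K h a0 I' (e2 b)) (reveal_site_splits e1 e2 K h a0 J' (e2 b)) (le_reveal_site_ft _ jt)) => //.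
  - by move=> Q [<-|//]; exact: dcone_open_prob.
  - by move=> F; exact: reveal_site_mul.
  - move=> v; apply: (Lip_stageB bN (@coupled_lip n _)); try exact: J_inv2_reveal.
    exact: le_reveal_site_ft.
  - move=> v w; have -> : (if v then reveal_site I' (e2 b) true else reveal_site I' (e2 b) false) = reveal_site I' (e2 b) v by case: v.
    have -> : (if w then reveal_site J' (e2 b) true else reveal_site J' (e2 b) false) = reveal_site J' (e2 b) w by case: w.
    apply: stB; [by split => //; exact: hasplus_reveal_site|by rewrite /knownb known_revealed known_reveal_site|].
    exact: J_inv2_reveal.
have st1 : syncV (e1 b) (syncV (e2 b) (syncB b (coupled n (N :\ b)))) I J
     <= budget (N :\ b) [:: occupied (e1 b); occupied (e2 b); open_prob b] I J.
  have [jt nf] := pj.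
  apply: (step_ub (reveal_site_splits e1 e2 K h a0 I (e1 b)) (reveal_site_splits e1 e2 K h a0 J (e1 b)) (le_reveal_site_ft _ jt)) => //.
  - by move=> Q [<-|[<-|//]]; [exact: dcone_occupied|exact: dcone_open_prob].
  - by move=> F; exact: reveal_site_mul.
  - move=> v; apply: (Lip_stageV bN (@coupled_lip n _)); try exact: J_inv1_reveal.
    exact: le_reveal_site_ft.
  - move=> v w; have -> : (if v then reveal_site I (e1 b) true else reveal_site I (e1 b) false) = reveal_site I (e1 b) v by case: v.
    have -> : (if w then reveal_site J (e1 b) true else reveal_site J (e1 b) false) = reveal_site J (e1 b) w by case: w.
    apply: st2; [by split => //; exact: hasplus_reveal_site|exact: known_revealed|exact: J_inv1_reveal].
apply: le_trans st1 _; rewrite !budget_cons /budget !big_nil [X in _ <= _ + X + _](big_setD1 b bN) /=.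
have W0 := bond_influence_ge0 b (proj1 pj).
have U1 : 1 <= reach b I.
  have g x : 0 <= expect I (fun s => spin s x).
    by apply: gks1 => //; [move=> s ->|exact: dcone_spin].
  by move: hp; rewrite /reach /hasplus => /orP[] /f_plus ->; rewrite ?lerDl ?lerDr.
have : bond_influence b J <= reach b I * bond_influence b J by rewrite ler_peMl.
by rewrite {1}/bond_influence; lra.
Qed.

(** Synchronized, the coupled value is [f J]; decoupled, it would be at most [f I * f J] up to the
    costs. *)
Theorem osss (I J : state) : I_inv N0 I -> J_inv N0 J -> le_state J I ->
  f J * (1 - f I) <= \sum_(b in N0) reach b I * bond_influence b J.
Proof.
move=> qi pj l; have := coupled_ub #|N0| (let: And4 _ fr _ _ := qi in fr) pj.
rewrite (coupled_dom (leqnn _) qi pj l) /budget big_nil; lra.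
Qed.

End Exploration.

(** * Covariances of single items bounded by that of the bond energy *)

Section EdgeBound.
Context {R : realType} {V B : finType} (e1 e2 : B -> V) (K : B -> R) (h : V -> R) (a : R).
Context (K0 : forall b, 0 <= K b) (h0 : forall x, 0 <= h x) (a0 : 0 < a).

Notation cfg := (@cfg V).
Notation spin := (@spin R V).
Notation state := (@state V B).
Notation bondspin := (@bondspin R V B e1 e2).
Notation bond_weight := (bond_weight e1 e2 K).
Notation weight := (weight e1 e2 K h a).
Notation expect := (expect e1 e2 K h a).
Notation le_state := (@le_state V B e1 e2).
Notation open_prob := (@open_prob R V B e1 e2 K).
Notation occupied := (@occupied R V).
Notation opens_known := (@opens_known V B e1 e2).

Definition unrevealed : state := State (fun=> Unknown) (fun=> Free).

Lemma unrevealed_known : opens_known unrevealed. Proof. by split. Qed.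

Definition setk (s : cfg) x (k : 'I_3) : cfg := [ffun y => if y == x then k else s y].

Let i0 : 'I_3 := inord 0.
Let i1 : 'I_3 := inord 1.
Let i2 : 'I_3 := inord 2.
Let sv0 : sv i0 = -1 :> R. Proof. by rewrite /sv inordK // sub0r. Qed.
Let sv1 : sv i1 = 0 :> R. Proof. by rewrite /sv inordK // subrr. Qed.
Let sv2 : sv i2 = 1 :> R. Proof. by rewrite /sv inordK // mulr2n addrK. Qed.

Let ord3P (k : 'I_3) : [\/ k = i0, k = i1 | k = i2].
Proof.
case: k => [[|[|[|//]]] ik]; [constructor 1|constructor 2|constructor 3];
  by apply/val_inj; rewrite /= inordK.
Qed.

Lemma sum_setk (F : cfg -> R) x :
  \sum_(s : cfg) F s = \sum_(s : cfg | s x == i1) (F (setk s x i0) + F s + F (setk s x i2)).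
Proof.
have re k : \sum_(s : cfg | s x == k) F s = \sum_(s : cfg | s x == i1) F (setk s x k).
  rewrite (reindex_onto (fun s => setk s x k) (fun s => setk s x i1)) /=.
    apply: eq_bigl => s; rewrite ffunE eqxx eqxx /=.
    apply/eqP/eqP => [/ffunP/(_ x)|e]; first by rewrite !ffunE eqxx.
    by apply/ffunP => y; rewrite !ffunE; case: eqP => // ->.
  move=> s /eqP e; apply/ffunP => y; rewrite !ffunE.
  by case: eqP => // ->.
rewrite !big_split /= -re -(re i2).
rewrite (bigID (fun s : cfg => s x == i1)) /= [RHS]addrAC [RHS]addrC; congr (_ + _).
rewrite (bigID (fun s : cfg => s x == i0)) /=; congr (_ + _); apply: eq_bigl => s.
  by case: eqP => [->|]; rewrite ?andbT ?andbF // -val_eqE /= !inordK.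
case: (ord3P (s x)) => ->; by rewrite -!val_eqE /= !inordK.
Qed.

Lemma spin_setk s x k y : spin (setk s x k) y = if y == x then sv k else spin s y.
Proof. by rewrite /spin ffunE; case: eqP. Qed.

(* AM-GM on the two ways of occupying the site [x]. *)
Lemma occupied_lb (st : state) x : (forall y, vs st y = Unknown) -> (forall b, bs st b <> Open) ->
  2 * a / (1 + 2 * a) <= expect st (occupied x).
Proof.
move=> uv nop.
have amgm (s : cfg) : s x == i1 -> 2 * a * weight st s <= weight st (setk s x i0) + weight st (setk s x i2).
  move=> /eqP sx.
  have spx : spin s x = 0 by rewrite /spin sx.
  have P : a ^+ 2 * weight st s ^+ 2 <= weight st (setk s x i0) * weight st (setk s x i2).
    have wD (t : cfg) : weight st t = apriori a (spin t x) * expR (h x * spin t x) *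
        ((\prod_(y | y != x) apriori a (spin t y)) * (\prod_(y | y != x) expR (h y * spin t y))) *
        \prod_b bond_weight st b t.
      rewrite /weight (bigD1 x) //= uv /= [\prod_y expR _](bigD1 x) //=.
      have -> : \prod_(y | y != x) (apriori a (spin t y) * site_ind (vs st y) (spin t y)) =
                \prod_(y | y != x) apriori a (spin t y).
        by apply: eq_bigr => y _; rewrite uv mulr1.
      ring.
    have E1 k : \prod_(y | y != x) apriori a (spin (setk s x k) y) =
      \prod_(y | y != x) apriori a (spin s y).
      by apply: eq_bigr => y /negbTE ny; rewrite spin_setk ny.
    have E2 k : \prod_(y | y != x) expR (h y * spin (setk s x k) y) =
      \prod_(y | y != x) expR (h y * spin s y).
      by apply: eq_bigr => y /negbTE ny; rewrite spin_setk ny.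
    rewrite (wD s) (wD (setk s x i0)) (wD (setk s x i2)) (E1 i0) (E1 i2) (E2 i0) (E2 i2).
    rewrite (spin_setk s x i0 x) (spin_setk s x i2 x) eqxx sv0 sv2 spx /apriori sqrrN expr1n expr0n /=.
    set A := \prod_(y | _) (1 + _); set H := \prod_(y | _) expR _.
    set G := \prod_b bond_weight st b s; set G0 := \prod_b _; set G2 := \prod_b _.
    (* The bond energy is affine in the spin at [x], except on a loop at [x], where occupying the
       site raises it. *)
    have GG : G ^+ 2 <= G0 * G2.
      rewrite /G /G0 /G2 -prodrXl -big_split /=; apply: ler_prod => b _.
      rewrite sqr_ge0 /=; rewrite /bond_weight; case eb : (bs st b).
      - rewrite -expRM_natl -expRD ler_expR -mulrDr mulrA [2%:R * _]mulrC -mulrA.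
        apply: ler_wpM2l => //; rewrite /bondspin !spin_setk sv0 sv2.
        case: (e1 b =P x) => [->|_]; case: (e2 b =P x) => [->|_]; rewrite ?spx; lra.
      - by rewrite expr1n mulr1.
      - by have := nop b.
    have hh : expR (h x * -1) * expR (h x * 1) = 1.
      by rewrite -expRD mulrN1 mulr1 addNr expR0.
    rewrite !mulr0 !mulr1 expR0 !addr0 !mul1r.
    have -> : a ^+ 2 * (A * H * G) ^+ 2 = (a ^+ 2 * A ^+ 2 * H ^+ 2) * G ^+ 2 by ring.
    have -> : (1 + (a - 1)) * expR (h x * -1) * (A * H) * G0 *
        ((1 + (a - 1)) * expR (h x) * (A * H) * G2) =
       (a ^+ 2 * A ^+ 2 * H ^+ 2) * (G0 * G2) * (expR (h x * -1) * expR (h x * 1)).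
      by rewrite mulr1; ring.
    rewrite hh mulr1; apply: ler_wpM2l => //.
    by apply: mulr_ge0; [apply: mulr_ge0|]; exact: sqr_ge0.
  have w1 := weight_ge0 e1 e2 K h a0 st s; have w0 := weight_ge0 e1 e2 K h a0 st (setk s x i0).
  have w2 := weight_ge0 e1 e2 K h a0 st (setk s x i2).
  move: P w1 w0 w2; move: (weight st (setk s x i0)) (weight st (setk s x i2)) (weight st s) => u v w P w0 u0 v0.
  have n1 : 0 <= 2 * a * w by apply: mulr_ge0 => //; apply: mulr_ge0 => //; exact: ltW.
  have n2 : 0 <= u + v by exact: addr_ge0.
  rewrite -ler_sqr ?nnegrE //.
  have -> : (2 * a * w) ^+ 2 = 4 * (a ^+ 2 * w ^+ 2) by ring.
  have -> : (u + v) ^+ 2 = (u - v) ^+ 2 + 4 * (u * v) by ring.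
  have := sqr_ge0 (u - v); lra.
have D0 : 0 < 1 + 2 * a by have := a0; lra.
rewrite ler_pdivrMr // mulrDr mulr1.
have Z0 := partition_gt0 e1 e2 K h a0 st.
have ev F : expect st F = (\sum_(s : cfg) weight st s * F s) / partition e1 e2 K h a st by [].
suff H : 2 * a * (\sum_(s : cfg) weight st s * (1 - occupied x s)) <= \sum_(s : cfg) weight st s * occupied x s.
  rewrite !(sum_weightE e1 e2 K h a0) expectB expect_cst // in H.
  have : partition e1 e2 K h a st * (2 * a * (1 - expect st (occupied x))) <= partition e1 e2 K h a st * expect st (occupied x).
    by move: H; congr (_ <= _); ring.
  rewrite ler_pM2l //; lra.
rewrite (sum_setk _ x) [X in _ <= X](sum_setk _ x) mulr_sumr; apply: ler_sum => s sx.
have spx : spin s x = 0 by rewrite /spin (eqP sx).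
rewrite /occupied !spin_setk eqxx sv0 sv2 spx sqrrN expr1n expr0n /=.
by have := amgm s sx; lra.
Qed.

(** Switch the interaction of [b] off: its factor times [bondspin] is [sinh K * bondspin ^+ 2 + cosh
    K * bondspin]. Without the interaction, the last mean is nonnegative and the mean of the square
    is at least the product of two occupation probabilities; the normalization costs at most
    [expR (K b)]. *)
Lemma bond_lb b :
  expR (- K b) * ((expR (K b) - expR (- K b)) / 2) * (2 * a / (1 + 2 * a)) ^+ 2 <= expect unrevealed (bondspin b).
Proof.
pose stC : state := State (fun=> Unknown) (fun b' => if b' == b then Closed else Free).
have wE s : weight unrevealed s = weight stC s * expR (K b * bondspin b s).
  rewrite /weight [X in _ * (_ * X)](bigD1 b) //= [X in _ = _ * (_ * X) * _](bigD1 b) //=.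
  rewrite /bond_weight /= eqxx mul1r.
  rewrite (eq_bigr (fun b' => match (if b' == b then Closed else Free) with
     Free => expR (K b' * bondspin b' s) | Closed => 1 | Open => 1 + bondspin b' s end)); first by ring.
  by move=> b' /negbTE ->.
pose Q s := expR (K b * bondspin b s).
have EQ F : expect unrevealed F * expect stC Q = expect stC (fun s => Q s * F s).
  have zE : partition e1 e2 K h a unrevealed = partition e1 e2 K h a stC * expect stC Q.
    by rewrite -(sum_weightE e1 e2 K h a0); apply: eq_bigr => s _; rewrite wE.
  have Z0 := partition_neq0 e1 e2 K h a0 unrevealed; have ZC := partition_neq0 e1 e2 K h a0 stC.
  apply: (mulfI ZC); rewrite -(sum_weightE e1 e2 K h a0) mulrCA -zE mulrC -(sum_weightE e1 e2 K h a0).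
  by apply: eq_bigr => s _; rewrite wE mulrA.
have K0b := K0 b.
set X := expR (K b); set Y := expR (- K b).
have Y0 : 0 < Y by exact: expR_gt0.
have X0 : 0 < X by exact: expR_gt0.
have XY : X * Y = 1 by rewrite -expRD subrr expR0.
have YX : Y <= X by rewrite ler_expR; have := K0b; lra.
have leC : le_state stC stC.
  by split=> [x|b'] //; rewrite /le_b /=; case: eqP.
have QE s : Q s * bondspin b s = (X - Y) / 2 * bondspin b s ^+ 2 + (X + Y) / 2 * bondspin b s.
  by rewrite /Q; case: (trivalued_bondspin (R := R) e1 e2 b s) => ->;
    rewrite ?mulrN1 ?mulr0 ?mulr1 ?expR0 -/X -/Y; field.
have Qpos : 0 < expect stC Q.
  rewrite lt_def; apply/andP; split.
    apply/eqP => e; have := EQ (fun=> 1); rewrite e mulr0.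
    have : Y <= expect stC (fun s => Q s * 1).
      rewrite -(expect_cst e1 e2 K h a0 stC Y); apply: expect_le => // s _.
      by rewrite mulr1 /Q /Y ler_expR; case: (trivalued_bondspin (R := R) e1 e2 b s) => ->; lra.
    by move=> + e2'; rewrite -e2'; move: Y0; lra.
  by apply: expect_ge0 => // s _; exact: expR_ge0.
have QX : expect stC Q <= X.
  rewrite -(expect_cst e1 e2 K h a0 stC X); apply: expect_le => // s _.
  by rewrite /Q /X ler_expR; case: (trivalued_bondspin (R := R) e1 e2 b s) => ->; lra.
have lbd : (2 * a / (1 + 2 * a)) ^+ 2 <= expect stC (fun s => bondspin b s ^+ 2).
  have nop b' : bs stC b' <> Open by rewrite /=; case: eqP.
  have o1 := @occupied_lb stC (e1 b) (fun _ => erefl) nop.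
  have o2 := @occupied_lb stC (e2 b) (fun _ => erefl) nop.
  have c0 : 0 <= 2 * a / (1 + 2 * a).
    by rewrite divr_ge0 // ?addr_ge0 // ?mulr_ge0 // ltW.
  rewrite expr2; apply: le_trans (ler_pM c0 c0 o1 o2) _.
  have := gks2 K0 h0 a0 leC (dcone_occupied (R := R) (e1 b)) (dcone_occupied (R := R) (e2 b)).
  by rewrite (@eq_expect R V B e1 e2 K h a stC (fun s => _ * _) (fun s => bondspin b s ^+ 2)) // => s;
    rewrite /bondspin exprMn.
have bd0 : 0 <= expect stC (bondspin b).
  apply: gks1 => //; last exact: dcone_bondspin.
  by move=> s sz; rewrite /bondspin sz mul0r.
have T : (X - Y) / 2 * (2 * a / (1 + 2 * a)) ^+ 2 <= expect unrevealed (bondspin b) * expect stC Q.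
  rewrite EQ (eq_expect _ _ _ _ _ _ QE) expectD !expectZ.
  have := ler_wpM2l (_ : 0 <= (X - Y) / 2) lbd.
  rewrite divr_ge0 ?subr_ge0 // => /(_ isT) H.
  apply: le_trans H _; rewrite lerDl; apply: mulr_ge0 => //.
  by apply: divr_ge0 => //; apply: addr_ge0; exact: ltW.
have s0 : 0 <= expect unrevealed (bondspin b).
  apply: gks1 => //; last exact: dcone_bondspin.
  by move=> s sz; rewrite /bondspin sz mul0r.
have : expect unrevealed (bondspin b) * expect stC Q <= expect unrevealed (bondspin b) * X by exact: ler_wpM2l.
move/(le_trans T)/(ler_wpM2l (ltW Y0)).
have -> : Y * (expect unrevealed (bondspin b) * X) = expect unrevealed (bondspin b) by rewrite mulrCA [Y * X]mulrC XY mulr1.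
by congr (_ <= _); ring.
Qed.

Context (o : V).
Let so (s : cfg) : R := spin s o.
Notation influence := (influence e1 e2 K h a o).
Notation bond_influence := (bond_influence e1 e2 K h a o).

Definition agree b (s : cfg) : R := (bondspin b s ^+ 2 + bondspin b s) / 2.

(** Griffiths' inequality in the model conditioned on [Q]. Because [O] lives where [Q] does, it says
    that the mean of [so] given [O] is at least its mean given [Q]. *)
Lemma cond_gks (st st' : state) (O Q : cfg -> R) : le_state st' st' ->
  (forall F, expect st Q * expect st' F = expect st (fun s => Q s * F s)) ->
  (forall s, Q s * O s = O s) -> dcone O ->
  expect st (fun s => Q s * so s) * expect st O <= expect st Q * expect st (fun s => O s * so s).
Proof.
move=> l c QO cO; have g := gks2 K0 h0 a0 l cO (dcone_spin (R := R) o).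
have := c O; rewrite (eq_expect _ _ _ _ _ _ QO) => <-.
rewrite -(c so).
have <- : expect st (fun s => Q s * (O s * so s)) = expect st (fun s => O s * so s).
  by apply: eq_expect => // s; rewrite mulrA QO.
rewrite -(c (fun s => O s * so s)).
have := ler_wpM2l (sqr_ge0 (expect st Q)) g; congr (_ <= _); rewrite /so; ring.
Qed.

(** Let [A] be the event that the ends agree, [P] its probability and [N] the event that both are
    occupied. By [cond_gks], [P * influence Q <= expect Q * influence A] for [Q] an occupied end or
    [N]. As [bondspin = 2 * A - N], the case of [N] bounds [influence A] by
    [influence (bondspin b)]. The 3 counts two sites and one bond. *)
Lemma bond_influence_le b : 0 < expect unrevealed (bondspin b) -> expect unrevealed (bondspin b) * bond_influence b unrevealed <= 3 * influence (bondspin b) unrevealed.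
Proof.
move=> s0.
have cO := dcone_agree e1 e2 b : dcone (agree b).
have O3 s : [\/ bondspin b s = -1, bondspin b s = 0 | bondspin b s = 1] := trivalued_bondspin e1 e2 b s.
have lx x w : opens_known (reveal_site unrevealed x w) by apply: reveal_site_known; exact: unrevealed_known.
have tri1 (u : R) : [\/ u = -1, u = 0 | u = 1] -> u ^+ 2 * u = u.
  by case=> ->; rewrite ?mulr0 ?sqrrN ?expr1n ?mul1r ?mulrN1.
have OX x : x = e1 b \/ x = e2 b -> forall s, occupied x s * agree b s = agree b s.
  move=> hx s; have t1 := tri1 _ (spin_cases (R := R) s (e1 b)).
  have t2 := tri1 _ (spin_cases (R := R) s (e2 b)).
  rewrite /occupied /agree /bondspin; case: hx => ->.
    have -> : spin s (e1 b) ^+ 2 * (((spin s (e1 b) * spin s (e2 b)) ^+ 2 + spin s (e1 b) * spin s (e2 b)) / 2)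
      = ((spin s (e1 b) ^+ 2 * spin s (e1 b)) * spin s (e1 b) * spin s (e2 b) ^+ 2 +
         (spin s (e1 b) ^+ 2 * spin s (e1 b)) * spin s (e2 b)) / 2 by field.
    by rewrite t1; field.
  have -> : spin s (e2 b) ^+ 2 * (((spin s (e1 b) * spin s (e2 b)) ^+ 2 + spin s (e1 b) * spin s (e2 b)) / 2)
      = ((spin s (e2 b) ^+ 2 * spin s (e2 b)) * spin s (e2 b) * spin s (e1 b) ^+ 2 +
         (spin s (e2 b) ^+ 2 * spin s (e2 b)) * spin s (e1 b)) / 2 by field.
  by rewrite t2; field.
have gx x : x = e1 b \/ x = e2 b ->
  expect unrevealed (fun s => occupied x s * so s) * expect unrevealed (agree b) <= expect unrevealed (occupied x) * expect unrevealed (fun s => agree b s * so s).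
  move=> hx; apply: (cond_gks (st' := reveal_site unrevealed x true)) => //; first exact: le_state_refl.
  - by move=> F; exact: reveal_site_mul.
  - exact: OX.
pose N s := bondspin b s ^+ 2.
have gN : expect unrevealed (fun s => N s * so s) * expect unrevealed (agree b) <= expect unrevealed N * expect unrevealed (fun s => agree b s * so s).
  apply: (cond_gks (st' := reveal_site (reveal_site unrevealed (e1 b) true) (e2 b) true)) => //.
  - by apply: le_state_refl; apply: reveal_site_known.
  - move=> F.
    have e : expect unrevealed N = expect unrevealed (fun s => occupied (e1 b) s * occupied (e2 b) s).
      by apply: eq_expect => // s; rewrite /N /occupied /bondspin exprMn.
    rewrite e -(reveal_site_mul e1 e2 K h a0) -mulrA reveal_site_mul // reveal_site_mul //.
    by apply: eq_expect => // s; rewrite /N /occupied /bondspin exprMn mulrA.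
  - by move=> s; rewrite /N /agree; case: (O3 s) => ->; rewrite ?mul1r ?sqrrN ?expr1n ?expr0n /=; field.
have sE F : expect unrevealed (fun s => bondspin b s * F s) =
    2 * expect unrevealed (fun s => agree b s * F s) - expect unrevealed (fun s => N s * F s).
  by rewrite -expectZ -expectB; apply: eq_expect => // s; rewrite /agree /N; field.
have sE1 : expect unrevealed (bondspin b) = 2 * expect unrevealed (agree b) - expect unrevealed N.
  by rewrite -expectZ -expectB; apply: eq_expect => // s; rewrite /agree /N; field.
have N0 : 0 <= expect unrevealed N by apply: expect_ge0 => // s _; exact: sqr_ge0.
have P0 : 0 < expect unrevealed (agree b) by lra.
have P1 : expect unrevealed (agree b) <= 1.
  rewrite -(expect_cst e1 e2 K h a0 unrevealed 1); apply: expect_le => // s _.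
  by case/andP: (agree01 (R := R) e1 e2 b s).
have x01 x : expect unrevealed (occupied x) <= 1.
  by have /andP[] := p_occupied01 e1 e2 K h a0 unrevealed x.
have al0 : 0 <= influence (agree b) unrevealed.
  by apply: influence_ge0 => //; exact: unrevealed_known.
pose P := expect unrevealed (agree b).
have iX x : x = e1 b \/ x = e2 b -> P * influence (occupied x) unrevealed <= influence (agree b) unrevealed.
  move=> hx; have H : P * influence (occupied x) unrevealed <= expect unrevealed (occupied x) * influence (agree b) unrevealed.
    rewrite -subr_ge0; have := gx x hx; rewrite -subr_ge0; congr (0 <= _).
    by rewrite /influence /P; ring.
  apply: le_trans H _; rewrite -[X in _ <= X]mul1r; exact: ler_wpM2r.
have iN : P * influence N unrevealed <= expect unrevealed N * influence (agree b) unrevealed.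
  rewrite -subr_ge0; have := gN; rewrite -subr_ge0; congr (0 <= _).
  by rewrite /influence /P; ring.
have iS : influence (bondspin b) unrevealed = 2 * influence (agree b) unrevealed - influence N unrevealed.
  by rewrite /influence sE sE1; ring.
have iB : influence (open_prob b) unrevealed <= influence (agree b) unrevealed.
  have -> : influence (open_prob b) unrevealed = (1 - expR (- (2 * K b))) * influence (agree b) unrevealed.
    have q1 : expect unrevealed (fun s => open_prob b s * so s) =
        (1 - expR (- (2 * K b))) * expect unrevealed (fun s => agree b s * so s).
      by rewrite -expectZ; apply: eq_expect => // s; rewrite /open_prob /agree; ring.
    have q2 : expect unrevealed (open_prob b) = (1 - expR (- (2 * K b))) * expect unrevealed (agree b).
      by rewrite -expectZ.
    by rewrite /influence q1 q2; ring.
  by case/andP: (open_factor01 K0 b) => c0 c1; apply: ler_piMl.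
have PS : expect unrevealed (bondspin b) * influence (agree b) unrevealed <= P * influence (bondspin b) unrevealed.
  rewrite iS sE1 -/P; rewrite -subr_ge0; move: iN; rewrite -subr_ge0; congr (0 <= _); ring.
have PW : P * bond_influence b unrevealed <= 3 * influence (agree b) unrevealed.
  have := iX (e1 b) (or_introl erefl); have := iX (e2 b) (or_intror erefl).
  have : P * influence (open_prob b) unrevealed <= influence (agree b) unrevealed.
    apply: le_trans (ler_wpM2l (ltW P0) iB) _.
    by rewrite -[X in _ <= X]mul1r; exact: ler_wpM2r.
  rewrite /bond_influence; lra.
rewrite -(ler_pM2l P0) -/P.
have := ler_wpM2l (ltW s0) PW; have := PS; lra.
Qed.

End EdgeBound.

(** * The Blume-Capel model on boxes *)

Section Boxes.
Context {R : realType} {d : nat}.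
Notation site := (site d).
Notation box := (box d).
Notation config := (config d).
Notation dir := ('I_d * bool)%type.

Definition mkv n (y : site) : box n := [ffun i => inord (absz (y i + n%:Z))].

Lemma inboxP n (y : site) : reflect (forall i, - n%:Z <= y i /\ y i <= n%:Z) (inbox n y).
Proof.
apply: (iffP forallP) => H i; first by have /andP := H i.
by apply/andP; exact: H.
Qed.

Lemma mkvK n (y : site) : inbox n y -> pt (mkv n y) = y.
Proof.
move=> /inboxP yn; apply/boolp.funext => i; rewrite /pt ffunE inordK.
  by have [y1 y2] := yn i; lia.
by have [y1 y2] := yn i; lia.
Qed.

Lemma pt_inbox n (v : box n) : inbox n (pt v).
Proof. by apply/inboxP => i; rewrite /pt; have := ltn_ord (v i); lia. Qed.

Lemma inbox_origin n : inbox n (@origin d).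
Proof. by apply/inboxP => i; rewrite /origin; lia. Qed.

Lemma norm_infP k (y : site) : inbox k y = (norm_inf y <= k)%N.
Proof.
apply/inboxP/bigmax_leqP => [H i _|H i]; first by have := H i; lia.
by have := H i isT; lia.
Qed.

Lemma norm_inf_nb (y : site) j : (norm_inf (nb y j) <= (norm_inf y).+1)%N.
Proof.
apply/bigmax_leqP => i _.
have yi : (`|y i| <= norm_inf y)%N by rewrite /norm_inf; exact: (leq_bigmax (F := fun i => `|y i|%N)).
by rewrite /nb; case: eqP => _; [case: (j.2)|]; lia.
Qed.

Lemma pt_inj n : injective (@pt d n).
Proof.
move=> v w e; apply/ffunP => i; apply/val_inj => /=.
by have := congr1 (fun f => f i) e; rewrite /pt; lia.
Qed.

Lemma ptK n (v : box n) : mkv n (pt v) = v.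
Proof. by apply: pt_inj; rewrite mkvK // pt_inbox. Qed.

Lemma plus_extE n (s : config n) y : inbox n y -> plus_ext s y = sv (s (mkv n y)) :> R.
Proof.
move=> yn; rewrite /plus_ext; case: pickP => [v /forallP e|/(_ (mkv n y)) /negP[]].
  have -> : v = mkv n y => //; apply: pt_inj; rewrite mkvK //.
  by apply/boolp.funext => i; exact/eqP.
by apply/forallP => i; rewrite mkvK.
Qed.

Lemma plus_ext_out n (s : config n) y : ~~ inbox n y -> plus_ext s y = 1 :> R.
Proof.
move=> yn; rewrite /plus_ext; case: pickP => // v /forallP e.
case/negP: yn; have -> : y = pt v by apply/boolp.funext => i; apply/esym/eqP.
exact: pt_inbox.
Qed.

Lemma plus_ext_pt n (s : config n) (v : box n) : plus_ext s (pt v) = sv (s v) :> R.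
Proof. by rewrite plus_extE ?pt_inbox // ptK. Qed.

Definition opp (j : dir) : dir := (j.1, ~~ j.2).
Lemma oppK j : opp (opp j) = j. Proof. by case: j => i b; rewrite /opp /= negbK. Qed.
Lemma nb_opp (y : site) j : nb (nb y j) (opp j) = y.
Proof.
apply/boolp.funext => i; rewrite /nb /=; case: eqP => // _.
by case: (j.2) => /=; rewrite ?addrK ?subrK.
Qed.

Definition shift (c y : site) : site := fun i => y i - c i.
Definition unshift (c y : site) : site := fun i => y i + c i.
Lemma shiftK c y : unshift c (shift c y) = y.
Proof. by apply/boolp.funext => i; rewrite /unshift /shift subrK. Qed.
Lemma unshiftK c y : shift c (unshift c y) = y.
Proof. by apply/boolp.funext => i; rewrite /unshift /shift addrK. Qed.
Lemma shift_nb c y j : shift c (nb y j) = nb (shift c y) j.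
Proof.
apply/boolp.funext => i; rewrite /shift /nb; case: eqP => // _.
by case: (j.2); rewrite addrAC.
Qed.

(** The coefficient of [beta] in the exponent: an edge inside the box is met from both ends with
    weight one half, an edge leaving the box once. *)
Definition pairsum n (s : config n) : R := \sum_(p : box n * dir)
  sv (s p.1) * (if inbox n (nb (pt p.1) p.2) then plus_ext s (nb (pt p.1) p.2) / 2 else 1).

Lemma BC_exponentE n beta Delta (s : config n) : BC_exponent beta Delta s =
  beta * pairsum s + Delta * \sum_(v : box n) sv (s v) ^+ 2.
Proof.
rewrite /BC_exponent addrAC -mulrDr; congr (_ * _ + _).
rewrite /pairsum -(pair_bigA _ (fun v j => sv (s v) *
   (if inbox n (nb (pt v) j) then plus_ext s (nb (pt v) j) / 2 else 1))) /=.
rewrite mulr_suml -big_split; apply: eq_bigr => v _ /=.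
rewrite mulr_suml -big_split; apply: eq_bigr => j _ /=.
case: ifP => e; first by rewrite addr0 mulrA.
by rewrite mul0r add0r plus_ext_out ?e.
Qed.

(** * Translated boxes inside a larger box *)

Section Transfer.
Context (n r : nat) (c : site).
Context (cn : forall i, - (n%:Z) + r%:Z <= c i /\ c i <= n%:Z - r%:Z).

Definition inD (y : site) := inbox r (shift c y).

Lemma inD_inbox y : inD y -> inbox n y.
Proof.
move=> /inboxP H; apply/inboxP => i; have := H i; have := cn i; rewrite /shift; lia.
Qed.

Definition plus_extend (t : config r) : config n :=
  [ffun v => if inD (pt v) then t (mkv r (shift c (pt v))) else inord 2].
Definition restrict (s : config n) : config r := [ffun w => s (mkv n (unshift c (pt w)))].

Lemma unshift_inD (w : box r) : inD (unshift c (pt w)).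
Proof. by rewrite /inD unshiftK pt_inbox. Qed.

Lemma plus_extendK t : restrict (plus_extend t) = t.
Proof.
apply/ffunP => w; rewrite !ffunE mkvK ?inD_inbox ?unshift_inD //.
by rewrite unshiftK ptK.
Qed.

Lemma restrictK (s : config n) : (forall v, ~~ inD (pt v) -> s v = inord 2) -> plus_extend (restrict s) = s.
Proof.
move=> H; apply/ffunP => v; rewrite !ffunE; case: ifP => [Dv|/negbT Dv]; last by rewrite H.
by rewrite mkvK // shiftK ptK.
Qed.

Lemma sv_inord2 : sv (inord 2) = 1 :> R.
Proof. by rewrite /sv inordK // mulr2n addrK. Qed.

Lemma plus_ext_extend t y : plus_ext (plus_extend t) y = plus_ext t (shift c y) :> R.
Proof.
have [yn|yn] := boolP (inbox n y); last first.
  rewrite plus_ext_out // plus_ext_out //; apply: contra yn; exact: inD_inbox.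
rewrite plus_extE // ffunE mkvK //; case: ifP => [Dy|/negbT Dy]; first by rewrite plus_extE.
by rewrite plus_ext_out // sv_inord2.
Qed.

Lemma sv_extend t v : sv (plus_extend t v) = plus_ext t (shift c (pt v)) :> R.
Proof. by rewrite -plus_ext_extend plus_ext_pt. Qed.

Lemma reindex_box (F : box r -> R) :
  \sum_(v : box n | inD (pt v)) F (mkv r (shift c (pt v))) = \sum_(w : box r) F w.
Proof.
rewrite [RHS](reindex_onto (fun v : box n => mkv r (shift c (pt v)))
   (fun w => mkv n (unshift c (pt w)))) /=; last first.
  by move=> w _; rewrite mkvK ?inD_inbox ?unshift_inD // unshiftK ptK.
apply: eq_bigl => v; apply/idP/eqP => [Dv|e].
  by rewrite mkvK // shiftK ptK.
by rewrite -e mkvK ?inD_inbox ?unshift_inD //; exact: unshift_inD.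
Qed.

(** Edges with both ends outside the translated box contribute the constant. An edge across its
    boundary appears with weight one half from each side, whereas the small box counts it once with
    full weight. *)
Lemma pairsum_extend : exists C : R, forall t, pairsum (plus_extend t) = pairsum t + C.
Proof.
pose nbp (p : box n * dir) := nb (pt p.1) p.2.
exists (\sum_(p : box n * dir | ~~ inD (pt p.1) && ~~ inD (nbp p))
         (if inbox n (nbp p) then 2^-1 else 1)) => t.
pose X y : R := plus_ext t (shift c y).
have X1 y : ~~ inD y -> X y = 1 by move=> ?; rewrite /X plus_ext_out.
have svX v : sv (plus_extend t v) = X (pt v) by exact: sv_extend.
pose G p := X (pt p.1) * (if inbox n (nbp p) then X (nbp p) / 2 else 1).
have -> : pairsum (plus_extend t) = \sum_p G p.
  by apply: eq_bigr => p _; rewrite svX plus_ext_extend.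
have -> : pairsum t = \sum_(p : box n * dir | inD (pt p.1))
    X (pt p.1) * (if inD (nbp p) then X (nbp p) / 2 else 1).
  pose H (p : box n * dir) := inD (pt p.1).
  rewrite (eq_bigl (fun p => inD (pt p.1) && true)) ; last by move=> p; rewrite andbT.
  rewrite -(pair_big_dep (fun v => inD (pt v)) (fun _ _ => true) (fun v j =>
     X (pt v) * (if inD (nb (pt v) j) then X (nb (pt v) j) / 2 else 1))) /=.
  rewrite /pairsum -(pair_bigA _ (fun v j => sv (t v) *
   (if inbox r (nb (pt v) j) then plus_ext t (nb (pt v) j) / 2 else 1))) /=.
  rewrite -reindex_box; apply: eq_bigr => v Dv; apply: eq_bigr => j _.
  rewrite mkvK // -shift_nb -/(inD _) -/(X _).
  by rewrite /X (plus_extE _ Dv).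
rewrite (bigID (fun p : box n * dir => inD (pt p.1))) /=.
rewrite [X in _ + X = _](bigID (fun p : box n * dir => inD (nbp p))) /= addrA.
congr (_ + _); last first.
  apply: eq_bigr => p /andP[D1 D2]; rewrite /G X1 // mul1r X1 // mul1r.
  by [].
(* Reversal of oriented edges moves the outer half of a crossing edge to its inner end. *)
pose sw (p : box n * dir) : box n * dir := (mkv n (nbp p), opp p.2).
have -> : \sum_(p : box n * dir | ~~ inD (pt p.1) && inD (nbp p)) G p =
   \sum_(p : box n * dir | inD (pt p.1) && (~~ inD (nbp p) && inbox n (nbp p))) X (pt p.1) / 2.
  rewrite [RHS](reindex_onto sw sw) /=; last first.
    move=> p /andP[_ /andP[_ i]]; rewrite /sw /nbp /= mkvK // nb_opp ptK oppK.
    by case: p {i}.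
  apply: eq_big => p; last first.
    by move=> /andP[D1 D2]; rewrite /G X1 // mul1r inD_inbox // /sw /= mkvK // inD_inbox.
  apply/idP/idP.
    move=> /andP[D1 D2]; have i2 := inD_inbox D2.
    rewrite /sw /nbp /= mkvK // nb_opp D2 D1 pt_inbox /= ptK oppK.
    by case: p {D1 D2 i2} => ? ?.
  move=> /andP[/andP[D1 /andP[D2 i2]] /eqP e].
  have ii : inbox n (nbp p).
    have e1 : mkv n (nbp (sw p)) = p.1 := congr1 fst e.
    have e2 : nbp (sw p) = pt p.1 by rewrite -e1 mkvK.
    have := nb_opp (pt (sw p).1) (sw p).2; rewrite -/(nbp (sw p)) e2 oppK => e3.
    by rewrite /nbp e3 pt_inbox.
  move: D1 D2; rewrite /sw /nbp /= mkvK // nb_opp => -> ->.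
  by [].

rewrite [X in X + _](bigID (fun p => ~~ inD (nbp p) && inbox n (nbp p))) /=.
rewrite [RHS](bigID (fun p => ~~ inD (nbp p) && inbox n (nbp p))) /=.
rewrite addrAC; congr (_ + _).
  rewrite -big_split; apply: eq_bigr => p /andP[D1 /andP[D2 i]] /=.
  by rewrite /G i (X1 (nbp p)) // (negbTE D2); field.
apply: eq_bigr => p /andP[D1]; rewrite negb_and negbK /G => /orP[D2|ni].
  by rewrite D2 inD_inbox.
by rewrite (negbTE ni); case: ifP => // /inD_inbox; rewrite (negbTE ni).
Qed.

End Transfer.

End Boxes.

(** * The model in a box as an instance of the abstract spin system *)

Section BlumeCapelModel.
Context {R : realType} {d : nat} (beta Delta : R) (b0 : 0 <= beta).
Notation site := (site d).
Notation box := (box d).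
Notation config := (config d).
Notation dir := ('I_d * bool)%type.

Definition nbp n (p : box n * dir) : site := nb (pt p.1) p.2.
(* Every bond of the box is listed twice, once from each end, hence the coupling [beta / 2];
   [tgt] is a junk value on the pairs that leave the box, where [coupling] vanishes. *)
Definition src n (p : box n * dir) : box n := p.1.
Definition tgt n (p : box n * dir) : box n := mkv n (nbp p).
Definition coupling n (p : box n * dir) : R := if inbox n (nbp p) then beta / 2 else 0.
Definition bfield n (v : box n) : R := beta * \sum_(j : dir) (~~ inbox n (nb (pt v) j))%:R.

Notation expectn n := (expect (@src n) (@tgt n) (@coupling n) (@bfield n) (expR Delta)).
Notation weightn n := (weight (@src n) (@tgt n) (@coupling n) (@bfield n) (expR Delta)).
Notation spinR := (@spin R _).
Notation unrevealedn n := (@unrevealed (box n) (box n * dir)%type).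

Lemma coupling_ge0 n p : 0 <= @coupling n p.
Proof. by rewrite /coupling; case: ifP => // _; rewrite divr_ge0. Qed.

Lemma bfield_ge0 n v : 0 <= @bfield n v.
Proof. by rewrite /bfield mulr_ge0 // sumr_ge0. Qed.

Lemma expR_sumE (I : finType) (F : I -> R) : expR (\sum_i F i) = \prod_i expR (F i).
Proof. exact: (big_morph _ (@expRD R) (expR0 R)). Qed.

Lemma pairsumE n (s : config n) : pairsum s =
  (\sum_(p : box n * dir) (if inbox n (nbp p) then spinR s (src p) * spinR s (tgt p) / 2 else 0)) +
  \sum_v spinR s v * \sum_(j : dir) (~~ inbox n (nb (pt v) j))%:R :> R.
Proof.
rewrite /pairsum.
have -> : \sum_v spinR s v * \sum_(j : dir) (~~ inbox n (nb (pt v) j))%:R =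
   \sum_(p : box n * dir) spinR s p.1 * (~~ inbox n (nb (pt p.1) p.2))%:R.
  rewrite -(pair_bigA _ (fun v j => spinR s v * (~~ inbox n (nb (pt v) j))%:R)) /=.
  by apply: eq_bigr => v _; rewrite mulr_sumr.
rewrite -big_split; apply: eq_bigr => p _ /=; rewrite -/(nbp p).
case: ifP => ip /=; last by rewrite add0r.
by rewrite mulr0 addr0 plus_extE // mulrA.
Qed.

Lemma weight_unrevealedE n (s : config n) : weightn n (unrevealedn n) s = expR (BC_exponent beta Delta s).
Proof.
rewrite BC_exponentE pairsumE mulrDr -addrA addrC expRD /weight [LHS]mulrA.
congr (_ * _); last first.
  rewrite mulr_sumr expR_sumE; apply: eq_bigr => p _.
  rewrite /bond_weight /= /coupling; case: ifP => _; last by rewrite mul0r mulr0.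
  by congr expR; rewrite /bondspin; ring.
rewrite expRD mulrC; congr (_ * _).
  rewrite mulr_sumr expR_sumE; apply: eq_bigr => v _; congr expR.
  by rewrite /bfield; ring.
rewrite mulr_sumr expR_sumE; apply: eq_bigr => v _.
rewrite /apriori /= mulr1 /spin; case: (sv_cases R (s v)) => ->;
  rewrite ?sqrrN ?expr1n ?expr0n /= ?mulr0 ?mulr1 ?addr0 ?expR0 //; ring.
Qed.

Lemma BC_expectE n (F : config n -> R) : BC_expect beta Delta F = expectn n (unrevealedn n) F.
Proof.
rewrite /BC_expect /expect /partition; congr (_ / _); apply: eq_bigr => s _.
  by rewrite weight_unrevealedE mulrC.
by rewrite weight_unrevealedE.
Qed.

Definition plus_outside n (D : pred (box n)) : @state (box n) (box n * dir)%type :=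
  State (fun v => if D v then Unknown else Plus) (fun=> Free).

Lemma weight_plus_outside n (D : pred (box n)) (s : config n) :
  weightn n (plus_outside D) s = if [forall v, D v || (s v == inord 2)] then weightn n (unrevealedn n) s else 0.
Proof.
case: ifP => [/forallP H|/negbT]; last first.
  rewrite negb_forall => /existsP[v]; rewrite negb_or => /andP[nD sv2].
  rewrite weight_supp0 // /supp negb_forall; apply/existsP; exists v; rewrite negbK /=.
  rewrite (negbTE nD) /= /spin; move: sv2; case: (s v) => -[|[|[|//]]] i.
  - by move=> _; rewrite /sv /= sub0r sqrrN expr1n subrr mul0r.
  - by move=> _; rewrite /sv /= subrr expr0n add0r mul0r.
  - by rewrite -val_eqE /= inordK.
rewrite /weight; congr (_ * (_ * _)).
apply: eq_bigr => v _; congr (_ * _) => /=; case Dv : (D v) => //.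
by have := H v; rewrite Dv /= => /eqP e; rewrite /spin e sv_inord2 expr1n; field.
Qed.

Definition magn n : R := BC_expect beta Delta (fun s : config n => plus_ext s (@origin d)).

Definition origin_vertex n : box n := mkv n (@origin d).

Lemma magnE n : magn n = expectn n (unrevealedn n) (fun s => spinR s (origin_vertex n)).
Proof.
by rewrite /magn BC_expectE; apply: eq_expect => // s; rewrite plus_extE // inbox_origin.
Qed.

Section Trans.
Context (n r : nat) (c : site).
Context (cn : forall i, - (n%:Z) + r%:Z <= c i /\ c i <= n%:Z - r%:Z).

(** Translation invariance within a single finite box: models in boxes of different radii and
    centres become states on one vertex set, so they can be compared by [expect_mono]. *)
Lemma transfer : expectn n (plus_outside (fun v => inD r c (pt v))) (fun s => spinR s (mkv n c)) = magn r.
Proof.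
set D := fun v => _.
have [C HC] := pairsum_extend (R := R) cn.
pose C' : R := \sum_(v : box n | ~~ D v) 1.
have sq t : \sum_(v : box n) sv (plus_extend n c t v) ^+ 2 = \sum_(w : box r) sv (t w) ^+ 2 + C' :> R.
  rewrite (bigID D) /=; congr (_ + _).
    rewrite -(reindex_box cn (fun w => sv (t w) ^+ 2)); apply: eq_bigr => v Dv.
    by rewrite ffunE -/(D v) Dv.
  by apply: eq_bigr => v /negbTE Dv; rewrite ffunE -/(D v) Dv sv_inord2 expr1n.
have main (G : config n -> R) : \sum_(s : config n) weightn n (plus_outside D) s * G s =
   expR (beta * C + Delta * C') *
     \sum_(t : config r) expR (BC_exponent beta Delta t) * G (plus_extend n c t).
  rewrite (bigID (fun s : config n => [forall v, D v || (s v == inord 2)])) /=.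
  rewrite [X in _ + X]big1 ?addr0; last first.
    by move=> s /negbTE e; rewrite weight_plus_outside e mul0r.
  rewrite (reindex_onto (fun t : config r => plus_extend n c t) (fun s => restrict r c s)) /=; last first.
    move=> s /forallP H; apply: restrictK => v nD.
    by have := H v; rewrite /D (negbTE nD) => /eqP.
  rewrite mulr_sumr; apply: eq_big => t.
    rewrite (plus_extendK cn) eqxx andbT; apply/forallP => v; rewrite ffunE -/(D v).
    by case: (D v) => /=.
  move=> /andP[e _]; rewrite weight_plus_outside e weight_unrevealedE !BC_exponentE HC sq mulrA -expRD.
  by congr (expR _ * _); ring.
rewrite /expect /partition main.
have -> : \sum_(s : config n) weightn n (plus_outside D) s = \sum_(s : config n) weightn n (plus_outside D) s * 1.
  by apply: eq_bigr => s _; rewrite mulr1.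
rewrite main -mulf_div divff ?gt_eqF ?expR_gt0 // mul1r /magn /BC_expect.
congr (_ / _); apply: eq_bigr => t _; last by rewrite mulr1.
rewrite mulrC; congr (_ * _).
rewrite /spin (sv_extend cn) mkvK; last first.
  by apply/inboxP => i; have := cn i; lia.
by congr plus_ext; apply/boolp.funext => i; rewrite /shift /origin subrr.
Qed.
End Trans.

Lemma plus_outside_le n (D D' : pred (box n)) : (forall v, D' v -> D v) ->
  le_state (@src n) (@tgt n) (plus_outside D) (plus_outside D').
Proof.
move=> DD'; split=> [v|b] /=.
  by case D'v : (D' v); [rewrite (DD' _ D'v)|case: (D v)].
by rewrite /le_b /= !orbT.
Qed.

Lemma unrevealed_le n (D' : pred (box n)) :
  le_state (@src n) (@tgt n) (unrevealedn n) (plus_outside D').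
Proof. by split=> [v|b] /=; [case: (D' v)|rewrite /le_b /= !orbT]. Qed.

Let a0 : 0 < expR Delta. Proof. exact: expR_gt0. Qed.

Lemma magn_ge0 n : 0 <= magn n.
Proof.
rewrite magnE; apply: gks1; [exact: coupling_ge0|exact: bfield_ge0|exact: a0| |exact: dcone_spin].
by move=> s ->.
Qed.

Lemma magn_anti n k : (k <= n)%N -> magn n <= magn k.
Proof.
move=> kn; rewrite magnE.
have cn i : - (n%:Z) + k%:Z <= @origin d i /\ @origin d i <= n%:Z - k%:Z.
  by rewrite /origin; lia.
rewrite -(transfer cn); apply: expect_mono; [exact: coupling_ge0|exact: bfield_ge0|exact: a0| |exact: dcone_spin].
exact: unrevealed_le.
Qed.

(** The zero configuration has positive weight. Strictness gives the positive factor [1 - magn 0] of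
    the differential inequality. *)
Lemma magn_lt1 n : magn n < 1.
Proof.
rewrite magnE -subr_gt0.
have -> : 1 - expectn n (unrevealedn n) (fun s => spinR s (origin_vertex n)) = expectn n (unrevealedn n) (fun s => 1 - spinR s (origin_vertex n)).
  by rewrite (expectB _ _ _ _ _ _ (fun=> 1) (fun s => spinR s (origin_vertex n))) (expect_cst _ _ _ _ a0).
rewrite /expect divr_gt0 ?partition_gt0 //.
have nn s : 0 <= weightn n (unrevealedn n) s * (1 - spinR s (origin_vertex n)).
  rewrite mulr_ge0 ?weight_ge0 // ?subr_ge0 //.
  by case: (spin_cases (R := R) s (origin_vertex n)) => ->; lra.
rewrite (bigD1 [ffun=> inord 1]) //= ltr_wpDr //; first by apply: sumr_ge0.
rewrite mulr_gt0 //; first by rewrite weight_unrevealedE expR_gt0.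
by rewrite /spin ffunE /sv inordK // subrr subr0.
Qed.

Lemma corr_le n (x : site) k : (k < norm_inf x)%N -> (norm_inf x <= n)%N ->
  BC_expect beta Delta (fun s : config n => plus_ext s (@origin d) * plus_ext s x) <= magn k.
Proof.
move=> kx xn; rewrite BC_expectE.
have cn i : - (n%:Z) + k%:Z <= @origin d i /\ @origin d i <= n%:Z - k%:Z.
  by rewrite /origin; lia.
have xb : inbox n x by rewrite norm_infP.
have -> : expectn n (unrevealedn n) (fun s => plus_ext s (@origin d) * plus_ext s x) =
   expectn n (unrevealedn n) (fun s => spinR s (origin_vertex n) * spinR s (mkv n x)).
  by apply: eq_expect => // s; rewrite !plus_extE // inbox_origin.
rewrite -(transfer cn); set st := plus_outside _.
have -> : expectn n st (fun s => spinR s (mkv n (@origin d))) =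
   expectn n st (fun s => spinR s (origin_vertex n) * spinR s (mkv n x)).
  apply: expect_supp => // s /(supp_ind (mkv n x)); rewrite /= mkvK // /inD.
  have -> : shift (@origin d) x = x by apply/boolp.funext => i; rewrite /shift /origin subr0.
  by rewrite norm_infP leqNgt kx /= => ->; rewrite mulr1.
apply: expect_mono; [exact: coupling_ge0|exact: bfield_ge0|exact: a0|exact: unrevealed_le|].
by apply: dcone_mul; exact: dcone_spin.
Qed.

(** The box of radius [k - norm_inf (pt v)] centred at the site lies inside the box of radius [k];
    freezing everything outside it only raises the spin. *)
Lemma plus_box_le n k (v : box n) : (k <= n)%N -> (norm_inf (pt v) <= k)%N ->
  expectn n (plus_outside (fun v => inbox k (pt v))) (fun s => spinR s v) <= magn (k - norm_inf (pt v)).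
Proof.
move=> kn vk; set r := (k - _)%N.
have yi i : (`|pt v i| <= norm_inf (pt v))%N.
  by rewrite /norm_inf; exact: (leq_bigmax (F := fun i => `|pt v i|%N)).
have cn i : - (n%:Z) + r%:Z <= pt v i /\ pt v i <= n%:Z - r%:Z.
  by have := yi i; rewrite /r; lia.
rewrite -(transfer cn) ptK; apply: expect_mono;
  [exact: coupling_ge0|exact: bfield_ge0|exact: a0| |exact: dcone_spin].
apply: plus_outside_le => w /inboxP Dw; apply/inboxP => i.
by have := Dw i; have := yi i; rewrite /shift /r; lia.
Qed.

Definition magn_sum n : R := 1 + \sum_(k < n) magn k.

(** The derivative of [magn n] in [beta], as shown in [magn_derive]: the covariance of the spin at
    the origin with the coefficient of [beta]. *)
Definition dmagn n : R := expectn n (unrevealedn n) (fun s => pairsum s * spinR s (origin_vertex n)) -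
  expectn n (unrevealedn n) (fun s => pairsum s) * magn n.

Notation influencen n Q := (influence (@src n) (@tgt n) (@coupling n) (@bfield n) (expR Delta) (origin_vertex n) Q (unrevealedn n)).

Lemma Infln_ge0 n Q : dcone Q -> 0 <= influencen n Q.
Proof.
by apply: influence_ge0; [exact: coupling_ge0|exact: bfield_ge0|exact: a0|].
Qed.

Lemma expect_sum n (I : finType) (c : I -> R) (F : I -> config n -> R) :
  expectn n (unrevealedn n) (fun s => \sum_i c i * F i s) = \sum_i c i * expectn n (unrevealedn n) (F i).
Proof.
rewrite /expect.
have -> : \sum_(s : config n) weightn n (unrevealedn n) s * \sum_i c i * F i s =
   \sum_i c i * \sum_(s : config n) weightn n (unrevealedn n) s * F i s.
  transitivity (\sum_(s : config n) \sum_i c i * (weightn n (unrevealedn n) s * F i s)).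
    by apply: eq_bigr => s _; rewrite mulr_sumr; apply: eq_bigr => i _; ring.
  by rewrite exchange_big; apply: eq_bigr => i _; rewrite mulr_sumr.
by rewrite mulr_suml; apply: eq_bigr => i _; rewrite mulrA.
Qed.

(** The factor 2 undoes the weight one half of an oriented edge; the boundary field terms have
    nonnegative covariance and are dropped. *)
Lemma dmagn_lb n : \sum_(p : box n * dir | inbox n (nbp p)) influencen n (bondspin (@src n) (@tgt n) p) <= 2 * dmagn n.
Proof.
pose A (p : box n * dir) : R := (inbox n (nbp p))%:R / 2.
pose c (v : box n) : R := \sum_(j : dir) (~~ inbox n (nb (pt v) j))%:R.
have pE (s : config n) : pairsum s = \sum_p A p * bondspin (@src n) (@tgt n) p s + \sum_v c v * spinR s v.
  rewrite pairsumE; congr (_ + _); apply: eq_bigr => p _; last by rewrite mulrC.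
  by rewrite /A /bondspin; case: ifP => _ /=; rewrite ?mul0r //; ring.
have e1 : expectn n (unrevealedn n) (fun s => pairsum s) =
    \sum_p A p * expectn n (unrevealedn n) (bondspin (@src n) (@tgt n) p) + \sum_v c v * expectn n (unrevealedn n) (fun s => spinR s v).
  rewrite -(expect_sum A) -(expect_sum c (fun v s => spinR s v)) -expectD; exact: eq_expect.
have e2 : expectn n (unrevealedn n) (fun s => pairsum s * spinR s (origin_vertex n)) =
    \sum_p A p * expectn n (unrevealedn n) (fun s => bondspin (@src n) (@tgt n) p s * spinR s (origin_vertex n)) +
    \sum_v c v * expectn n (unrevealedn n) (fun s => spinR s v * spinR s (origin_vertex n)).
  rewrite -(expect_sum A (fun p s => bondspin (@src n) (@tgt n) p s * spinR s (origin_vertex n))).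
  rewrite -(expect_sum c (fun v s => spinR s v * spinR s (origin_vertex n))) -expectD.
  apply: eq_expect => // s; rewrite pE mulrDl !mulr_suml.
  by congr (_ + _); apply: eq_bigr => i _; rewrite mulrA.
have -> : dmagn n = \sum_p A p * influencen n (bondspin (@src n) (@tgt n) p) + \sum_v c v * influencen n (fun s => spinR s v).
  rewrite /dmagn e1 e2 magnE mulrDl opprD addrACA !mulr_suml -!sumrB /influence.
  by congr (_ + _); apply: eq_bigr => i _; ring.
rewrite mulrDr -[X in X <= _]addr0; apply: lerD; last first.
  rewrite mulr_ge0 // sumr_ge0 // => v _; rewrite mulr_ge0 ?sumr_ge0 //.
  by apply: Infln_ge0; exact: dcone_spin.
rewrite mulr_sumr big_mkcond /=; apply: ler_sum => p _; rewrite /A.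
by case: ifP => _ /=; rewrite ?mul0r ?mulr0 // mul1r mulrA divff // mul1r.
Qed.

(** The bound of [bond_lb] at coupling [beta / 2], where [expR (- K) * sinh K = (1 - expR (- beta))
    / 2]. It does not depend on the box. *)
Definition bond_lb_cst : R := (1 - expR (- beta)) / 2 * (2 * expR Delta / (1 + 2 * expR Delta)) ^+ 2.

Lemma bond_lb_cst_le n (p : box n * dir) : inbox n (nbp p) ->
  bond_lb_cst <= expectn n (unrevealedn n) (bondspin (@src n) (@tgt n) p).
Proof.
move=> ip; have := bond_lb (@src n) (@tgt n) (@coupling_ge0 n) (@bfield_ge0 n) a0 p.
apply: le_trans; rewrite le_eqVlt; apply/orP; left; apply/eqP; rewrite /bond_lb_cst /coupling ip.
congr (_ * _); rewrite mulrA mulrBr -!expRD; congr ((_ - _) / _).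
  by rewrite addNr expR0.
by congr expR; field.
Qed.

(** The 12 is [2 * 3 * 2]: the two ends of an edge, each reached with total weight at most
    [magn_sum n], the 3 of [bond_influence_le] and the 2 of [dmagn_lb]. The factor [1 - magn 0]
    bounds [1 - f I] from below for all [k] at once. *)
Lemma diff_ineq n : 0 < bond_lb_cst -> n%:R * magn n * (1 - magn 0) * bond_lb_cst <= 12 * magn_sum n * dmagn n.
Proof.
move=> q00.
pose Ds k (v : box n) := inbox k (pt v).
pose touch k (p : box n * dir) := inbox n (nbp p) && (Ds k (src p) || Ds k (tgt p)).
pose Wn p := bond_influence (@src n) (@tgt n) (@coupling n) (@bfield n) (expR Delta) (origin_vertex n) p (unrevealedn n).
pose Uk k p := reach (@src n) (@tgt n) (@coupling n) (@bfield n) (expR Delta) p (plus_outside (Ds k)).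
have W0 p : 0 <= Wn p.
  by apply: bond_influence_ge0 => //; [exact: coupling_ge0|exact: bfield_ge0].
have step k : (k < n)%N -> magn n * (1 - magn 0) <= \sum_(p | touch k p) Uk k p * Wn p.
  move=> kn.
  have fI : expectn n (plus_outside (Ds k)) (fun s => spinR s (origin_vertex n)) <= magn 0.
    have e : norm_inf (pt (origin_vertex n)) = 0%N.
      by rewrite /origin_vertex mkvK ?inbox_origin // /norm_inf big1.
    have := @plus_box_le n k (origin_vertex n) (ltnW kn); rewrite e subn0 => /(_ isT) H.
    by apply: le_trans H _; exact: magn_anti.
  have := @osss _ _ _ (@src n) (@tgt n) (@coupling n) (@bfield n) _ (@coupling_ge0 n) (@bfield_ge0 n) a0 (origin_vertex n)
     [set v | Ds k v] [set p | touch k p] _ _ (plus_outside (Ds k)) (unrevealedn n) _ _ (unrevealed_le _).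
  rewrite -magnE => H.
  apply: (@le_trans _ _ (magn n * (1 - expectn n (plus_outside (Ds k)) (fun s => spinR s (origin_vertex n))))).
    by rewrite ler_wpM2l ?magn_ge0 // lerD2l lerN2.
  rewrite (eq_bigl (fun p => p \in [set p | touch k p])); last by move=> p; rewrite inE.
  apply: H.
  - move=> v; rewrite inE /bfield => vk; rewrite big1 ?mulr0 // => j _.
    rewrite norm_infP (leq_trans (norm_inf_nb _ _)) //.
    by move: vk; rewrite /Ds norm_infP => vk; exact: leq_ltn_trans kn.
  - move=> p; rewrite !inE /touch /coupling; case: ifP => // ip.
    by rewrite /= => /negbTE ->.
  - split => //; first by move=> p -> /negP[].
    by move=> v; rewrite inE /= => /negbTE ->.
  - by split; [exact: unrevealed_known|].
(* An edge touching the box of radius [k] may have its other end at distance [k.+1], where the site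
   is frozen and the bound is 1. *)
have phi k (v : box n) : (k < n)%N -> (norm_inf (pt v) <= k.+1)%N ->
   expectn n (plus_outside (Ds k)) (fun s => spinR s v) <=
     (if (norm_inf (pt v) <= k)%N then magn (k - norm_inf (pt v)) else (norm_inf (pt v) == k.+1)%:R).
  move=> kn vk; case: ifP => [vk'|/negbT]; first by apply: plus_box_le => //; exact: ltnW.
  rewrite -ltnNge => vk'; have -> : norm_inf (pt v) == k.+1 by rewrite eqn_leq vk vk'.
  rewrite -(expect_cst (@src n) (@tgt n) (@coupling n) (@bfield n) a0 (plus_outside (Ds k)) 1).
  apply: expect_le => // s _; case: (spin_cases (R := R) s v) => -> //; lra.
(* At most one [k] puts the site at distance [k.+1], whence the 1 in [magn_sum]; the other terms are
   a shifted initial piece of the sum of the magnetizations. *)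
have sumphi (v : box n) : \sum_(k < n)
   (if (norm_inf (pt v) <= k)%N then magn (k - norm_inf (pt v)) else (norm_inf (pt v) == k.+1)%:R) <= magn_sum n.
  set p := norm_inf _.
  apply: (@le_trans _ _ (\sum_(k < n) (p == k.+1)%:R + \sum_(k < n) (if (p <= k)%N then magn (k - p) else 0))).
    rewrite -big_split; apply: ler_sum => k _ /=; case: ifP => _; last by rewrite addr0.
    by rewrite lerDr.
  rewrite /magn_sum; apply: lerD.
    case: p => [|p]; first by rewrite big1 //.
    have [pn|np] := ltnP p n; last first.
      rewrite big1 // => k _; rewrite eqSS; case: eqP => // e.
      by have := ltn_ord k; rewrite -e ltnNge np.
    rewrite (bigD1 (Ordinal pn)) //= eqxx big1 ?addr0 // => k nk.
    by rewrite eqSS eq_sym; move: nk; rewrite -val_eqE /= => /negbTE ->.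
  rewrite -(big_mkord xpredT (fun k => if (p <= k)%N then magn (k - p) else 0)).
  rewrite -(big_mkord xpredT magn).
  have [pn|np] := leqP p n; last first.
    rewrite big_nat big1; first by apply: sumr_ge0 => k _; exact: magn_ge0.
    by move=> k /andP[_ kn]; rewrite leqNgt (leq_trans kn) // ltnW.
  rewrite (@big_cat_nat _ _ _ p) //= big_nat big1 ?add0r; last first.
    by move=> k /andP[_ kp]; rewrite leqNgt kp.
  rewrite -{1}[p]add0n big_addn [X in _ <= X](@big_cat_nat _ _ _ (n - p)) ?leq_subr //=.
  rewrite -[X in X <= _]addr0; apply: lerD; last first.
    by apply: sumr_ge0 => k _; exact: magn_ge0.
  by apply: ler_sum => k _; rewrite leq_addl addnK.
have ptt (p : box n * dir) : inbox n (nbp p) -> pt (tgt p) = nbp p by move=> ip; rewrite /tgt mkvK.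
have tl p k : touch k p -> (norm_inf (pt (src p)) <= k.+1)%N /\ (norm_inf (pt (tgt p)) <= k.+1)%N.
  move=> /andP[ip]; rewrite /Ds !norm_infP (ptt _ ip) => /orP[] H; split.
  - exact: leqW.
  - exact: leq_trans (norm_inf_nb _ _) _.
  - rewrite -[pt (src p)](nb_opp _ p.2); exact: leq_trans (norm_inf_nb _ _) _.
  - exact: leqW.
have tot : n%:R * (magn n * (1 - magn 0)) <= \sum_(p | inbox n (nbp p)) (2 * magn_sum n) * Wn p.
  have -> : n%:R * (magn n * (1 - magn 0)) = \sum_(k < n) magn n * (1 - magn 0).
    by rewrite sumr_const card_ord mulr_natl.
  apply: (@le_trans _ _ (\sum_(k < n) \sum_(p | inbox n (nbp p)) (if touch k p then Uk k p else 0) * Wn p)).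
    apply: ler_sum => k _; apply: le_trans (step k (ltn_ord k)) _.
    rewrite big_mkcond [X in _ <= X]big_mkcond; apply: ler_sum => p _.
    by rewrite /touch; case: (inbox n (nbp p)) => //=; case: ifP => //; rewrite mul0r.
  rewrite exchange_big; apply: ler_sum => p ip /=; rewrite -mulr_suml.
  apply: ler_wpM2r => //.
  rewrite mulr_natl mulr2n; apply: le_trans (lerD (sumphi (src p)) (sumphi (tgt p))).
  rewrite -big_split; apply: ler_sum => k _ /=.
  have nn v : 0 <= (if (norm_inf (pt v) <= k)%N then magn (k - norm_inf (pt v)) else
       (norm_inf (pt v) == k.+1)%:R :> R).
    by case: ifP => // _; exact: magn_ge0.
  case: ifP => [/tl[t1 t2]|_]; last by rewrite addr_ge0.
  by rewrite /Uk /reach; apply: lerD; apply: phi.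
have S0 : 0 <= magn_sum n by rewrite addr_ge0 // sumr_ge0 // => k _; exact: magn_ge0.
have wb p : inbox n (nbp p) -> bond_lb_cst * Wn p <= 3 * influencen n (bondspin (@src n) (@tgt n) p).
  move=> ip; have qs := bond_lb_cst_le ip.
  have := bond_influence_le (@coupling_ge0 n) (@bfield_ge0 n) a0 (origin_vertex n) (lt_le_trans q00 qs).
  by apply: le_trans; exact: ler_wpM2r.
have -> : n%:R * magn n * (1 - magn 0) * bond_lb_cst = bond_lb_cst * (n%:R * (magn n * (1 - magn 0))) by ring.
apply: le_trans (ler_wpM2l (ltW q00) tot) _.
have -> : 12 * magn_sum n * dmagn n = 6 * magn_sum n * (2 * dmagn n) by ring.
apply: (@le_trans _ _ (6 * magn_sum n * \sum_(p : box n * dir | inbox n (nbp p)) influencen n (bondspin (@src n) (@tgt n) p))).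
  rewrite !mulr_sumr; apply: ler_sum => p ip.
  have := ler_wpM2l (_ : 0 <= 2 * magn_sum n) (wb p ip); rewrite mulr_ge0 // => /(_ isT).
  by congr (_ <= _); ring.
by apply: ler_wpM2l; [rewrite mulr_ge0|exact: dmagn_lb].
Qed.

Lemma dmagn_ge0 n : 0 <= dmagn n.
Proof.
have : 0 <= 2 * dmagn n.
  apply: le_trans (dmagn_lb n); apply: sumr_ge0 => p _.
  by apply: Infln_ge0; exact: dcone_bondspin.
by rewrite pmulr_rge0.
Qed.

End BlumeCapelModel.

(** * The differential inequality *)

Section Derivatives.
Context {R : realType}.
Import numFieldNormedType.Exports.

Lemma is_derive_bigsum (I : Type) (r : seq I) (f : I -> R -> R) (df : I -> R) (x : R) :
  (forall i, is_derive x (1 : R) (f i) (df i)) ->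
  is_derive x (1 : R) (fun y => \sum_(i <- r) f i y) (\sum_(i <- r) df i).
Proof.
move=> H; elim: r => [|i r IH].
  have -> : (fun y => \sum_(i <- [::]) f i y) = cst (0 : R).
    by apply/boolp.funext => y; rewrite big_nil.
  by rewrite big_nil; exact: is_derive_cst.
have -> : (fun y => \sum_(j <- i :: r) f j y) = f i \+ (fun y => \sum_(j <- r) f j y).
  by apply/boolp.funext => y; rewrite big_cons.
by rewrite big_cons; exact: is_deriveD.
Qed.

Lemma is_derive_expR_affine (p c x : R) :
  is_derive x (1 : R) (fun y => expR (y * p + c)) (p * expR (x * p + c)).
Proof.
have H1 : is_derive x (1 : R) (fun y : R => y * p + c) p.
  have := is_deriveD (is_deriveZ p (is_derive_id x (1 : R^o))) (is_derive_cst (c : R^o) x (1 : R^o)).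
  congr (is_derive _ _ _ _); last by rewrite /GRing.scale /= mulr1 addr0.
  by apply/boolp.funext => y; rewrite mulrC.
have H2 := is_derive_expR (x * p + c).
have := @is_derive1_comp R expR (fun y : R => y * p + c) x _ _ H2 H1.
by rewrite mulrC.
Qed.

Lemma derive_ndecr (g dg : R -> R) (a b : R) :
  (forall x, a <= x <= b -> is_derive x (1 : R) g (dg x)) ->
  (forall x, a <= x <= b -> 0 <= dg x) -> a <= b -> g a <= g b.
Proof.
move=> dgH dg0 ab.
have in_oo x : x \in `]a, b[ -> a <= x <= b.
  by rewrite in_itv /= => /andP[/ltW -> /ltW ->].
apply: (@ger0_derive1_ndecr R g a b) => //.
- by move=> x /in_oo/dgH[].
- move=> x /in_oo xab; rewrite derive1E.
  by have H := dgH x xab; rewrite (@derive_val _ _ _ _ _ _ _ H) dg0.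
- apply: derivable_within_continuous => x; rewrite in_itv /= => xab.
  by case: (dgH x xab).
Qed.

Lemma is_derive_ratio (N Z : R -> R) (dN dZ x : R) : Z x != 0 ->
  is_derive x (1 : R) N dN -> is_derive x (1 : R) Z dZ ->
  is_derive x (1 : R) (fun y => N y / Z y) (dN / Z x - (N x / Z x) * (dZ / Z x)).
Proof.
move=> Z0 HN HZ.
have HV : is_derive x (1 : R) (fun y => (Z y)^-1) (- (Z x) ^- 2 *: dZ).
  exact: is_deriveV.
have -> : (fun y => N y / Z y) = N * (fun y => (Z y)^-1) by [].
have := is_deriveM HN HV; congr (is_derive _ _ _ _).
by rewrite /GRing.scale /=; field.
Qed.

End Derivatives.

(** * Derivative of the magnetization in [beta] *)

Section MagnetizationDerivative.
Context {R : realType} {d : nat} (Delta : R).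
Import numFieldNormedType.Exports.

Lemma magn_derive (n : nat) (beta : R) :
  is_derive beta (1 : R) (fun b : R => @magn R d b Delta n) (@dmagn R d beta Delta n).
Proof.
pose P (s : config d n) : R := pairsum s.
pose c (s : config d n) : R := Delta * \sum_(v : box d n) sv (s v) ^+ 2.
pose F (s : config d n) : R := plus_ext s (@origin d).
pose E (s : config d n) (b : R) := expR (b * P s + c s).
have eE b s : expR (BC_exponent b Delta s) = E s b by rewrite BC_exponentE.
pose N b := \sum_(s : config d n) F s * E s b.
pose Z b := \sum_(s : config d n) E s b.
have HE s : is_derive beta (1 : R) (E s) (P s * E s beta) by exact: is_derive_expR_affine.
have HZ : is_derive beta (1 : R) Z (\sum_(s : config d n) P s * E s beta).
  exact: is_derive_bigsum.
have HN : is_derive beta (1 : R) N (\sum_(s : config d n) F s * (P s * E s beta)).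
  apply: is_derive_bigsum => s; exact: is_deriveZ.
have Z0 : Z beta != 0.
  rewrite gt_eqF // /Z (bigD1 [ffun=> inord 1]) //= ltr_wpDr ?expR_gt0 //.
  by apply: sumr_ge0 => s _; exact: expR_ge0.
have mE : (fun b : R => @magn R d b Delta n) = fun b => N b / Z b.
  apply/boolp.funext => b; rewrite /magn /BC_expect; congr (_ / _);
  by apply: eq_bigr => s _; rewrite eE.
rewrite mE; have := is_derive_ratio Z0 HN HZ; congr (is_derive _ _ _ _).
have be G : expect (@src d n) (@tgt d n) (@coupling R d beta n) (@bfield R d beta n) (expR Delta) unrevealed G =
   (\sum_(s : config d n) G s * E s beta) / Z beta.
  by rewrite -BC_expectE /BC_expect; congr (_ / _); apply: eq_bigr => s _; rewrite eE.
rewrite /dmagn /magn BC_expectE !be -/P.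
have ov1 s : spin s (origin_vertex n) = F s :> R by rewrite /F plus_extE // inbox_origin.
congr (_ / _ - _).
  by apply: eq_bigr => s _; rewrite ov1 -/(P s); ring.
rewrite mulrC; congr (_ * _).
Qed.

End MagnetizationDerivative.

Section DifferentialInequality.
Context {R : realType}.
Import numFieldNormedType.Exports.

(** [m t * expR (- lam * t)] is nondecreasing. *)
Lemma gronwall (m dm : R -> R) (lam x y : R) :
  (forall t, x <= t <= y -> is_derive t (1 : R) m (dm t)) ->
  (forall t, x <= t <= y -> lam * m t <= dm t) -> x <= y ->
  m x <= m y * expR (- (lam * (y - x))).
Proof.
move=> dmH lmH xy.
pose g t := m t * expR (t * - lam + 0).
have H : g x <= g y.
  apply: (@derive_ndecr R g (fun t => (dm t - lam * m t) * expR (t * - lam + 0))) => //.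
    move=> t /dmH Hm; have He := is_derive_expR_affine (- lam) 0 t.
    have := is_deriveM Hm He; congr (is_derive _ _ _ _).
    by rewrite /GRing.scale /=; ring.
  by move=> t /lmH h; rewrite mulr_ge0 ?expR_ge0 // subr_ge0.
move: H; rewrite /g !addr0 => H.
have := ler_wpM2r (expR_ge0 (x * lam)) H; rewrite -!mulrA -!expRD.
have -> : x * - lam + x * lam = 0 by ring.
have -> : y * - lam + x * lam = - (lam * (y - x)) by ring.
by rewrite expR0 mulr1.
Qed.

Context (m dm : nat -> R -> R) (b0 b1 C : R).
Context (b01 : b0 < b1) (C0 : 0 < C).
Context (dmH : forall n t, b0 <= t <= b1 -> is_derive t (1 : R) (m n) (dm n t)).
Context (dm0 : forall n t, b0 <= t <= b1 -> 0 <= dm n t).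
Context (m0 : forall n t, b0 <= t <= b1 -> 0 <= m n t).
Context (m1 : forall n t, b0 <= t <= b1 -> m n t <= 1).

Definition Ssum n t : R := 1 + \sum_(k < n) m k t.
Context (ineq : forall n t, b0 <= t <= b1 -> n%:R * m n t <= C * Ssum n t * dm n t).
Context (mcv : forall eps, 0 < eps -> exists n0, forall n, (n0 <= n)%N -> m n b1 <= eps).

Lemma m_ndecr n x y : b0 <= x -> x <= y -> y <= b1 -> m n x <= m n y.
Proof.
move=> x0 xy y1; apply: (@derive_ndecr R (m n) (dm n)) => // t /andP[t1 t2];
  [apply: dmH|apply: dm0]; by rewrite (le_trans x0) // (le_trans t2).
Qed.

Lemma S_ge1 n t : b0 <= t <= b1 -> 1 <= Ssum n t.
Proof. by move=> tb; rewrite lerDl sumr_ge0 // => k _; exact: m0. Qed.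

Lemma S_ndecr n x y : b0 <= x -> x <= y -> y <= b1 -> Ssum n x <= Ssum n y.
Proof. by move=> *; rewrite lerD2l; apply: ler_sum => k _; exact: m_ndecr. Qed.

Lemma S_le n t : b0 <= t <= b1 -> Ssum n t <= 1 + n%:R.
Proof.
move=> tb; rewrite lerD2l; apply: (@le_trans _ _ (\sum_(k < n) 1)).
  by apply: ler_sum => k _; exact: m1.
by rewrite sumr_const card_ord.
Qed.

(** Up to [y] the sum is at most [s], so [m n] grows at logarithmic rate at least [n%:R / (C * s)];
    it is at most 1 at [y]. *)
Lemma decay_of_bounded_sum n x y s : b0 <= x -> x <= y -> y <= b1 -> Ssum n y <= s ->
  m n x <= expR (- (n%:R / (C * s) * (y - x))).
Proof.
move=> x0 xy y1 Ss.
have yb : b0 <= y <= b1 by rewrite (le_trans x0).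
have s0 : 0 < s by apply: lt_le_trans Ss; apply: lt_le_trans (S_ge1 n yb).
have := @gronwall (m n) (dm n) (n%:R / (C * s)) x y.
have tb t : x <= t <= y -> b0 <= t <= b1.
  by move=> /andP[t1 t2]; rewrite (le_trans x0) // (le_trans t2).
move=> /(_ (fun t h => dmH n (tb t h)))/(_ _ xy) G.
have Cs : 0 < C * s by exact: mulr_gt0.
apply: le_trans (G _) _; last first.
  by rewrite -[X in _ <= X]mul1r ler_wpM2r ?expR_ge0 // m1.
move=> t txy; rewrite mulrAC ler_pdivrMr //.
apply: le_trans (ineq n (tb t txy)) _; rewrite [X in _ <= X]mulrC.
apply: ler_wpM2r; first exact: dm0 (tb t txy).
rewrite ler_pM2l //; apply: le_trans Ss; case/andP: txy => t1 t2.
by apply: S_ndecr => //; exact: le_trans t1.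
Qed.

Lemma ln_le_sub1 (x : R) : 0 < x -> ln x <= x - 1.
Proof.
by move=> x0; have := expR_ge1Dx (ln x); rewrite lnK ?posrE //; lra.
Qed.

(** By [ln (1 + u) <= u], each step of [ln (Ssum k t)] is at most [m k t / Ssum k t], hence at most
    [k%:R^-1 * (C * dm k t)]. The sum telescopes from [Ssum 1 t <= 2], the term [k = 0] being
    zero. *)
Lemma sum_ratio_lb n t : b0 <= t <= b1 -> (0 < n)%N ->
  ln (Ssum n t) - ln 2 <= \sum_(k < n) k%:R^-1 * (C * dm k t).
Proof.
move=> tb; elim: n => // -[|n] IH _.
  rewrite big_ord_recl big_ord0 invr0 mul0r addr0 subr_le0 ler_ln ?posrE //; last first.
    exact: lt_le_trans (S_ge1 1 tb).
  by apply: le_trans (S_le 1 tb) _.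
rewrite big_ord_recr /=; apply: le_trans (lerD (IH isT) (lexx _)).
rewrite addrAC lerD2r.
set S := Ssum n.+1 t; have S1 : 1 <= S := S_ge1 _ tb.
have S0 : 0 < S by lra.
have SS : Ssum n.+2 t = S + m n.+1 t by rewrite /S /Ssum big_ord_recr /= addrA.
have mm0 := m0 n.+1 tb.
have -> : Ssum n.+2 t = S * (1 + m n.+1 t / S) by rewrite SS mulrDr mulr1 mulrCA divff ?mulr1 // gt_eqF.
have r0 : 0 <= m n.+1 t / S by rewrite divr_ge0 // ltW.
rewrite lnM ?posrE //; last by lra.
rewrite lerD2l; apply: le_trans (ln_le_sub1 _) _; first by lra.
rewrite addrAC subrr add0r ler_pdivrMr //.
have n0 : 0 < n.+1%:R :> R by rewrite ltr0n.
rewrite -(ler_pM2l n0); apply: le_trans (ineq n.+1 tb) _; rewrite -/S.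
rewrite le_eqVlt; apply/orP; left; apply/eqP.
by rewrite !mulrA divff ?gt_eqF // mul1r mulrAC.
Qed.

Lemma harmonic_le n : (0 < n)%N -> \sum_(k < n) k%:R^-1 <= 1 + ln n%:R :> R.
Proof.
move=> n0; apply: (@le_trans _ _ (\sum_(k < n.+1) k%:R^-1)).
  by rewrite big_ord_recr /= lerDl invr_ge0.
elim: n n0 => // -[|n] IH _.
  by rewrite !big_ord_recl big_ord0 invr0 ln1 /bump /= invr1 add0r !addr0.
rewrite big_ord_recr /=; apply: le_trans (lerD (IH isT) (lexx _)) _.
rewrite -addrA lerD2l -lerBrDl.
have p1 : 0 < n.+1%:R :> R by rewrite ltr0n.
have p2 : 0 < n.+2%:R :> R by rewrite ltr0n.
have := ln_le_sub1 (divr_gt0 p1 p2); rewrite ln_div ?posrE //.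
have -> : n.+1%:R / n.+2%:R - 1 = - n.+2%:R^-1 :> R.
  apply: (mulIf (lt0r_neq0 p2)); rewrite mulrBl divfK ?gt_eqF // mulNr mulVf ?gt_eqF // mul1r.
  by rewrite -[n.+2%:R]natr1; ring.
by move=> H; rewrite -lerN2 opprB.
Qed.

(** Otherwise, for arbitrarily large [n], [ln (Ssum n)] exceeds half of [ln n] at [a], hence on all
    of [[a, b1]], and the average of the [m k] with weights [1 / k] cannot tend to zero at [b1]. *)
Lemma Ssum_sqrt a : b0 <= a -> a < b1 -> exists n0, forall n, (n0 <= n)%N -> Ssum n a ^+ 2 <= n%:R.
Proof.
move=> a0 ab.
apply: contrapT => nex.
have H n0 : exists2 n, (n0 <= n)%N & n%:R < Ssum n a ^+ 2.
  apply: contrapT => nn; apply: nex; exists n0 => n nn0.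
  by rewrite leNgt; apply/negP => lt; apply: nn; exists n.
pose del := (b1 - a) / C.
have del0 : 0 < del by rewrite divr_gt0 ?subr_gt0.
have d4 : 0 < del / 4 by rewrite divr_gt0.
have [k0 Hk0] := mcv d4.
(* Solves the inequality reached at the end, [del * (ln n / 2 - ln 2) <= k0 + del / 4 * (1 + ln n)];
   the threshold [del / 4] leaves half of the growth rate [del / 2] to spare. *)
pose bound := (k0%:R + del / 4 + del * ln 2) / (del / 4).
have [n nbig nS] := H (Num.bound (expR bound)).+1.
have n0 : (0 < n)%N by apply: leq_trans nbig.
have n0R : 0 < n%:R :> R by rewrite ltr0n.
have lnn : bound < ln n%:R.
  rewrite -ltr_expR lnK ?posrE //.
  apply: (lt_le_trans (archi_boundP (expR_ge0 _))).
  by rewrite ler_nat ltnW.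
have b1b : b0 <= b1 <= b1 by rewrite ltW // lexx.
(* The term [k = 0] vanishes since [0^-1 = 0]. The derivative of [T] dominates
   [ln (Ssum n)], whereas [T b1 = o (ln n)]. *)
pose T t := \sum_(k < n) k%:R^-1 * m k t.
pose lo := (ln n%:R / 2 - ln 2) / C.
have grow : T a + lo * (b1 - a) <= T b1.
  have -> : T a + lo * (b1 - a) = T a - lo * a + lo * b1 by ring.
  rewrite -lerBrDr.
  pose g t := T t + (t * - lo).
  suff : g a <= g b1 by rewrite /g !mulrN !(mulrC lo).
  have dI t : is_derive t (1 : R) (fun y : R => y * - lo) (- lo).
    have := is_deriveZ (- lo) (is_derive_id t (1 : R^o)); congr (is_derive _ _ _ _).
      by apply/boolp.funext => y; rewrite mulrC.
    by rewrite /GRing.scale /= mulr1.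
  apply: (@derive_ndecr R g (fun t => \sum_(k < n) k%:R^-1 * dm k t + (- lo))); last exact: ltW.
    move=> t /andP[t1 t2].
    have tb : b0 <= t <= b1 by rewrite (le_trans a0).
    apply: is_deriveD; apply: is_derive_bigsum => k.
    by apply: is_deriveZ; exact: dmH.
  move=> t /andP[t1 t2]; have tb : b0 <= t <= b1 by rewrite (le_trans a0).
  rewrite subr_ge0 /lo ler_pdivrMr //.
  have := sum_ratio_lb tb n0.
  have -> : \sum_(k < n) k%:R^-1 * (C * dm k t) = (\sum_(k < n) k%:R^-1 * dm k t) * C.
    by rewrite mulr_suml; apply: eq_bigr => k _; ring.
  apply: le_trans; rewrite lerD2r.
  have Sa1 : 1 <= Ssum n a by apply: S_ge1; rewrite a0 ltW.
  have Sat : Ssum n a <= Ssum n t by apply: S_ndecr.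
  have Sa0 : 0 < Ssum n a by lra.
  have St0 : 0 < Ssum n t by exact: lt_le_trans Sat.
  rewrite ler_pdivrMr // mulr_natr -lnXn //.
  rewrite ler_ln ?posrE ?exprn_gt0 //; apply: le_trans (ltW nS) _.
  by rewrite ler_sqr ?nnegrE // ltW.
have Ta0 : 0 <= T a.
  by rewrite sumr_ge0 // => k _; rewrite mulr_ge0 ?invr_ge0 // m0 // a0 ltW.
have Tb : T b1 <= k0%:R + del / 4 * (1 + ln n%:R).
  apply: (@le_trans _ _ (\sum_(k < n) ((k < k0)%N%:R + del / 4 * k%:R^-1))).
    apply: ler_sum => k _; have [kk|kk] := ltnP k k0.
      have k1 : k%:R^-1 * m k b1 <= 1.
        apply: mulr_ile1; rewrite ?invr_ge0 ?m0 ?m1 //.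
        by case: (k : nat) => [|j]; rewrite ?invr0 // invf_le1 ?ltr0n // ler1n.
      by rewrite -[X in X <= _]addr0 lerD // mulr_ge0 ?invr_ge0 // ltW // divr_gt0.
    by rewrite add0r mulrC ler_wpM2r ?invr_ge0 // Hk0.
  rewrite big_split /=; apply: lerD.
    rewrite -natr_sum ler_nat -big_mkcond /= sum1_card.
    apply: leq_trans (_ : (#|[pred i : 'I_n | i < k0]| <= k0))%N => //.
    rewrite cardE -(size_map val) -[X in (_ <= X)%N](size_iota 0).
    apply: uniq_leq_size; first by rewrite map_inj_uniq ?enum_uniq //; exact: val_inj.
    by move=> x /mapP[y]; rewrite mem_enum inE mem_iota => yk ->.
  by rewrite -mulr_sumr; apply: ler_wpM2l; [exact: ltW|exact: harmonic_le].
have e : lo * (b1 - a) = del * (ln n%:R / 2 - ln 2) by rewrite /lo /del; ring.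
have : bound * (del / 4) < ln n%:R * (del / 4) by rewrite ltr_pM2r // divr_gt0.
rewrite /bound divfK ?(gt_eqF d4) //.
by move: grow Tb; rewrite e; lra.
Qed.

(* Three intervals: [Ssum n <= sqrt n] at [ba] gives stretched exponential decay at [bb], hence
   a bounded [Ssum] there, hence exponential decay at [b0]. *)
Theorem exp_decay : exists c A : R, [/\ 0 < c, 0 < A & forall n, m n b0 <= A * expR (- (c * n%:R))].
Proof.
pose h := (b1 - b0) / 3.
have h0 : 0 < h by rewrite divr_gt0 // subr_gt0.
pose ba := b0 + 2 * h; pose bb := b0 + h.
have hb1 : b1 = b0 + 3 * h by rewrite /h; field.
have [ba0 ba1 bb0 bbba] : [/\ b0 <= ba, ba < b1, b0 <= bb & bb <= ba].
  by rewrite /ba /bb hb1; split; lra.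
have [n0 Hn0] := Ssum_sqrt ba0 ba1.
have bba : b0 <= ba <= b1 by rewrite ba0 ltW.
have bbb : b0 <= bb <= b1 by rewrite bb0 (le_trans bbba) // ltW.
pose lam := h / C.
have lam0 : 0 < lam by rewrite divr_gt0.
(* From [y ^+ 4 / 24 <= expR y] with [y] at least [lam] times the square root of [n]: the fourth
   power already gives the summable bound [A0 / n ^+ 2]. *)
pose A0 := 24 / lam ^+ 4.
have A00 : 0 < A0 by rewrite divr_gt0 // exprn_gt0.
have poly n : (n0 <= n)%N -> (0 < n)%N -> m n bb <= A0 / n%:R ^+ 2.
  move=> nn npos; have nR : 0 < n%:R :> R by rewrite ltr0n.
  have S1 := S_ge1 n bba; have S0 : 0 < Ssum n ba by lra.
  have := decay_of_bounded_sum bb0 bbba (ltW ba1) (lexx (Ssum n ba)).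
  have -> : n%:R / (C * Ssum n ba) * (ba - bb) = lam * (n%:R / Ssum n ba).
    rewrite /lam /ba /bb; field; rewrite !gt_eqF //.
  set y := lam * _ => H; apply: le_trans H _.
  have y0 : 0 < y by rewrite mulr_gt0 // divr_gt0.
  have yy : lam ^+ 4 * n%:R ^+ 2 <= y ^+ 4.
    have l4 : 0 < lam ^+ 4 by rewrite exprn_gt0.
    have S4 : 0 < Ssum n ba ^+ 4 by rewrite exprn_gt0.
    have -> : y ^+ 4 = lam ^+ 4 * (n%:R ^+ 4 / Ssum n ba ^+ 4) by rewrite /y exprMn_comm ?expr_div_n //; exact: mulrC.
    rewrite (ler_pM2l l4) ler_pdivlMr //.
    have := ler_wpM2l (sqr_ge0 n%:R) (_ : (Ssum n ba ^+ 2) ^+ 2 <= n%:R ^+ 2 :> R).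
    rewrite ler_sqr ?nnegrE ?sqr_ge0 // => /(_ (Hn0 n nn)).
    by congr (_ <= _); ring.
  have e24 : y ^+ 4 / 24 <= expR y.
    have := expR_ge1Dxn 3 (ltW y0); have -> : (4`!)%:R = 24 :> R by [].
    lra.
  have P0 : 0 < lam ^+ 4 * n%:R ^+ 2 by rewrite mulr_gt0 // exprn_gt0.
  rewrite expRN -[A0 / _]invrK lef_pV2 ?posrE ?expR_gt0 ?invr_gt0 ?divr_gt0 ?exprn_gt0 //.
  apply: le_trans e24.
  have -> : (A0 / n%:R ^+ 2)^-1 = lam ^+ 4 * n%:R ^+ 2 / 24.
    by rewrite /A0; field; rewrite (gt_eqF lam0) (gt_eqF nR).
  by rewrite ler_pM2r ?invr_gt0.
have [M HM] : exists M : R, forall n, Ssum n bb <= M.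
  pose n1 := maxn n0 1.
  exists (1 + n1%:R + 2 * A0) => n.
  have B k : (0 < k)%N -> (k%:R ^+ 2)^-1 <= 2 * (k%:R^-1 - k.+1%:R^-1) :> R.
    move=> k0; have kR : 0 < k%:R :> R by rewrite ltr0n.
    have kR1 : 1 <= k%:R :> R by rewrite ler1n.
    have kS : 0 < k.+1%:R :> R by rewrite ltr0n.
    have -> : 2 * (k%:R^-1 - k.+1%:R^-1) = 2 / (k%:R * k.+1%:R) :> R.
      by rewrite -natr1; field; rewrite !lt0r_neq0 //; lra.
    rewrite ler_pdivlMr ?mulr_gt0 // mulrC ler_pdivrMr ?exprn_gt0 //.
    by rewrite -natr1; nra.
  have ind k : Ssum (n1 + k) bb <= 1 + n1%:R + 2 * A0 * (n1%:R^-1 - (n1 + k)%:R^-1).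
    elim: k => [|k IH]; first by rewrite addn0 subrr mulr0 addr0 S_le.
    rewrite addnS /Ssum big_ord_recr /= addrA -/(Ssum _ _).
    have p0 : (0 < n1 + k)%N by rewrite addn_gt0 /n1 leq_max orbT.
    have := poly (n1 + k)%N; rewrite (leq_trans (leq_maxl n0 1)) ?leq_addr // p0.
    move=> /(_ isT isT) h1; have h2 := ler_wpM2l (ltW A00) (B _ p0).
    apply: le_trans (lerD IH (le_trans h1 h2)) _.
    by rewrite le_eqVlt; apply/orP; left; apply/eqP; ring.
  have n1R : n1%:R^-1 <= 1 :> R.
    have : (0 < n1)%N by rewrite /n1 leq_max orbT.
    by move=> n1p; rewrite invf_le1 ?ltr0n // ler1n.
  apply: (@le_trans _ _ (Ssum (n1 + n) bb)).
    rewrite lerD2l -!(big_mkord xpredT (fun k => m k bb)).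
    rewrite [X in _ <= X](@big_cat_nat _ _ _ n) ?leq_addl //=.
    by rewrite lerDl sumr_ge0 // => k _; exact: m0.
  apply: le_trans (ind n) _; rewrite lerD2l -[X in _ <= X]mulr1.
  apply: ler_wpM2l; first by rewrite mulr_ge0 // ltW.
  have : 0 <= (n1 + n)%:R^-1 :> R by rewrite invr_ge0.
  lra.
have M0 : 0 < M by apply: lt_le_trans (HM 0%N); apply: lt_le_trans (S_ge1 0 bbb).
exists (h / (C * M)), 1; split=> //; first by rewrite divr_gt0 // mulr_gt0.
move=> n; rewrite mul1r.
have := decay_of_bounded_sum (lexx b0) bb0 (le_trans bbba (ltW ba1)) (HM n).
congr (_ <= expR (- _)); rewrite /bb; ring.
Qed.

End DifferentialInequality.

(** * Infinite volume and the critical point *)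

Section Conclusion.
Context {R : realType} {d : nat}.
Import numFieldNormedType.Exports.
Local Open Scope classical_set_scope.

(** On a divergent sequence [limn] takes the default value 0, which [0 <= M] covers. *)
Lemma limn_le_of_nonneg (u : nat -> R) (M : R) (N : nat) :
  0 <= M -> (forall n, (N <= n)%N -> u n <= M) -> limn u <= M.
Proof.
move=> M0 uM; have [cu|ncu] := pselect (cvgn u); last by rewrite (dvgP ncu).
by apply: limr_le => //; exists N.
Qed.

Lemma plus_corr_le (beta Delta M : R) (x : site d) : 0 <= beta -> 0 <= M ->
  (forall n, (norm_inf x <= n)%N ->
    BC_expect beta Delta (fun s : config d n => plus_ext s (@origin d) * plus_ext s x) <= M) ->
  plus_corr beta Delta x <= M.
Proof. by move=> b0 M0 H; apply: limn_le_of_nonneg M0 H. Qed.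

Lemma corr_le1 (beta Delta : R) (x : site d) n : 0 <= beta ->
  BC_expect beta Delta (fun s : config d n => plus_ext s (@origin d) * plus_ext s x) <= 1.
Proof.
move=> b0; rewrite BC_expectE.
rewrite -(expect_cst (@src d n) (@tgt d n) (@coupling R d beta n) (@bfield R d beta n) (expR_gt0 Delta) unrevealed 1).
apply: expect_le; first exact: expR_gt0.
have p3 (s : config d n) y : [\/ plus_ext s y = -1 :> R, plus_ext s y = 0 :> R | plus_ext s y = 1 :> R].
  have [yn|yn] := boolP (inbox n y); first by rewrite plus_extE //; exact: sv_cases.
  by constructor 3; exact: plus_ext_out.
by move=> s _; case: (p3 s (@origin d)) => ->; case: (p3 s x) => ->; lra.
Qed.

(** The magnetization decreases in the box, so it converges; a positive limit would put [b] in the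
    set whose infimum is [beta_c]. *)
Lemma mag_to0 (b Delta : R) : 0 < b -> b < beta_c d Delta ->
  forall eps, 0 < eps -> exists n0, forall n, (n0 <= n)%N -> @magn R d b Delta n <= eps.
Proof.
move=> b0 bc eps eps0.
pose u n := @magn R d b Delta n.
have cu : cvgn u.
  apply: nonincreasing_is_cvgn.
    by move=> k n kn; apply: magn_anti => //; exact: ltW.
  by exists 0 => _ [n _ <-]; apply: magn_ge0; exact: ltW.
have lu : limn u <= 0.
  rewrite leNgt; apply/negP => l0; move: bc; rewrite ltNge => /negP; apply.
  apply: ge_inf; first by exists 0 => x [x0 _]; exact: ltW.
  by split.
have /cvgrPdist_le/(_ eps eps0)[n0 _ H] := cu.
exists n0 => n nn; have := H n nn; rewrite /= -/(u n) => h.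
have := ler_norm (u n - limn u); rewrite distrC; lra.
Qed.

Lemma magn_ndecr (Delta : R) n (x y : R) : 0 <= x -> x <= y -> @magn R d x Delta n <= @magn R d y Delta n.
Proof.
move=> x0 xy; apply: (@derive_ndecr R (fun b => @magn R d b Delta n) (fun b => @dmagn R d b Delta n)) => //.
  by move=> t _; exact: magn_derive.
by move=> t /andP[xt _]; apply: dmagn_ge0; exact: le_trans xt.
Qed.

(** [exp_decay] is applied between [beta] and the midpoint to [beta_c]. Monotonicity in [beta] makes
    the constants uniform there: [1 - magn 0] is smallest at the right end, [bond_lb_cst] at the
    left end. *)
Lemma magn_exp_decay (beta Delta : R) : 0 < beta -> beta < beta_c d Delta ->
  exists c A : R, [/\ 0 < c, 0 < A & forall n, @magn R d beta Delta n <= A * expR (- (c * n%:R))].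
Proof.
move=> b0 bc.
pose b1 := (beta + beta_c d Delta) / 2.
have [bb1 b1c] : beta < b1 /\ b1 < beta_c d Delta by rewrite /b1; split; lra.
have b10 : 0 < b1 by exact: lt_trans bb1.
pose g := 1 - @magn R d b1 Delta 0.
have g0 : 0 < g by rewrite subr_gt0 magn_lt1 // ltW.
pose q := bond_lb_cst beta Delta.
have e0 : 0 < expR Delta by exact: expR_gt0.
have r0 : 0 < (2 * expR Delta / (1 + 2 * expR Delta)) ^+ 2.
  by rewrite exprn_gt0 // divr_gt0 ?mulr_gt0 // addr_gt0 // mulr_gt0.
have q0pos t : 0 < t -> 0 < bond_lb_cst t Delta.
  move=> t0; rewrite mulr_gt0 // divr_gt0 // subr_gt0 -expR0 ltr_expR; lra.
have qpos : 0 < q by exact: q0pos.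
have qt t : beta <= t -> q <= bond_lb_cst t Delta.
  move=> bt; rewrite /q /bond_lb_cst ler_wpM2r ?(ltW r0) // ler_wpM2r // lerD2l lerN2 ler_expR; lra.
have gq : 0 < g * q by exact: mulr_gt0.
apply: (@exp_decay R (fun n t => @magn R d t Delta n) (fun n t => @dmagn R d t Delta n) beta b1
   (12 / (g * q)) bb1) => //.
- by rewrite divr_gt0.
- by move=> n t _; exact: magn_derive.
- by move=> n t /andP[bt _]; apply: dmagn_ge0; apply: le_trans bt; exact: ltW.
- by move=> n t /andP[bt _]; apply: magn_ge0; apply: le_trans bt; exact: ltW.
- by move=> n t /andP[bt _]; apply/ltW/magn_lt1; apply: le_trans bt; exact: ltW.
- move=> n t /andP[bt tb1].
  have t0 : 0 < t by exact: lt_le_trans bt.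
  have H := @diff_ineq R d t Delta (ltW t0) n (q0pos _ t0).
  have -> : 12 / (g * q) * Ssum (fun n t => @magn R d t Delta n) n t * @dmagn R d t Delta n =
     (12 * @magn_sum R d t Delta n * @dmagn R d t Delta n) / (g * q).
    by rewrite /Ssum /magn_sum; ring.
  rewrite ler_pdivlMr //; apply: le_trans H.
  rewrite -[X in _ <= X]mulrA; apply: ler_wpM2l.
    by apply: mulr_ge0 => //; apply: magn_ge0; exact: ltW.
  apply: ler_pM; [exact: ltW|exact: ltW| |exact: qt].
  by rewrite lerD2l lerN2; apply: magn_ndecr => //; exact: ltW.
- exact: mag_to0.
Qed.

End Conclusion.

Theorem theorem1p3 (R : realType) (d : nat) (Delta beta : R) :
  (2 <= d)%N -> 0 < beta -> beta < beta_c d Delta ->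
  exists c : R, 0 < c /\
    forall x : site d,
      plus_corr beta Delta x <= expR (- (c * (norm_inf x)%:R)).
Proof.
move=> _ b0 bc; have [c0 [A [c00 A0 HA]]] := magn_exp_decay b0 bc.
have b0' := ltW b0.
(* Bounds all magnetizations by a number below 1, which handles the finitely many small norms;
   [2^-1] keeps it positive for the logarithm. *)
pose q := Num.max (@magn R d beta Delta 0) (2^-1).
have q0 : 0 < q by rewrite lt_max invr_gt0 ltr0n orbT.
have q1 : q < 1 by rewrite gt_max magn_lt1 //=; lra.
have mq k : @magn R d beta Delta k <= q.
  by rewrite le_max (@magn_anti R d beta Delta b0' k 0).
pose L := ln (A * expR c0).
(* From this norm on, [L] is at most half of [c0 * norm_inf x], so the prefactor is absorbed by
   halving the rate. *)
pose N1 := (Num.bound (`|2 * L / c0|)).+1.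
have N1L : 2 * L / c0 <= N1%:R.
  apply: le_trans (ler_norm _) _; apply: le_trans (ltW (archi_boundP (normr_ge0 _))) _.
  by rewrite ler_nat.
have N1p : 0 < N1%:R :> R by rewrite ltr0n.
have lq : 0 < - ln q by rewrite oppr_gt0 ln_lt0 // q0.
exists (Num.min (c0 / 2) (- ln q / N1%:R)); split.
  by rewrite lt_min !divr_gt0.
move=> x; set c := Num.min _ _.
have cA : c <= c0 / 2 by rewrite ge_min lexx.
have cq : c <= - ln q / N1%:R by rewrite ge_min lexx orbT.
(* At the origin no box can be frozen just short of [x]; the required bound is 1. *)
case eN : (norm_inf x) => [|N].
  by rewrite mulr0 oppr0 expR0; apply: plus_corr_le => // n _; exact: corr_le1.
apply: plus_corr_le => //.
rewrite eN => n nN; apply: (@le_trans _ _ (@magn R d beta Delta N)).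
  by apply: corr_le => //; rewrite eN.
have NR : 0 <= N.+1%:R :> R by [].
have [big|small] := leqP N1 N.+1; last first.
  apply: le_trans (mq N) _; rewrite -[X in X <= _](lnK (_ : q \in Num.pos)) ?posrE //.
  rewrite ler_expR lerNr; apply: le_trans (ler_wpM2r NR cq) _.
  rewrite mulrAC ler_pdivrMr // ler_wpM2l ?(ltW lq) // ler_nat; exact: ltnW.
apply: le_trans (HA N) _.
have -> : A * expR (- (c0 * N%:R)) = expR (L - c0 * N.+1%:R).
  rewrite expRD /L lnK ?posrE ?mulr_gt0 ?expR_gt0 // -mulrA -expRD.
  by congr (_ * expR _); rewrite -natr1; ring.
rewrite ler_expR.
have H1 : 2 * L / c0 <= N.+1%:R by apply: le_trans N1L _; rewrite ler_nat.
rewrite ler_pdivrMr // in H1.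
have H2 := ler_wpM2r NR cA; lra.
Qed.
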